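(* Let $N=\operatorname{rank}(L)$ be even and let $k,m\in\mathbb{N}$ with $k$ even and $k>2+N$. Then $E_{k,m}$ is a holomorphic Jacobi form on $\mathcal{H}\times(L\otimes\mathbb{C})$. Setting $\Delta(n,\lambda)=nm-\frac12(\lambda,\lambda)$, the Fourier expansion of $E_{k,m}$ is \[E_{k,m}(\tau,\mathfrak{z})=\Theta_{mS,0,0}(\tau,\mathfrak{z})+\sum_{n=1}^{\infty}\sum_{\substack{\lambda\in S^{-1}\mathbb{Z}^N\\ nm>\frac12(\lambda,\lambda)}}\beta_{k,m}(n,\lambda)e^{2\pi\mathrm{i} n\tau}e^{2\pi\mathrm{i}(\lambda,\mathfrak{z})}\] with \[\begin{aligned}\beta_{k,m}(n,\lambda)=&\frac{(-2\pi\mathrm{i}/q(L))^{k-N/2}}{(k-N/2-1)!}\cdot\frac{(\det S)^{-1/2}}{\mathrm{i}^{N/2}}\,(q(L)\Delta(n,\lambda))^{k-N/2-1}\sum_{\substack{c\in\mathbb{N}\\ d'\bmod mc\\ (c,d')=1}}(mc)^{-k}\\&\times\sum_{\substack{x\in L\\ x\bmod c}}\exp\Big\{\frac{\pi\mathrm{i}}{c}\big(ma(x,x)-2(\lambda,x)+2nd'\big)\Big\}\\&\times\sum_{\nu\bmod q(L)}\exp(2\pi\mathrm{i} nm\nu)\exp(\pi\mathrm{i}\nu(\lambda+L,\lambda+L))\exp(-\pi\mathrm{i}\nu(\lambda,\lambda)).\end{aligned}\]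
   Context: $L=\mathbb{Z}^N$ with Gram matrix $S\in\mathbb{Z}^{N\times N}$ symmetric positive definite with even diagonal, $(x,y)=x^tSy$ extended $\mathbb{C}$-bilinearly to $\mathbb{C}^N$; $L^\vee=S^{-1}\mathbb{Z}^N$. The discriminant form is $(\lambda+L,\lambda+L)=(\lambda,\lambda)+2\mathbb{Z}\in\mathbb{Q}/2\mathbb{Z}$ (so $\exp(\pi\mathrm{i}\nu(\lambda+L,\lambda+L))$ is well defined for integer $\nu$). The level is $q(L)=\min\{\mu\in\mathbb{N}\,|\,\mu(p,p)\in2\mathbb{Z}\text{ for all }p\in L^\vee\}$. In the sum over $(c,d')$, $a$ denotes an integer with $ad'\equiv1\bmod c$ (the upper-left entry of a matrix in $\mathrm{SL}(2,\mathbb{Z})$ with lower row $(c,d)$, $d\equiv d'\bmod c$). $x\bmod c$ means $x$ runs over $L/cL$. Slash actions: $(\phi|_{k,m}\left(\begin{smallmatrix}a&b\\c&d\end{smallmatrix}\right))(\tau,\mathfrak{z})=(c\tau+d)^{-k}e^{-\pi\mathrm{i} m\frac{c(\mathfrak{z},\mathfrak{z})}{c\tau+d}}\phi(\frac{a\tau+b}{c\tau+d},\frac{\mathfrak{z}}{c\tau+d})$ and $(\phi|_m[x,y])(\tau,\mathfrak{z})=e^{\pi\mathrm{i} m((x,x)\tau+2(x,\mathfrak{z}))}\phi(\tau,\mathfrak{z}+x\tau+y)$ ($x,y\in L$), defining an action of $\Gamma^J=\mathrm{SL}(2,\mathbb{Z})\ltimes(L\times L)$. A holomorphic Jacobi form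 of weight $k$ and index $m$ is a holomorphic $\phi$ on $\mathcal{H}\times\mathbb{C}^N$ with $\phi|_{k,m}g=\phi$ for all $g\in\Gamma^J$ and a Fourier expansion $\sum_{n\in\mathbb{Z},l\in L^\vee,2nm-(l,l)\ge0}f(n,l)e^{2\pi\mathrm{i} n\tau+2\pi\mathrm{i}(l,\mathfrak{z})}$. With $\Gamma^J_\infty=\{g\,;\,1|_{k,m}g=1\}$, the Jacobi–Eisenstein series is $E_{k,m}=\sum_{g\in\Gamma^J_\infty\backslash\Gamma^J}1|_{k,m}g$, explicitly $E_{k,m}(\tau,\mathfrak{z})=\frac12\sum_{\gcd(c,d)=1}\sum_{x\in L}(c\tau+d)^{-k}\exp\big(\pi\mathrm{i} m\frac{(x,x)(a\tau+b)+2(x,\mathfrak{z})-c(\mathfrak{z},\mathfrak{z})}{c\tau+d}\big)$ with $ad-bc=1$. $\Theta_{mS,0,0}(\tau,\mathfrak{z})=\sum_{x\in\mathbb{Z}^N}\exp(\pi\mathrm{i} m((x,x)\tau+2(x,\mathfrak{z})))$. *)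

(* Defs.v *)
From HB Require Import structures.
From mathcomp Require Import all_boot all_order all_algebra.
From mathcomp Require Import finmap complex.
From mathcomp Require Import all_classical all_reals all_analysis.
From mathcomp.analysis.showcase Require summability.

Set Implicit Arguments.
Unset Strict Implicit.
Unset Printing Implicit Defensive.

Import Order.TTheory GRing.Theory Num.Theory.
Import numFieldNormedType.Exports.

Local Open Scope classical_set_scope.
Local Open Scope ring_scope.
Local Open Scope complex_scope.

(* Unordered (equivalently, absolutely convergent) sums of complex families:
   limits of the finite partial sums along the directed set of finite subsets. *)
Definition psum (R : realType) (I : choiceType) (D : set I) (f : I -> R[i]) :
    {fset I} -> R[i]^o :=
  summability.partial_sum (patch (fun=> 0) D f).

Definition csummable (R : realType) (I : choiceType) (D : set I)
    (f : I -> R[i]) : Prop :=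
  cvg (psum D f @ summability.totally).

(* Only meaningful when [csummable D f]. *)
Definition csum (R : realType) (I : choiceType) (D : set I) (f : I -> R[i]) :
    R[i] :=
  lim (psum D f @ summability.totally).

Definition cexp (R : realType) (z : R[i]) : R[i] :=
  Complex (expR (complex.Re z) * cos (complex.Im z))
          (expR (complex.Re z) * sin (complex.Im z)).

Definition ipi (R : realType) : R[i] := Complex 0 (pi : R).

Definition upper_half (R : realType) : set R[i] :=
  [set tau | 0 < complex.Im tau].

Definition bil (F : pzRingType) (N : nat) (S : 'M[int]_N) (x y : 'cV[F]_N) : F :=
  (x^T *m map_mx intr S *m y) 0 0.

Definition even_lattice (R : realType) (N : nat) (S : 'M[int]_N) : Prop :=
  [/\ S^T = S,
      forall x : 'cV[R]_N, x != 0 -> 0 < bil S x x &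
      forall i, (2 %| S i i)%Z].

Definition intv (F : pzRingType) (N : nat) (x : 'cV[int]_N) : 'cV[F]_N :=
  map_mx intr x.

Definition ratv (R : realType) (N : nat) (l : 'cV[rat]_N) : 'cV[R[i]]_N :=
  map_mx ratr l.

Definition dual_lattice (N : nat) (S : 'M[int]_N) : set 'cV[rat]_N :=
  [set invmx (map_mx intr S) *m intv rat h | h in [set: 'cV[int]_N]].

Definition is_level (N : nat) (S : 'M[int]_N) (q : nat) : Prop :=
  let P (mu : nat) := (0 < mu)%N /\
    forall p, dual_lattice S p -> exists t : int, mu%:R * bil S p p = (2 * t)%:~R
  in P q /\ forall mu, P mu -> (q <= mu)%N.

(* The default value 0 is never reached for an even lattice. *)
Definition level (N : nat) (S : 'M[int]_N) : nat := xget 0%N (is_level S).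

(* (l + L, l + L) = (l, l) + 2Z in Q/2Z, through the representative in [0, 2[. *)
Definition disc_form (N : nat) (S : 'M[int]_N) (l : 'cV[rat]_N) : rat :=
  bil S l l - 2 * (Num.floor (bil S l l / 2))%:~R.

Definition slash_SL2 (R : realType) (N : nat) (S : 'M[int]_N) (k m : nat)
    (M : 'M[int]_2) (phi : R[i] -> 'cV[R[i]]_N -> R[i]) :
    R[i] -> 'cV[R[i]]_N -> R[i] :=
  fun tau z =>
    let a := (M 0 0)%:~R in let b := (M 0 1)%:~R in
    let c := (M 1 0)%:~R in let d := (M 1 1)%:~R in
    let j := c * tau + d in
    j ^- k * cexp (- (ipi R * m%:R * (c * bil S z z / j)))
      * phi ((a * tau + b) / j) (j^-1 *: z).

Definition slash_heis (R : realType) (N : nat) (S : 'M[int]_N) (m : nat)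
    (x y : 'cV[int]_N) (phi : R[i] -> 'cV[R[i]]_N -> R[i]) :
    R[i] -> 'cV[R[i]]_N -> R[i] :=
  fun tau z =>
    let x' := intv R[i] x in let y' := intv R[i] y in
    cexp (ipi R * m%:R * (bil S x' x' * tau + 2 * bil S x' z))
      * phi tau (z + tau *: x' + y').

Definition expo (R : realType) (N : nat) (S : 'M[int]_N) (n : int)
    (l : 'cV[rat]_N) (tau : R[i]) (z : 'cV[R[i]]_N) : R[i] :=
  cexp (2 * ipi R * n%:~R * tau) * cexp (2 * ipi R * bil S (ratv R l) z).

(* C x C^N as a normed space over C, so that [differentiable] is complex Fréchet
   differentiability. *)
Definition CxCN (R : realType) (N : nat) : normedModType R[i] :=
  (R[i]^o * 'cV[R[i]]_N)%type.

Definition holomorphic_HC (R : realType) (N : nat)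
    (phi : R[i] -> 'cV[R[i]]_N -> R[i]) : Prop :=
  forall p : CxCN R N, upper_half (p.1 : R[i]) ->
    differentiable (fun w : CxCN R N => phi w.1 w.2 : R[i]^o) p.

(* Every element of SL(2,Z) |x (L x L) is a product M [x, y]. *)
Definition jacobi_form (R : realType) (N : nat) (S : 'M[int]_N) (k m : nat)
    (phi : R[i] -> 'cV[R[i]]_N -> R[i]) : Prop :=
  [/\ holomorphic_HC phi,
      forall (M : 'M[int]_2) (x y : 'cV[int]_N) tau z,
        \det M = 1 -> upper_half tau ->
        slash_heis S m x y (slash_SL2 S k m M phi) tau z = phi tau z &
      exists f : int -> 'cV[rat]_N -> R[i], forall tau z, upper_half tau ->
        let D := [set p : int * 'cV[rat]_N |
          dual_lattice S p.2 /\ 0 <= 2 * p.1%:~R * m%:R - bil S p.2 p.2] in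
        let t := fun p : int * 'cV[rat]_N => f p.1 p.2 * expo S p.1 p.2 tau z in
        csummable D t /\ phi tau z = csum D t].

(* For coprime c, d, [egcdz c d = (u, v)] with u c + v d = 1, so a := v and
   b := - u satisfy a d - b c = 1. As (x, x) is even on L, the exponentials
   below do not depend on this choice. *)
Definition bez_a (c d : int) : int := (egcdz c d).2.
Definition bez_b (c d : int) : int := - (egcdz c d).1.

Definition eis_index (N : nat) : set (int * int * 'cV[int]_N) :=
  [set p | coprimez p.1.1 p.1.2].
Arguments eis_index : clear implicits.

Definition eis_term (R : realType) (N : nat) (S : 'M[int]_N) (k m : nat)
    (tau : R[i]) (z : 'cV[R[i]]_N) (p : int * int * 'cV[int]_N) : R[i] :=
  let c := p.1.1%:~R in let d := p.1.2%:~R in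
  let a := (bez_a p.1.1 p.1.2)%:~R in let b := (bez_b p.1.1 p.1.2)%:~R in
  let x := intv R[i] p.2 in
  let j := c * tau + d in
  j ^- k * cexp (ipi R * m%:R *
    ((bil S x x * (a * tau + b) + 2 * bil S x z - c * bil S z z) / j)).

Definition eisenstein (R : realType) (N : nat) (S : 'M[int]_N) (k m : nat)
    (tau : R[i]) (z : 'cV[R[i]]_N) : R[i] :=
  2^-1 * csum (eis_index N) (eis_term S k m tau z).

Definition theta (R : realType) (N : nat) (S : 'M[int]_N) (m : nat)
    (tau : R[i]) (z : 'cV[R[i]]_N) : R[i] :=
  csum [set: 'cV[int]_N] (fun x => let x' := intv R[i] x in
    cexp (ipi R * m%:R * (bil S x' x' * tau + 2 * bil S x' z))).

Definition Delta (N : nat) (S : 'M[int]_N) (m : nat) (n : int)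
    (l : 'cV[rat]_N) : rat :=
  n%:~R * m%:R - 2^-1 * bil S l l.

Definition beta_index (m : nat) : set (nat * nat) :=
  [set p | [/\ (0 < p.1)%N, (p.2 < m * p.1)%N & coprime p.1 p.2]].

(* [p = (c, d')]; the sum over x ranges over the representatives of L / cL with
   coordinates in {0, ..., c - 1}. *)
Definition beta_term (R : realType) (N : nat) (S : 'M[int]_N) (k m : nat)
    (n : int) (l : 'cV[rat]_N) (p : nat * nat) : R[i] :=
  let c := p.1 in let d' := p.2 in
  let a := (bez_a c%:Z d'%:Z)%:~R in
  let l' := ratv R l in
  (m * c)%:R ^- k
  * (\sum_(x : 'cV['I_c]_N)
       let x' := intv R[i] (map_mx (fun i : 'I_c => (i : nat)%:Z) x) in
       cexp (ipi R / c%:R *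
         (m%:R * a * bil S x' x' - 2 * bil S l' x' + 2 * n%:~R * d'%:R)))
  * (\sum_(nu < level S)
       cexp (2 * ipi R * n%:~R * m%:R * (nu : nat)%:R)
       * cexp (ipi R * (nu : nat)%:R * ratr (disc_form S l))
       * cexp (- (ipi R * (nu : nat)%:R * bil S l' l'))).

Definition beta (R : realType) (N : nat) (S : 'M[int]_N) (k m : nat)
    (n : int) (l : 'cV[rat]_N) : R[i] :=
  (- (2 * ipi R) / (level S)%:R) ^+ (k - N./2) / ((k - N./2 - 1)`!)%:R
  * (((Num.sqrt (\det S)%:~R : R)^-1)%:C / 'i%C ^+ N./2)
  * ((level S)%:R * ratr (Delta S m n l)) ^+ (k - N./2 - 1)
  * csum (beta_index m) (beta_term R S k m n l).

Definition fourier_index (N : nat) (S : 'M[int]_N) (m : nat) :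
    set (int * 'cV[rat]_N) :=
  [set p | [/\ 1 <= p.1, dual_lattice S p.2 &
               2^-1 * bil S p.2 p.2 < p.1%:~R * m%:R]].

(* Main.v *)
(* The series is split according to the lower left entry c.  The terms with c = 0 give the
   theta series, and those with c < 0 repeat those with c > 0 because k is even.  For
   c > 0 write d = d' + c n and x = r - c y with d', r running over residues modulo c.
   The sum over y is a theta series in z - r / c, which the N-dimensional theta
   transformation turns into a sum over the dual lattice; the sum over n is then evaluated by
   the Lipschitz formula twisted by exp (2 pi i alpha n) with alpha = (lambda, lambda) / (2 m),
   and the remaining sum over c is the singular series in the coefficient beta.

   The theta transformation is reduced to dimension one by completing squares (Schur
   complements).  There, and in the Lipschitz formula, the integral of the usual Poisson
   summation is avoided: a filter by roots of unity gives an exact identity between the sum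
   and Riemann sums of mesh 1 / l, and l goes to infinity by dominated convergence
   (Tannery's theorem).

   Holomorphy is read off the Fourier expansion: absolute convergence at points whose
   imaginary parts are slightly shifted dominates the second order Taylor remainders of the
   exponentials.  Invariance is obtained by reindexing the absolutely convergent series. *)

From HB Require Import structures.
Require Import Defs.
From mathcomp Require Import all_boot all_order all_algebra.
From mathcomp Require Import finmap complex.
From mathcomp Require Import all_classical all_reals all_analysis.
From mathcomp Require Import ring lra zify.
From mathcomp.analysis.showcase Require summability.

Set Implicit Arguments.
Unset Strict Implicit.
Unset Printing Implicit Defensive.

Import Order.TTheory GRing.Theory Num.Theory.
Import numFieldNormedType.Exports.
Import Normc.

Local Open Scope classical_set_scope.
Local Open Scope ring_scope.
Local Open Scope complex_scope.

(** * Unordered sums of complex families *)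

(** Two constants are obtained without any integral. Every Gaussian Riemann sum is asymptotic to an
    explicit multiple of the one for [exp (- pi x ^ 2)]; the limit of the latter is forced by
    applying the Poisson identity to that self-dual Gaussian, whose sum over the integers is
    nonzero. In the Lipschitz formula the Riemann sums are polylogarithms of negative order,
    rational in [exp (2 pi i w)], and their pole at [w = 0] supplies the constant. Convergence: the
    sum over [x] costs a factor [|c tau + d| ^ N], and parity turns [k > N + 2] into [k >= N + 4],
    so at most the order [|c tau + d| ^ -4] remains, which lies below a product of two summable
    one-variable majorants. Since [N] is even, the root in the theta transformation is an integral
    power, and the exponent in the sum over [n] drops from [k] to [k - N / 2]. In the coefficient
    every term of the sum over [nu] is 1, so this sum equals the level, and the sum over
    [d' mod m c] is [m] copies of one over [d mod c]. The level then cancels, and the powers of [m]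
    reduce to the [m ^ (- N / 2)] of the theta transformation. *)

Section ComplexModulus.
Variable R : realType.
Implicit Types x y z : R[i].

Lemma normcE' z : `|z| = (normc z)%:C.
Proof. by []. Qed.

Lemma normc_ge0 z : 0 <= normc z.
Proof. by case: z => a b; rewrite /normc sqrtr_ge0. Qed.

Lemma normcD x y : normc (x + y) <= normc x + normc y.
Proof. exact: le_normcD. Qed.

Lemma normcB x y : normc (x - y) <= normc x + normc y.
Proof. by rewrite -[normc y]normcN; exact: normcD. Qed.

Lemma normc_distC x y : normc (x - y) = normc (y - x).
Proof. by rewrite -[LHS]normcN opprB. Qed.

Lemma normc_dist_triangle x y z : normc (x - z) <= normc (x - y) + normc (y - z).
Proof. by have := normcD (x - y) (y - z); rewrite addrA subrK. Qed.

Lemma normc_eq0 z : (normc z == 0) = (z == 0).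
Proof.
apply/eqP/eqP => [/eq0_normc //|->]; exact: normc0.
Qed.

Lemma normc_gt0 z : (0 < normc z) = (z != 0).
Proof. by rewrite lt_def normc_eq0 normc_ge0 andbT. Qed.

Lemma normc_real (a : R) : normc a%:C = `|a|.
Proof. by rewrite /normc/= expr0n /= addr0 sqrtr_sqr. Qed.

Lemma normcX z n : normc (z ^+ n) = normc z ^+ n.
Proof. by elim: n => [|n IHn]; rewrite ?expr0 ?normc1 // !exprS normcM IHn. Qed.

Lemma normc_nat n : normc (n%:R : R[i]) = n%:R.
Proof.
by rewrite -(rmorph_nat (real_complex R)) normc_real ger0_norm ?ler0n.
Qed.

Lemma normc_int (n : int) : normc (n%:~R : R[i]) = `|n%:~R|.
Proof. by rewrite -(rmorph_int (real_complex R)) normc_real. Qed.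

Lemma normc_sum (I : Type) (s : seq I) (P : pred I) (F : I -> R[i]) :
  normc (\sum_(i <- s | P i) F i) <= \sum_(i <- s | P i) normc (F i).
Proof.
elim/big_rec2: _ => [|i y1 y2 _ IH]; first by rewrite normc0.
by apply: le_trans (normcD _ _) _; rewrite lerD2l.
Qed.

Lemma normc_Re z : `|complex.Re z| <= normc z.
Proof.
case: z => a b; rewrite /= -sqrtr_sqr ler_wsqrtr // lerDl sqr_ge0 //.
Qed.

Lemma normc_Im z : `|complex.Im z| <= normc z.
Proof.
case: z => a b; rewrite /= -sqrtr_sqr ler_wsqrtr // lerDr sqr_ge0 //.
Qed.

Lemma normc_sqr z : normc z ^+ 2 = complex.Re z ^+ 2 + complex.Im z ^+ 2.
Proof. by case: z => a b; rewrite /= sqr_sqrtr // addr_ge0 ?sqr_ge0. Qed.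

Lemma normc_le_ReIm z : normc z <= `|complex.Re z| + `|complex.Im z|.
Proof.
rewrite -(@ler_pXn2r _ 2) ?nnegrE ?normc_ge0 ?addr_ge0 //.
rewrite normc_sqr sqrrD !real_normK ?num_real //.
by rewrite -subr_ge0; set a := _ ^+ 2; set b := _ ^+ 2; set c := _ *+ _;
  rewrite (_ : _ - _ = c); [rewrite mulrn_wge0 // mulr_ge0|ring].
Qed.

Lemma normc_eps0 z : (forall e : R, 0 < e -> normc z < e) -> z = 0.
Proof.
move=> h; apply/eqP; rewrite -normc_eq0 eq_le normc_ge0 andbT leNgt.
by apply/negP => /h; rewrite ltxx.
Qed.

End ComplexModulus.

Section FiniteSums.
Variables (R : realType) (I : choiceType).

Lemma ler_sum_subseq (g : I -> R) (s s' : seq I) :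
  (forall i, 0 <= g i) -> uniq s -> {subset s <= s'} ->
  \sum_(i <- s) g i <= \sum_(i <- s') g i.
Proof.
move=> g0; elim: s s' => [|i s IHs] s' /=.
  by rewrite big_nil sumr_ge0.
move=> /andP[nis us] ss; rewrite big_cons.
have is' : i \in s' by rewrite ss ?mem_head.
rewrite [leRHS](perm_big _ (perm_to_rem is')) /= big_cons lerD2l.
apply: IHs => // j js; have : j \in i :: rem i s'.
  by rewrite -(perm_mem (perm_to_rem is')) ss // inE js orbT.
by rewrite inE => /orP[/eqP ji|//]; rewrite -ji js in nis.
Qed.

Lemma big_fsetDsub (V : zmodType) (f : I -> V) (J0 J : {fset I}) :
  (J0 `<=` J)%fset ->
  \sum_(i <- J) f i = \sum_(i <- J0) f i + \sum_(i <- (J `\` J0)%fset) f i.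
Proof.
move=> sub; rewrite -big_cat; apply: perm_big; apply: uniq_perm => //.
  rewrite cat_uniq !fset_uniq /= andbT; apply/hasPn => i.
  by rewrite in_fsetD => /andP[].
move=> i; rewrite mem_cat in_fsetD.
by case: (boolP (i \in J0)) => //= /(fsubsetP sub).
Qed.

Lemma big_fset_seq (V : zmodType) (f : I -> V) (s : seq I) :
  uniq s -> \sum_(i <- [fset x in s]%fset) f i = \sum_(i <- s) f i.
Proof.
move=> us; apply: perm_big; apply: uniq_perm => // i.
by rewrite in_fset.
Qed.

End FiniteSums.

(** An epsilon form of convergence along finite subsets, with the limit explicit and no domain, so
    that sums can be manipulated freely; [hsum_csum] translates back to [csum]. *)
Definition hsum (R : realType) (I : choiceType) (f : I -> R[i]) (s : R[i]) :=
  forall e : R, 0 < e -> exists J0 : {fset I}, forall J : {fset I},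
    (J0 `<=` J)%fset -> normc (\sum_(i <- J) f i - s) < e.

(** Duplicate-free lists instead of finite sets: such a bound passes through an injection by a plain
    [map]. *)
Definition sbound (R : realType) (I : choiceType) (g : I -> R) (M : R) :=
  forall s : seq I, uniq s -> \sum_(i <- s) g i <= M.

Definition asum (R : realType) (I : choiceType) (f : I -> R[i]) :=
  exists M, sbound (fun i => normc (f i)) M.

Section Hsum.
Variables (R : realType) (I : choiceType).
Implicit Types (f : I -> R[i]) (g : I -> R) (s t : R[i]).

Lemma sbound_ge0 g M : sbound g M -> 0 <= M.
Proof. by move=> /(_ [::] isT); rewrite big_nil. Qed.

Lemma sbound_le g g' M : (forall i, g i <= g' i) -> sbound g' M -> sbound g M.
Proof. by move=> le b s us; apply: le_trans (b s us); apply: ler_sum. Qed.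

Lemma sbound_leM g M M' : M <= M' -> sbound g M -> sbound g M'.
Proof. by move=> le b s us; apply: le_trans (b s us) le. Qed.

Lemma sboundZ (a : R) g M : 0 <= a -> sbound g M -> sbound (fun i => a * g i) (a * M).
Proof. by move=> a0 b s us; rewrite -mulr_sumr ler_wpM2l ?b. Qed.

Lemma sboundD g g' M M' :
  sbound g M -> sbound g' M' -> sbound (fun i => g i + g' i) (M + M').
Proof. by move=> b b' s us; rewrite big_split lerD ?b ?b'. Qed.

Lemma asum_le f g M : (forall i, normc (f i) <= g i) -> sbound g M -> asum f.
Proof. by move=> le b; exists M; apply: sbound_le b. Qed.

Lemma hsum_uniq f s t : hsum f s -> hsum f t -> s = t.
Proof.
move=> hs ht; apply/eqP; rewrite -subr_eq0; apply/eqP.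
apply: normc_eps0 => e e0; have e20 : 0 < e / 2 by rewrite divr_gt0.
have [J hJ] := hs _ e20; have [K hK] := ht _ e20.
have /hJ h1 := fsubsetUl J K; have /hK h2 := fsubsetUr J K.
apply: le_lt_trans (normc_dist_triangle _ (\sum_(i <- (J `|` K)%fset) f i) _) _.
by rewrite normc_distC [e]splitr ltrD.
Qed.

Lemma eq_hsum f f' s : f =1 f' -> hsum f s -> hsum f' s.
Proof. by move=> /funext ->. Qed.

Lemma eq_asum f f' : f =1 f' -> asum f -> asum f'.
Proof. by move=> /funext ->. Qed.

Lemma hsum0 : hsum (fun=> 0) 0 (I := I) (R := R).
Proof.
by move=> e e0; exists fset0 => J _; rewrite big1 // subr0 normc0.
Qed.

Lemma hsumD f f' s s' : hsum f s -> hsum f' s' ->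
  hsum (fun i => f i + f' i) (s + s').
Proof.
move=> hs ht e e0; have e20 : 0 < e / 2 by rewrite divr_gt0.
have [J hJ] := hs _ e20; have [K hK] := ht _ e20.
exists (J `|` K)%fset => L JKL; rewrite big_split /= opprD addrACA.
apply: le_lt_trans (normcD _ _) _; rewrite [e]splitr; apply: ltrD.
  by apply: hJ; apply: fsubset_trans JKL; apply: fsubsetUl.
by apply: hK; apply: fsubset_trans JKL; apply: fsubsetUr.
Qed.

Lemma hsumZ a f s : hsum f s -> hsum (fun i => a * f i) (a * s).
Proof.
move=> hs e e0; have a0 : 0 < normc a + 1 by rewrite ltr_wpDl ?normc_ge0.
have [J hJ] := hs (e / (normc a + 1)) (divr_gt0 e0 a0).
exists J => K /hJ; rewrite -mulr_sumr -mulrBr normcM ltr_pdivlMr // => h.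
apply: le_lt_trans h; rewrite mulrC ler_wpM2l ?normc_ge0 ?lerDl //.
Qed.

Lemma hsumN f s : hsum f s -> hsum (fun i => - f i) (- s).
Proof.
by move=> /(hsumZ (-1)); rewrite mulN1r; apply: eq_hsum => i; rewrite mulN1r.
Qed.

Lemma hsumB f f' s s' : hsum f s -> hsum f' s' ->
  hsum (fun i => f i - f' i) (s - s').
Proof. by move=> hs /hsumN; apply: hsumD. Qed.

Lemma hsum_bigsum (K : Type) (r : seq K) (F : K -> I -> R[i]) (S : K -> R[i]) :
  (forall k, hsum (F k) (S k)) ->
  hsum (fun i => \sum_(k <- r) F k i) (\sum_(k <- r) S k).
Proof.
move=> h; elim: r => [|k r IHr].
  by rewrite big_nil; apply: eq_hsum hsum0 => i; rewrite big_nil.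
rewrite big_cons; apply: eq_hsum (hsumD (h k) IHr) => i.
by rewrite big_cons.
Qed.

(** The supremum of the finite sums is reached up to [e] on some [J0]; a list disjoint from [J0] can
    only add what is missing. *)
Lemma sbound_tail g M : (forall i, 0 <= g i) -> sbound g M ->
  forall e : R, 0 < e -> exists J0 : {fset I}, forall s : seq I, uniq s ->
    {in s, forall i, i \notin J0} -> \sum_(i <- s) g i < e.
Proof.
move=> g0 b e e0.
pose E := [set x | exists J : {fset I}, x = \sum_(i <- J) g i].
have supE : has_sup E.
  split; first by exists (\sum_(i <- (fset0 : {fset I})) g i), fset0.
  by exists M => _ [J ->]; apply: b.
have [_ [J0 ->] hJ0] := sup_adherent e0 supE.
exists J0 => s us dis.
have us' : uniq (J0 ++ s).
  by rewrite cat_uniq fset_uniq us andbT; apply/hasPn => i /dis.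
have : \sum_(i <- [fset x in J0 ++ s]%fset) g i <= sup E.
  by apply: sup_upper_bound => //; eexists; reflexivity.
rewrite big_fset_seq // big_cat /= => h.
by move: hJ0 h; set u := \sum_(i <- J0) _; set v := \sum_(i <- s) _; lra.
Qed.

Lemma sbound_hsum g M : (forall i, 0 <= g i) -> sbound g M ->
  exists s, hsum (fun i => (g i)%:C) s.
Proof.
move=> g0 b.
pose E := [set x | exists J : {fset I}, x = \sum_(i <- J) g i].
have supE : has_sup E.
  split; first by exists (\sum_(i <- (fset0 : {fset I})) g i), fset0.
  by exists M => _ [J ->]; apply: b.
exists (sup E)%:C => e e0.
have [_ [J0 ->] hJ0] := sup_adherent e0 supE.
exists J0 => J J0J; rewrite -rmorph_sum -rmorphB normc_real.
have le1 : \sum_(i <- J) g i <= sup E.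
  by apply: sup_upper_bound => //; exists J.
have le2 : \sum_(i <- J0) g i <= \sum_(i <- J) g i.
  by apply: ler_sum_subseq => //; apply/fsubsetP.
by rewrite distrC ger0_norm ?subr_ge0 //; lra.
Qed.

(** Real and imaginary parts are split into positive and negative parts, and each of these
    nonnegative bounded families converges to its supremum. *)
Lemma asum_hsum f : asum f -> exists s, hsum f s.
Proof.
move=> [M b].
have aux (h : R[i] -> R) : (forall z, `|h z| <= normc z) ->
    exists s, hsum (fun i => (h (f i))%:C) s.
  move=> hle.
  have [||s1 h1] := @sbound_hsum (fun i => Num.max (h (f i)) 0) M.
  - by move=> i; rewrite le_max lexx orbT.
  - apply: sbound_le b => i; rewrite ge_max normc_ge0 andbT.
    by apply: le_trans (hle _); rewrite ler_norm.
  have [||s2 h2] := @sbound_hsum (fun i => Num.max (- h (f i)) 0) M.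
  - by move=> i; rewrite le_max lexx orbT.
  - apply: sbound_le b => i; rewrite ge_max normc_ge0 andbT.
    by apply: le_trans (hle _); rewrite -normrN ler_norm.
  exists (s1 - s2); apply: eq_hsum (hsumB h1 h2) => i.
  rewrite -rmorphB; congr (_%:C).
  by rewrite !maxEle; case: ifP; case: ifP; lra.
have [s1 h1] := aux _ (@normc_Re R); have [s2 h2] := aux _ (@normc_Im R).
exists (s1 + 'i * s2); apply: eq_hsum (hsumD h1 (hsumZ 'i h2)) => i.
by rewrite -complexE.
Qed.

Lemma hsum_normc_le f s M : hsum f s -> sbound (fun i => normc (f i)) M ->
  normc s <= M.
Proof.
move=> hs b; apply/ler_addgt0Pr => e e0.
have [J /(_ J (fsubset_refl _)) hJ] := hs e e0.
rewrite -[s](subrK (\sum_(i <- J) f i)) addrC.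
apply: le_trans (normcD _ _) _; apply: lerD.
  exact: le_trans (normc_sum _ _ _) (b _ (fset_uniq _)).
by rewrite normc_distC ltW.
Qed.

Lemma hsum_csum (D : set I) f s :
  hsum (fun i => if i \in D then f i else 0) s ->
  csummable D f /\ csum D f = s.
Proof.
move=> hs; have TF := @summability.totally_filter I.
have cv : psum D f @ summability.totally --> (s : R[i]^o).
  apply/cvgrPdist_lt => -[e e'] ee.
  (* The radius of a ball is an element of [R[i]], and positivity there forces it to be real. *)
  have /andP[/eqP e'0 e0] : (0 == e') && (0 < e).
    by move: ee; rewrite ltcE /= eq_sym.
  have [J hJ] := hs e e0.
  exists J => // K /= JK.
  rewrite distrC /psum /summability.partial_sum normcE' -e'0 ltcR.
  by have := hJ K JK; rewrite big_seq_fsetE.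
split; first by apply/cvg_ex; exists s.
exact: (cvg_lim (@norm_hausdorff _ R[i]^o) cv).
Qed.

End Hsum.

(** * Reindexing of sums *)

Section HsumReindex.
Variables (R : realType) (I I' : choiceType).

(** A choice of preimages as a partial function, so that [pmap] pulls finite lists back along
    [h]. *)
Lemma partial_inverse (h : I' -> I) : injective h ->
  exists g : I -> option I', pcancel h g /\ ocancel g h.
Proof.
move=> ih; have [g hg] : {g : I -> option I' & forall i,
   if g i is Some j then h j = i else forall j, h j <> i}.
  apply: (@choice _ _ (fun i o => if o is Some j then h j = i else forall j, h j <> i)).
  move=> i; case: (pselect (exists j, h j = i)) => [[j <-]|n]; first by exists (Some j).
  by exists None => j hj; apply: n; exists j.
exists g; split.
  by move=> j; have := hg (h j); case: (g (h j)) => [j' /ih ->//|/(_ j)].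
by move=> i; have := hg i; case: (g i).
Qed.

(** Terms outside the image of [h] vanish, so a finite sum over [I] equals the sum over the pulled
    back list. The equivalence serves both to restrict an index set and to extend it. *)
Lemma hsum_reindex (h : I' -> I) (f : I -> R[i]) s : injective h ->
  (forall i, f i != 0 -> exists j, h j = i) ->
  hsum (fun j => f (h j)) s <-> hsum f s.
Proof.
move=> ih sup; have [g [hK gK]] := partial_inverse ih.
have key (r : seq I) : \sum_(i <- r) f i = \sum_(j <- pmap g r) f (h j).
  rewrite -(big_map h predT f) pmap_filter // big_filter.
  rewrite [RHS]big_mkcond; apply: eq_bigr => i _.
  case: ifPn => //; case: (eqVneq (f i) 0) => [->//|/sup[j <-]].
  by rewrite hK.
have mem_pm j (r : seq I) : (j \in pmap g r) = (h j \in r).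
  rewrite mem_pmap; apply/mapP/idP => [[i ir gi]|hr]; last by exists (h j); rewrite ?hK.
  by have := gK i; rewrite -gi /= => ->.
split=> hs e /hs[J0 hJ].
- exists [fset h j | j in J0]%fset => J J0J; rewrite key.
  have up : uniq (pmap g J) by apply: (pmap_uniq gK); exact: fset_uniq.
  rewrite -(big_fset_seq (fun j => f (h j))) //; apply: hJ.
  apply/fsubsetP => j jJ; rewrite in_fset mem_pm; apply: (fsubsetP J0J).
  by apply: in_imfset.
- exists [fset j in pmap g J0]%fset => J J0J.
  have up : uniq (pmap g J0) by apply: (pmap_uniq gK); exact: fset_uniq.
  have := hJ (J0 `|` [fset h j | j in J])%fset (fsubsetUl _ _).
  rewrite key; set r := pmap g _.
  have ur : uniq r by apply: (pmap_uniq gK); exact: fset_uniq.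
  rewrite (perm_big (enum_fset J)) //; apply: uniq_perm => // j.
  rewrite mem_pm in_fsetU; apply/orP/idP => [[h0|]|jJ].
  + by apply: (fsubsetP J0J); rewrite in_fset mem_pm.
  + by move=> /imfsetP[j' /= j'J /ih ->].
  + by right; apply: in_imfset.
Qed.

Lemma sbound_reindex (h : I' -> I) (g : I -> R) M : injective h ->
  sbound g M -> sbound (fun j => g (h j)) M.
Proof.
by move=> ih b s us; rewrite -(big_map h predT g); apply: b; rewrite map_inj_uniq.
Qed.

Lemma sbound_reindex_onto (h : I' -> I) (g : I -> R) M : injective h ->
  (forall i, g i != 0 -> exists j, h j = i) ->
  sbound (fun j => g (h j)) M -> sbound g M.
Proof.
move=> ih sup b r ur; have [k [hK gK]] := partial_inverse ih.
rewrite (_ : \sum_(i <- r) g i = \sum_(j <- pmap k r) g (h j)).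
  by apply: b; apply: (pmap_uniq gK).
rewrite -(big_map h predT g) pmap_filter // big_filter.
rewrite [RHS]big_mkcond; apply: eq_bigr => i _.
case: ifPn => //; case: (eqVneq (g i) 0) => [->//|/sup[j <-]].
by rewrite hK.
Qed.

Lemma asum_reindex (h : I' -> I) (f : I -> R[i]) : injective h ->
  (forall i, f i != 0 -> exists j, h j = i) ->
  asum (fun j => f (h j)) <-> asum f.
Proof.
move=> ih sup; split=> -[M b]; exists M.
  apply: (sbound_reindex_onto ih) b => i; rewrite normc_eq0; exact: sup.
exact: (sbound_reindex ih b).
Qed.

End HsumReindex.

Section HsumPair.
Variables (R : realType) (I K : choiceType).

(** A finite set of pairs lies in the product of its two projections. *)
Lemma sbound_pair (g : I * K -> R) (T : I -> R) M :
  (forall p, 0 <= g p) -> (forall i, sbound (fun k => g (i, k)) (T i)) ->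
  sbound T M -> sbound g M.
Proof.
move=> g0 gT bT s us.
pose A := undup (map fst s); pose B := undup (map snd s).
apply: le_trans (_ : \sum_(p <- [seq (i, k) | i <- A, k <- B]) g p <= _).
  apply: ler_sum_subseq => // -[i k] ik; apply/allpairsP; exists (i, k) => /=.
  by rewrite !mem_undup (map_f fst ik) (map_f snd ik).
rewrite big_allpairs; apply: le_trans (bT A (undup_uniq _)).
by apply: ler_sum => i _; apply: gT; exact: undup_uniq.
Qed.

Lemma sbound_prod (g : I -> R) (h : K -> R) M M' :
  (forall i, 0 <= g i) -> (forall i, 0 <= h i) -> sbound g M -> sbound h M' ->
  sbound (fun p : I * K => g p.1 * h p.2) (M * M').
Proof.
move=> g0 h0 bg bh; apply: (@sbound_pair _ (fun i => g i * M')) => [p|i|].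
- by rewrite mulr_ge0.
- exact: (sboundZ (g0 i) bh).
- rewrite mulrC; apply: sbound_le (sboundZ (sbound_ge0 bh) bg) => i.
  by rewrite mulrC.
Qed.

(** For a finite [A] containing the first projection of [J0], one finite [B'] makes all rows over
    [A] accurate and contains the second projection; then the product of [A] and [B'] contains [J0],
    and its sum is close to [s]. *)
Lemma hsum_pair (f : I * K -> R[i]) (t : I -> R[i]) s :
  hsum f s -> (forall i, hsum (fun k => f (i, k)) (t i)) -> hsum t s.
Proof.
move=> hf ht e e0; have e20 : 0 < e / 2 by rewrite divr_gt0.
have [J0 hJ0] := hf _ e20.
exists [fset p.1 | p in J0]%fset => A subA.
(* The tolerance is shared among the rows of [A]; the successor covers the empty set. *)
have d0 : 0 < e / 2 / (size A).+1%:R by rewrite divr_gt0.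
have [B hB] : exists B : {fset K}, forall i, i \in (A : seq I) -> forall B', (B `<=` B')%fset ->
    normc (\sum_(k <- B') f (i, k) - t i) < e / 2 / (size A).+1%:R.
  elim: (A : seq I) (size A) d0 => [|i r IHr] n d0; first by exists fset0.
  have [B1 hB1] := IHr n d0; have [B2 hB2] := ht i _ d0.
  exists (B1 `|` B2)%fset => j; rewrite inE => /orP[/eqP ->|jr] B' BB'.
    by apply: hB2; apply: fsubset_trans BB'; exact: fsubsetUr.
  by apply: (hB1 j jr); apply: fsubset_trans BB'; exact: fsubsetUl.
pose B' := (B `|` [fset p.2 | p in J0])%fset.
have uAB : uniq [seq (i, k) | i <- A, k <- B'].
  by apply: allpairs_uniq => // -[? ?] [? ?].
have := hJ0 [fset p in [seq (i, k) | i <- A, k <- B']]%fset.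
rewrite big_fset_seq // big_allpairs => h1.
have {}h1 : normc (\sum_(i <- A) \sum_(k <- B') f (i, k) - s) < e / 2.
  apply: h1; apply/fsubsetP => -[i k] ik; rewrite in_fset; apply/allpairsP.
  exists (i, k) => /=; split=> //.
    by apply: (fsubsetP subA); apply: (in_imfset _ fst ik).
  by rewrite in_fsetU; apply/orP; right; apply: (in_imfset _ snd ik).
apply: le_lt_trans (normc_dist_triangle _ (\sum_(i <- A) \sum_(k <- B') f (i, k)) _) _.
rewrite [e]splitr ler_ltD // -sumrB.
apply: le_trans (normc_sum _ _ _) _.
apply: le_trans (_ : \sum_(i <- A) (e / 2 / (size A).+1%:R) <= _).
  rewrite !big_seq; apply: ler_sum => i iA; rewrite normc_distC ltW //.
  by apply: hB => //; exact: fsubsetUl.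
rewrite big_const_seq count_predT iter_addr_0 -[X in X <= _]mulr_natr -mulrA ler_piMr ?ltW //.
by rewrite mulrC ltr_pdivrMr ?ltr0n // mul1r ltr_nat.
Qed.

Lemma asum_fst (f : I * K -> R[i]) i : asum f -> asum (fun k => f (i, k)).
Proof.
move=> [M b]; exists M => s us.
rewrite -(big_map (pair i) predT (fun p => normc (f p))); apply: b.
by rewrite map_inj_uniq // => x y [].
Qed.

End HsumPair.

Section HsumSwap.
Variables (R : realType) (I K : choiceType).

Lemma hsum_swap (f : I -> K -> R[i]) (t : I -> R[i]) (u : K -> R[i]) s :
  asum (fun p : I * K => f p.1 p.2) ->
  (forall i, hsum (f i) (t i)) -> (forall k, hsum (fun i => f i k) (u k)) ->
  hsum t s <-> hsum u s.
Proof.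
move=> af ht hu; have [s0 h0] := asum_hsum af.
have hts : hsum t s0 by apply: (hsum_pair h0 ht).
have hus : hsum u s0.
  pose sw (p : K * I) := (p.2, p.1).
  have isw : injective sw by move=> [? ?] [? ?] [-> ->].
  have h0' : hsum (fun p : K * I => f p.2 p.1) s0.
    by apply/(hsum_reindex (h := sw) (f := fun p : I * K => f p.1 p.2)) => // -[i k] _; exists (k, i).
  exact: (hsum_pair h0' hu).
split=> h.
  by rewrite (hsum_uniq h hts).
by rewrite (hsum_uniq h hus).
Qed.

End HsumSwap.

(** * Dominated convergence for sums *)

Section Tannery.
Variables (R : realType) (I : choiceType).

Lemma hsum_tail_le (f : I -> R[i]) s (g : I -> R) (e : R) (J0 : {fset I}) :
  hsum f s -> (forall i, normc (f i) <= g i) ->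
  (forall r : seq I, uniq r -> {in r, forall i, i \notin J0} -> \sum_(i <- r) g i < e) ->
  normc (\sum_(i <- J0) f i - s) <= e.
Proof.
move=> hs le tail; apply/ler_addgt0Pr => d d0; have [J hJ] := hs d d0.
have := hJ (J0 `|` J)%fset (fsubsetUr _ _).
rewrite (big_fsetDsub f (fsubsetUl J0 J)).
set K := (_ `\` _)%fset; set x := \sum_(i <- J0) _; set y := \sum_(i <- K) _ => h.
rewrite (_ : x - s = (x + y - s) - y); last by ring.
apply: le_trans (normcB _ _) _; rewrite [e + d]addrC; apply: lerD; first exact: ltW.
apply: le_trans (normc_sum _ _ _) _.
apply: le_trans (_ : \sum_(i <- K) g i <= _); first by apply: ler_sum.
by apply/ltW/tail => // i; rewrite in_fsetD => /andP[].
Qed.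

(** A finite [J0] carries all but [e / 4] of the dominating family. The tails of [u l] and of [v]
    and the finitely many remaining differences then cost at most [e / 4] each. *)
Lemma tannery (u : nat -> I -> R[i]) (v : I -> R[i]) (S : nat -> R[i]) (g : I -> R) M t :
  (forall l, hsum (u l) (S l)) ->
  (forall l i, normc (u l i) <= g i) -> sbound g M ->
  (forall i (e : R), 0 < e -> exists L, forall l, (L <= l)%N -> normc (u l i - v i) < e) ->
  hsum v t ->
  forall e : R, 0 < e -> exists L, forall l, (L <= l)%N -> normc (S l - t) < e.
Proof.
move=> hu le bg uv hv e e0.
have g0 i : 0 <= g i by apply: le_trans (le 0 i); exact: normc_ge0.
have vg i : normc (v i) <= g i.
  apply/ler_addgt0Pr => d d0; have [L hL] := uv i d d0.
  rewrite (_ : v i = u L i - (u L i - v i)); last by ring.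
  by apply: le_trans (normcB _ _) _; rewrite lerD // ltW // hL.
have e40 : 0 < e / 4 by rewrite divr_gt0.
have [J0 hJ0] := sbound_tail g0 bg e40.
have d0 : 0 < e / 4 / (size J0).+1%:R by rewrite divr_gt0.
have [L hL] : exists L, forall l, (L <= l)%N -> forall i, i \in (J0 : seq I) ->
    normc (u l i - v i) < e / 4 / (size J0).+1%:R.
  elim: (J0 : seq I) (size J0) d0 => [|i r IHr] n d0; first by exists 0%N.
  have [L1 h1] := IHr n d0; have [L2 h2] := uv i _ d0.
  exists (maxn L1 L2) => l; rewrite geq_max => /andP[l1 l2] j.
  by rewrite inE => /orP[/eqP ->|jr]; [exact: h2|exact: h1].
exists L => l /hL hl.
have h1 := hsum_tail_le (hu l) (le l) hJ0.
have h2 := hsum_tail_le hv vg hJ0.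
have h3 : normc (\sum_(i <- J0) u l i - \sum_(i <- J0) v i) <= e / 4.
  rewrite -sumrB; apply: le_trans (normc_sum _ _ _) _.
  apply: le_trans (_ : \sum_(i <- J0) (e / 4 / (size J0).+1%:R) <= _).
    by rewrite !big_seq; apply: ler_sum => i iJ; rewrite ltW ?hl.
  rewrite big_const_seq count_predT iter_addr_0 -[X in X <= _]mulr_natr -mulrA ler_piMr ?ltW //.
  by rewrite mulrC ltr_pdivrMr ?ltr0n // mul1r ltr_nat.
move: h1 h2 h3; set x := \sum_(i <- J0) _; set y := \sum_(i <- J0) _ => h1 h2 h3.
rewrite (_ : S l - t = (y - t) - (x - S l) + (x - y)); last by ring.
have h4 := normcD ((y - t) - (x - S l)) (x - y).
have h5 := normcB (y - t) (x - S l).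
lra.
Qed.

End Tannery.

Ltac nneg := repeat first [assumption | exact: normc_ge0 | exact: sqr_ge0
  | exact: normr_ge0 | exact: ler0n | exact: ler01 | apply: addr_ge0 | apply: mulr_ge0 | apply: exprn_ge0
  | rewrite invr_ge0 | (apply/ltW; assumption)].

(** * The complex exponential *)

Section Cexp.
Variable R : realType.
Implicit Types x y z : R[i].

Lemma ReD x y : complex.Re (x + y) = complex.Re x + complex.Re y.
Proof. by case: x y => [? ?] [? ?]. Qed.
Lemma ImD x y : complex.Im (x + y) = complex.Im x + complex.Im y.
Proof. by case: x y => [? ?] [? ?]. Qed.
Lemma ReN x : complex.Re (- x) = - complex.Re x.
Proof. by case: x => [? ?]. Qed.
Lemma ImN x : complex.Im (- x) = - complex.Im x.
Proof. by case: x => [? ?]. Qed.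
Lemma ReM x y : complex.Re (x * y) =
  complex.Re x * complex.Re y - complex.Im x * complex.Im y.
Proof. by case: x y => [? ?] [? ?]. Qed.
Lemma ImM x y : complex.Im (x * y) =
  complex.Re x * complex.Im y + complex.Im x * complex.Re y.
Proof. by case: x y => [? ?] [? ?]. Qed.
Lemma ReC (a : R) : complex.Re a%:C = a. Proof. by []. Qed.
Lemma ImC (a : R) : complex.Im a%:C = 0. Proof. by []. Qed.
Lemma natC n : n%:R = (n%:R : R)%:C :> R[i].
Proof. by rewrite (rmorph_nat (real_complex R)). Qed.
Lemma intC (n : int) : n%:~R = (n%:~R : R)%:C :> R[i].
Proof. by rewrite (rmorph_int (real_complex R)). Qed.
Lemma ReMC (a : R) x : complex.Re (a%:C * x) = a * complex.Re x.
Proof. by rewrite ReM /= mul0r subr0. Qed.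
Lemma ImMC (a : R) x : complex.Im (a%:C * x) = a * complex.Im x.
Proof. by rewrite ImM /= mul0r addr0. Qed.

Lemma ipiE : ipi R = 'i * (pi : R)%:C.
Proof. by rewrite /ipi; simpc. Qed.

Lemma normc_i : normc ('i : R[i]) = 1.
Proof. by rewrite /= expr0n /= expr1n add0r sqrtr1. Qed.

Lemma sqr_i' : ('i : R[i]) * 'i = -1.
Proof. by rewrite -expr2 sqr_i. Qed.

Lemma cexpD x y : cexp (x + y) = cexp x * cexp y.
Proof.
case: x y => [a b] [c d]; rewrite /cexp /= expRD cosD sinD.
by apply/eqP; rewrite eq_complex /=; apply/andP; split; apply/eqP; ring.
Qed.

Lemma cexp0 : cexp (0 : R[i]) = 1.
Proof. by rewrite /cexp /= expR0 cos0 sin0 mulr1 mulr0. Qed.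

Lemma normc_cexp z : normc (cexp z) = expR (complex.Re z).
Proof.
rewrite /cexp /= !exprMn -mulrDr cos2Dsin2 mulr1 sqrtr_sqr ger0_norm //.
Qed.

Lemma cexp_neq0 z : cexp z != 0.
Proof. by rewrite -normc_eq0 normc_cexp gt_eqF ?expR_gt0. Qed.

Lemma cexpN z : cexp (- z) = (cexp z)^-1.
Proof.
apply: (mulfI (cexp_neq0 z)); rewrite -cexpD subrr cexp0 mulfV //.
exact: cexp_neq0.
Qed.

Lemma cexpB x y : cexp (x - y) = cexp x / cexp y.
Proof. by rewrite cexpD cexpN. Qed.

Lemma cexpMn n z : cexp (n%:R * z) = cexp z ^+ n.
Proof.
elim: n => [|n IHn]; first by rewrite mul0r cexp0 expr0.
by rewrite -natr1 mulrDl mul1r cexpD IHn exprSr.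
Qed.

Lemma cexp_real (a : R) : cexp a%:C = (expR a)%:C.
Proof. by rewrite /cexp /= cos0 sin0 mulr1 mulr0. Qed.

Lemma cexp_2pi : cexp (2 * ipi R) = 1.
Proof.
rewrite (_ : 2 * ipi R = Complex 0 (pi *+ 2)); last first.
  by apply/eqP; rewrite eq_complex /=; apply/andP; split; apply/eqP; ring.
by rewrite /cexp /= expR0 cos2pi sin2pi mulr1 mulr0.
Qed.

Lemma cexp_2pi_int (n : int) : cexp (2 * ipi R * n%:~R) = 1.
Proof.
have hn (p : nat) : cexp (2 * ipi R * p%:R) = 1.
  by rewrite mulrC cexpMn cexp_2pi expr1n.
case: n => n; first exact: hn.
by rewrite NegzE mulrNz mulrN cexpN -pmulrn hn invr1.
Qed.

Lemma cexpDint z (n : int) : cexp (z + 2 * ipi R * n%:~R) = cexp z.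
Proof. by rewrite cexpD cexp_2pi_int mulr1. Qed.

Lemma normc_cexp_le z (a : R) : complex.Re z <= a -> normc (cexp z) <= expR a.
Proof. by rewrite normc_cexp ler_expR. Qed.

(** This family is closed under differentiation in [s], which acts linearly on [(p, q)]. One mean
    value argument thus covers the real part, [(1, 0)], and the imaginary part, [(0, 1)], of
    [exp (s z)]. *)
Let E (a b p q s : R) := expR (s * a) * (p * cos (s * b) + q * sin (s * b)).

Let E_derive (a b p q s : R) :
  is_derive s 1 (E a b p q) (E a b (a * p + b * q) (a * q - b * p) s).
Proof.
have h1 : is_derive s 1 (fun s : R => s * a) a.
  by apply: is_derive_eq; rewrite scaler0 add0r /GRing.scale /= mulr1.
have h2 : is_derive s 1 (fun s : R => s * b) b.
  by apply: is_derive_eq; rewrite scaler0 add0r /GRing.scale /= mulr1.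
have he : is_derive s 1 (fun s : R => expR (s * a)) (expR (s * a) * a).
  exact: (is_derive1_comp (f := expR) (g := fun s : R => s * a)).
have hc : is_derive s 1 (fun s : R => cos (s * b)) (- sin (s * b) * b).
  exact: (is_derive1_comp (f := cos) (g := fun s : R => s * b)).
have hs : is_derive s 1 (fun s : R => sin (s * b)) (cos (s * b) * b).
  exact: (is_derive1_comp (f := sin) (g := fun s : R => s * b)).
rewrite /E; apply: is_derive_eq.
rewrite ?scaler0 /GRing.scale /=; ring.
Qed.

Let E_le (a b p q s : R) : 0 <= s <= 1 ->
  `|E a b p q s| <= (1 + expR a) * (`|p| + `|q|).
Proof.
move=> /andP[s0 s1]; rewrite /E normrM ger0_norm ?expR_ge0 //.
apply: ler_pM => //.
  have [a0|a0] := leP 0 a.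
    by apply: ler_wpDl => //; rewrite ler_expR ler_piMl.
  apply: ler_wpDr; first exact: expR_ge0.
  by rewrite -expR0 ler_expR mulr_ge0_le0 // ltW.
apply: le_trans (ler_normD _ _) _; rewrite !normrM.
by apply: lerD; rewrite ler_piMr // ?cos_max ?sin_max.
Qed.

Let E_MVT (a b p q t : R) : 0 <= t -> exists2 c : R, 0 <= c <= t &
  E a b p q t - E a b p q 0 = E a b (a * p + b * q) (a * q - b * p) c * t.
Proof.
move=> t0; have [c cI ->] := MVT_segment t0 (fun r _ => E_derive a b p q r)
  (derivable_within_continuous (fun r _ => @ex_derive _ _ _ _ _ _ _ (E_derive a b p q r))).
by exists c; rewrite ?subr0 // -in_itv.
Qed.

Let E_taylor (a b p q : R) : `|E a b p q 1 - E a b p q 0 - (a * p + b * q)| <=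
  (1 + expR a) * ((`|a| + `|b|) ^+ 2 * (`|p| + `|q|)).
Proof.
have [c /andP[c0 c1] ->] := E_MVT a b p q ler01; rewrite mulr1.
set p1 := a * p + b * q; set q1 := a * q - b * p.
have E0 : E a b p1 q1 0 = p1.
  by rewrite /E !mul0r expR0 cos0 sin0 mulr1 mulr0 addr0 mul1r.
rewrite -{2}E0; have [d /andP[d0 dc] ->] := E_MVT a b p1 q1 c0.
rewrite normrM (ger0_norm c0).
apply: le_trans (_ : `|E a b (a * p1 + b * q1) (a * q1 - b * p1) d| * 1 <= _).
  by rewrite ler_wpM2l.
rewrite mulr1; apply: le_trans (E_le _ _ _ _ _) _.
  by rewrite d0 (le_trans dc).
rewrite ler_wpM2l ?addr_ge0 ?expR_ge0 //.
have aux (u v : R) : `|a * u + b * v| + `|a * v - b * u| <= (`|a| + `|b|) * (`|u| + `|v|).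
  have := ler_normD (a * u) (b * v); have := ler_normB (a * v) (b * u).
  rewrite !normrM; nra.
apply: le_trans (aux _ _) _; rewrite expr2 -mulrA ler_wpM2l ?addr_ge0 //.
exact: aux.
Qed.

Lemma cexp_taylor z : 
  normc (cexp z - 1 - z) <= 8 * normc z ^+ 2 * (1 + expR (complex.Re z)).
Proof.
case: z => a b; set z := Complex a b.
have ha : `|a| <= normc z := normc_Re z; have hb : `|b| <= normc z := normc_Im z.
have hab : (`|a| + `|b|) ^+ 2 <= (2 * normc z) ^+ 2.
  by rewrite ler_pXn2r ?nnegrE ?addr_ge0 ?mulr_ge0 ?normc_ge0 //; lra.
move: (normc z) ha hb hab => nz ha hb hab.
have main (p q : R) : `|p| + `|q| = 1 ->
    `|E a b p q 1 - E a b p q 0 - (a * p + b * q)| <= 4 * nz ^+ 2 * (1 + expR a).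
  move=> pq; apply: le_trans (E_taylor _ _ _ _) _; rewrite pq mulr1 mulrC.
  apply: ler_pM; rewrite ?addr_ge0 ?expR_ge0 ?sqr_ge0 ?ler_expR //.
  by apply: le_trans hab _; rewrite exprMn le_eqVlt; apply/orP; left; apply/eqP; ring.
have h1 := main 1 0; have h2 := main 0 1.
rewrite normr1 normr0 addr0 in h1; rewrite normr1 normr0 add0r in h2.
move/(_ erefl): h1; move/(_ erefl): h2.
rewrite /E !mul0r !mul1r !expR0 cos0 sin0 !mulr0 !mulr1 ?mul0r ?addr0 ?add0r ?mul1r.
move=> h2 h1; apply: le_trans (normc_le_ReIm _) _.
rewrite !ReD !ImD !ReN !ImN /=.
rewrite ?oppr0 ?addr0 ?subr0 in h1 h2 *.
by move: h1 h2; set u := `|_|; set v := `|_|; lra.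
Qed.

(** Only the moduli at the two end points enter the bound, so it can be summed whenever both
    families of exponentials are summable. *)
Lemma cexp_taylor2 (u v : R[i]) : normc (cexp v - cexp u - cexp u * (v - u)) <=
  8 * normc (v - u) ^+ 2 * (normc (cexp u) + normc (cexp v)).
Proof.
have -> : cexp v = cexp u * cexp (v - u) by rewrite -cexpD addrC subrK.
rewrite (_ : _ - _ - _ = cexp u * (cexp (v - u) - 1 - (v - u))); last by ring.
rewrite !normcM mulrC; apply: le_trans (ler_wpM2r (normc_ge0 _) (cexp_taylor _)) _.
by rewrite !normc_cexp le_eqVlt; apply/orP; left; apply/eqP; ring.
Qed.

(** If the fractional part [f] were positive, then [sin (pi f) > 0], and
    [cos (2 pi f) = 1 - 2 sin (pi f) ^ 2] would be less than 1. *)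
Lemma cexp_2pi_eq1 (x : R) : cexp (2 * ipi R * x%:C) = 1 ->
  x = (Num.floor x)%:~R.
Proof.
move=> h; set n := Num.floor x; apply/eqP; rewrite -subr_eq0; apply/eqP.
have /andP[n1 n2] := floor_itv x.
set f := x - n%:~R.
have f0 : 0 <= f by rewrite subr_ge0.
have f1 : f < 1 by rewrite /f ltrBlDr addrC -intrD1.
have {}h : cexp (2 * ipi R * f%:C) = 1.
  by rewrite /f rmorphB mulrBr cexpB h rmorph_int cexp_2pi_int divr1.
apply/eqP; rewrite eq_le f0 andbT leNgt; apply/negP => fp.
have := sin_gt0_pi (x := pi * f); rewrite mulr_gt0 ?pi_gt0 //= gtr_pMr ?pi_gt0 // => /(_ f1) sp.
have re0 : complex.Re (2 * ipi R * f%:C) = 0 by rewrite !ReM /=; ring.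
have im0 : complex.Im (2 * ipi R * f%:C) = (pi * f) + (pi * f).
  by rewrite !ImM !ReM /=; ring.
move: h => /(congr1 (@complex.Re R)); rewrite /cexp re0 im0 /=.
rewrite expR0 mul1r cosD => h1; have := cos2Dsin2 (pi * f); nra.
Qed.

(** The filter by roots of unity. The offset [l'] moves the frequencies to a window that can be
    centred at 0, as the decay estimates require. *)
Lemma root_sum (l : nat) (l' n : int) : (0 < l)%N ->
  \sum_(i < l) cexp (2 * ipi R * (((i : nat)%:Z - l')%:~R * n%:~R / l%:R)) =
  (if (l%:Z %| n)%Z then l%:R * cexp (2 * ipi R * ((- l')%:~R * n%:~R / l%:R)) else 0).
Proof.
move=> l0; have ln0 : (l%:R : R[i]) != 0 by rewrite pnatr_eq0 -lt0n.
pose w := cexp (2 * ipi R * (n%:~R / l%:R)).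
have step (i : nat) : cexp (2 * ipi R * ((i%:Z - l')%:~R * n%:~R / l%:R)) =
    cexp (2 * ipi R * ((- l')%:~R * n%:~R / l%:R)) * w ^+ i.
  rewrite /w -cexpMn -cexpD; congr cexp; rewrite !rmorphB /= ?mulrNz.
  by rewrite -pmulrn; field.
under eq_bigr => i _ do rewrite step.
rewrite -mulr_sumr.
case: ifPn => dv.
  have -> : w = 1.
    case/dvdzP: dv => q eqn; rewrite /w eqn rmorphM /= -pmulrn mulfK //.
    exact: cexp_2pi_int.
  under eq_bigr => i _ do rewrite expr1n.
  by rewrite sumr_const card_ord mulrC.
have w1 : w - 1 != 0.
  rewrite subr_eq0; apply: contra dv => /eqP.
  rewrite /w (_ : n%:~R / l%:R = (n%:~R / l%:R : R)%:C); last first.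
    by rewrite rmorphM fmorphV /= -intC -natC.
  move=> /cexp_2pi_eq1 e.
  apply/dvdzP; exists (Num.floor (n%:~R / l%:R : R)).
  apply/eqP; rewrite -(eqr_int R) rmorphM /= -e -pmulrn divfK //.
  by rewrite pnatr_eq0 -lt0n.
have wl : w ^+ l = 1 by rewrite /w -cexpMn mulrCA [l%:R * _]mulrC divfK // cexp_2pi_int.
have : (w - 1) * \sum_(i < l) w ^+ i = 0 by rewrite -subrX1 wl subrr.
by move/eqP; rewrite mulf_eq0 (negbTE w1) /= => /eqP ->; rewrite mulr0.
Qed.

(** With [v = y / 2], the mean value theorem gives [sin v >= v cos v], hence
    [sin y = 2 sin v cos v >= 2 v cos v ^ 2], and [cos v ^ 2 >= 1 / 2] because [cos y >= 0]. *)
Lemma sin_ge_half (y : R) : 0 <= y <= pi / 2 -> y / 2 <= sin y.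
Proof.
move=> /andP[y0 y1]; pose v := y / 2.
have pp := pi_gt0 R.
have v0 : 0 <= v by rewrite divr_ge0.
have vy : v <= y by rewrite /v; lra.
have [c] := MVT_segment v0 (fun r _ => is_derive_sin r)
  (derivable_within_continuous (fun r _ => derivable_sin (x := r))).
rewrite in_itv /= => /andP[c0 cv]; rewrite sin0 !subr0 => sv.
have cc : cos v <= cos c.
  have [->//|ne] := eqVneq c v; apply/ltW.
  rewrite (@ltr_cos R c v) ?in_itv /=; first by rewrite lt_neqAle ne.
    by apply/andP; split=> //; apply: le_trans cv _; rewrite /v; lra.
  by apply/andP; split=> //; rewrite /v; lra.
have cy : 0 <= cos y by rewrite cos_ge0_pihalf //; apply/andP; split; lra.
have cv0 : 0 <= cos v by rewrite cos_ge0_pihalf //; apply/andP; split; rewrite /v; lra.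
have e1 : y = v + v by rewrite /v; field.
have e2 : cos y = cos v * cos v - sin v * sin v by rewrite {1}e1 cosD.
have e3 : sin y = sin v * cos v + cos v * sin v by rewrite {1}e1 sinD.
have := cos2Dsin2 v => e4.
have h1 : 1 / 2 <= cos v * cos v by nra.
have h2 : v * cos v <= sin v by rewrite sv mulrC ler_wpM2r.
have h3 : v * cos v * cos v <= sin v * cos v by rewrite ler_wpM2r.
rewrite e3 -/v; nra.
Qed.

End Cexp.

(** * Elementary summable families *)

Section Bounds.
Variable R : realType.

Lemma inv1sq_nat : sbound (fun n : nat => (1 + (n%:R : R) ^+ 2)^-1) 4.
Proof.
move=> s us.
pose m := (\max_(i <- s) i).+1.
apply: le_trans (_ : \sum_(n <- iota 0 m) (1 + (n%:R : R) ^+ 2)^-1 <= _).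
  apply: ler_sum_subseq => // i si.
  by rewrite mem_iota /= add0n ltnS; apply: (leq_bigmax_seq (F := id)).
rewrite -/(index_iota 0 m) -[m]subn0 subn0.
(* A telescoping majorant: its increment [4 / ((m + 1) (m + 2))] exceeds the new term. *)
suff : \sum_(n <- iota 0 m) (1 + (n%:R : R) ^+ 2)^-1 <= 4 - 4 / m.+1%:R.
  move/le_trans; apply; rewrite lerBlDr lerDl divr_ge0 //.
elim: m => [|m IHm]; first by rewrite big_nil divr1 subrr.
rewrite -addn1 iotaD big_cat /= big_seq1 add0n addn1.
apply: le_trans (lerD IHm (lexx _)) _.
have m0 : 0 <= (m%:R : R) by [].
have m1 : 0 < (m%:R : R) + 1 by rewrite ltr_wpDl.
have m2 : 0 < (m%:R : R) + 2 by rewrite ltr_wpDl.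
have m3 : 0 < 1 + (m%:R : R) ^+ 2 by rewrite ltr_wpDr ?sqr_ge0.
have -> : (m.+2%:R : R) = m%:R + (1 + 1) by rewrite -[m.+2]addn2 natrD.
have -> : (m.+1%:R : R) = m%:R + 1 by rewrite -natr1.
rewrite -subr_ge0.
have -> : 4 - 4 / (m%:R + (1 + 1)) - (4 - 4 / (m%:R + 1) + (1 + m%:R ^+ 2)^-1) =
  (3 * (m%:R : R) ^+ 2 - 3 * m%:R + 2) / ((m%:R + 1) * (m%:R + 2) * (1 + m%:R ^+ 2)).
  by field; rewrite !gt_eqF.
rewrite divr_ge0 //.
have := sqr_ge0 ((m%:R : R) - 1 / 2); nra.
Qed.

Lemma sbound_int_of_nat (g : nat -> R) M : (forall n, 0 <= g n) -> sbound g M ->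
  sbound (fun n : int => g `|n|%N) (M + M).
Proof.
move=> g0 b.
pose h (n : int) := ((0 <= n)%R, `|n|%N).
have ih : injective h by move=> n n' [] /=; lia.
apply: (sbound_reindex ih (g := fun p : bool * nat => g p.2)).
apply: (@sbound_pair _ _ _ _ (fun=> M)) => // s us.
have M0 := sbound_ge0 b.
apply: le_trans (_ : \sum_(i <- [:: true; false]) M <= _).
  by apply: ler_sum_subseq => // -[]; rewrite !inE.
by rewrite !big_cons big_nil addr0.
Qed.

Lemma absz_sqr (n : int) : ((`|n|%N)%:R : R) ^+ 2 = (n%:~R) ^+ 2.
Proof. by rewrite -natrX -rmorphXn /= pmulrn -abszX; congr (_%:~R); lia. Qed.

Lemma inv1sq_int : sbound (fun n : int => (1 + (n%:~R : R) ^+ 2)^-1) 8.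
Proof.
apply: sbound_leM (_ : _ <= _) (sbound_le _ (sbound_int_of_nat _ inv1sq_nat)).
- by lra.
- by move=> i; rewrite absz_sqr.
- by move=> n; rewrite invr_ge0 addr_ge0 ?sqr_ge0.
Qed.

Lemma size_int_interval (s : seq int) (m : int) (b : nat) : uniq s ->
  {in s, forall n, m <= n < m + b%:Z} -> (size s <= b)%N.
Proof.
move=> us h; rewrite -(size_iota 0 b) -(size_map (fun i : nat => m + i%:Z)).
apply: uniq_leq_size => // n /h /andP[h1 h2]; apply/mapP; exists `|n - m|%N.
  by rewrite mem_iota; lia.
by lia.
Qed.

(** At most [b] integers [n] give [(n + u) / b] the same floor [i], and replacing the quotient by
    [i] costs a factor 3; whence [24 = 3 * 8]. The point is that the bound does not depend on the
    shift [u]. *)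
Lemma inv1sq_shift (u : R) (b : nat) : (0 < b)%N ->
  sbound (fun n : int => (1 + ((n%:~R + u) / b%:R) ^+ 2)^-1) (24 * b%:R).
Proof.
move=> b0; have bp : 0 < (b%:R : R) by rewrite ltr0n.
pose fl (n : int) := Num.floor ((n%:~R + u) / b%:R).
pose h (n : int) := (fl n, n).
have ih : injective h by move=> n n' [].
pose g (p : int * int) : R :=
  if fl p.2 == p.1 then 3 * (1 + (p.1%:~R : R) ^+ 2)^-1 else 0.
have pos (i : int) : 0 <= (1 + (i%:~R : R) ^+ 2)^-1 by rewrite invr_ge0 addr_ge0 ?sqr_ge0.
apply: (@sbound_le _ _ _ (fun n => g (h n))).
  move=> n; rewrite /g /= eqxx; set x := (n%:~R + u) / _.
  have /andP[] := floor_itv x; rewrite -/(fl n); set i := fl n.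
  rewrite intrD1 => i1 i2; set y := (i%:~R : R) in i1 i2 *.
  have p1 : 0 < 1 + x ^+ 2 by rewrite ltr_wpDr ?sqr_ge0.
  have p2 : 0 < 1 + y ^+ 2 by rewrite ltr_wpDr ?sqr_ge0.
  rewrite -[leLHS]mul1r ler_pdivrMr // mulrAC ler_pdivlMr // mul1r.
  have := sqr_ge0 (x - 2 * (y - x)); have := sqr_ge0 (x + (y - x)).
  have := sqr_ge0 (x - (y - x)); nra.
apply: (sbound_reindex ih (g := g)).
apply: (@sbound_pair _ _ _ _ (fun i : int => 3 * (1 + (i%:~R : R) ^+ 2)^-1 * b%:R)).
- by move=> p; rewrite /g; case: ifP => // _; rewrite mulr_ge0.
- move=> i s us; rewrite /g -big_mkcond /= -big_filter.
  rewrite big_const_seq count_predT iter_addr_0 -[leLHS]mulr_natr ler_wpM2l ?mulr_ge0 //.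
  rewrite ler_nat; apply: (@size_int_interval _ (Num.ceil (i%:~R * b%:R - u))).
    by rewrite filter_uniq.
  move=> n; rewrite mem_filter => /andP[/eqP <- _].
  have /andP[] := floor_itv ((n%:~R + u) / b%:R); rewrite -/(fl n) => i1 i2.
  rewrite ceil_le_int; apply/andP; split.
    by move: i1; rewrite ler_pdivlMr // lerBlDr.
  rewrite -ltrBlDr ltNge ceil_le_int -ltNge.
  move: i2; rewrite ltr_pdivrMr // intrD1 mulrDl mul1r rmorphB /= -pmulrn; lra.
- apply: sbound_leM (sbound_le _ (sboundZ (_ : 0 <= 3 * b%:R) inv1sq_int)).
  + by rewrite le_eqVlt; apply/orP; left; apply/eqP; ring.
  + by move=> i; rewrite mulrAC.
  + by rewrite mulr_ge0.
Qed.

Lemma expR_inv1 (y : R) : 0 <= y -> expR (- y) <= (1 + y)^-1.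
Proof.
move=> y0; rewrite expRN lef_pV2 ?posrE ?expR_gt0 ?ltr_wpDr //.
exact: expR_ge1Dx.
Qed.

Lemma gauss_shift (a u : R) (b : nat) : (0 < b)%N -> 1 <= a * b%:R ^+ 2 ->
  sbound (fun n : int => expR (- (a * (n%:~R + u) ^+ 2))) (24 * b%:R).
Proof.
move=> b0 ab; apply: sbound_le (inv1sq_shift u b0) => n; set x := n%:~R + u.
have bp : 0 < (b%:R : R) ^+ 2 by rewrite exprn_gt0 ?ltr0n.
have le : (x / b%:R) ^+ 2 <= a * x ^+ 2.
  rewrite expr_div_n ler_pdivrMr // mulrAC; have := sqr_ge0 x; nra.
apply: le_trans (expR_inv1 _) _; first exact: le_trans (sqr_ge0 _) le.
by rewrite lef_pV2 ?posrE ?lerD2l // ltr_wpDr ?sqr_ge0 // (le_trans (sqr_ge0 _) le).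
Qed.

Lemma pow_expR_bound (p : nat) (c y : R) : 0 < c -> 0 <= y ->
  y ^+ p * expR (- (c * y)) <= (p.+1%:R / c) ^+ p.
Proof.
move=> c0 y0; have pp : 0 < (p.+1%:R : R) by rewrite ltr0n.
(* The inequality [v <= exp v] is raised to the power [p]; the successor keeps the quotient
   meaningful for [p = 0]. *)
pose v := c * y / p.+1%:R.
have v0 : 0 <= v by rewrite divr_ge0 // ?mulr_ge0 // ltW.
have h : v ^+ p <= expR (c * y).
  have -> : c * y = v * p.+1%:R by rewrite divfK // gt_eqF.
  rewrite expRM_natr; apply: le_trans (_ : expR v ^+ p <= _).
    apply: lerXn2r; rewrite ?nnegrE ?expR_ge0 //.
    by apply: le_trans (expR_ge1Dx v); rewrite lerDr.
  by rewrite ler_weXn2l // -expR0 ler_expR.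
rewrite expRN ler_pdivrMr ?expR_gt0 //.
have -> : y ^+ p = (p.+1%:R / c) ^+ p * v ^+ p.
  by rewrite -exprMn /v; congr (_ ^+ _); field; rewrite !gt_eqF.
by rewrite ler_wpM2l // exprn_ge0 // divr_ge0 // ltW.
Qed.

(** Half of the Gaussian absorbs the polynomial; the other half absorbs the linear exponent by
    completing the square. *)
Lemma gauss_poly_bound (p : nat) (a b : R) : 0 < a -> 0 <= b ->
  exists2 K : R, 0 <= K &
    forall x : R, (1 + x ^+ 2) ^+ p * expR (- (a * x ^+ 2) + b * `|x|) <= K.
Proof.
move=> a0 b0; pose c := a / 2.
have c0 : 0 < c by rewrite divr_gt0.
exists ((p.+1%:R / c) ^+ p * expR (c + b ^+ 2 / (2 * a))).
  by rewrite mulr_ge0 ?expR_ge0 // exprn_ge0 // divr_ge0 // ltW.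
move=> x.
have y0 : 0 <= 1 + x ^+ 2 by rewrite addr_ge0 ?sqr_ge0.
apply: le_trans (ler_wpM2r (expR_ge0 _) (pow_expR_bound p c0 y0)).
rewrite -mulrA -expRD ler_wpM2l ?exprn_ge0 // ler_expR /c.
have e : x ^+ 2 = `|x| ^+ 2 by rewrite real_normK ?num_real.
rewrite e; set t := `|x|.
rewrite -subr_ge0.
have -> : - (a / 2 * (1 + t ^+ 2)) + (a / 2 + b ^+ 2 / (2 * a)) - (- (a * t ^+ 2) + b * t)
   = (a * t - b) ^+ 2 / (2 * a).
  by field; rewrite gt_eqF.
by rewrite divr_ge0 ?sqr_ge0 // mulr_ge0 // ltW.
Qed.

End Bounds.

(** * Splitting off the first coordinate *)

Section Vectors.
Variable T : Type.

Definition vcons N (a : T) (y : 'cV[T]_N) : 'cV[T]_N.+1 :=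
  \col_i (if unlift ord0 i is Some j then y j 0 else a).
Definition vtl N (x : 'cV[T]_N.+1) : 'cV[T]_N := \col_i x (lift ord0 i) 0.

Lemma vcons0 N a (y : 'cV[T]_N) : vcons a y 0 0 = a.
Proof. by rewrite mxE unlift_none. Qed.

Lemma vconsS N a (y : 'cV[T]_N) i : vcons a y (lift ord0 i) 0 = y i 0.
Proof. by rewrite mxE liftK. Qed.

Lemma vtl_cons N a (y : 'cV[T]_N) : vtl (vcons a y) = y.
Proof. by apply/matrixP => i j; rewrite mxE vconsS !ord1. Qed.

Lemma vcons_eta N (x : 'cV[T]_N.+1) : vcons (x 0 0) (vtl x) = x.
Proof.
apply/matrixP => i j; rewrite !ord1 mxE.
by case: unliftP => [k ->|->]; rewrite ?mxE.
Qed.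

Lemma vcons_inj N : injective (fun p : T * 'cV[T]_N => vcons p.1 p.2).
Proof.
move=> [a y] [a' y'] /= h; have := congr1 (@vtl N) h; rewrite !vtl_cons => ->.
by have := congr1 (fun x : 'cV[T]_N.+1 => x 0 0) h; rewrite !vcons0 => ->.
Qed.

End Vectors.

Section VectorBounds.
Variable R : realType.

Lemma sbound_vec N (g : 'I_N -> int -> R) (M : R) :
  (forall i n, 0 <= g i n) -> (forall i, sbound (g i) M) ->
  sbound (fun x : 'cV[int]_N => \prod_i g i (x i 0)) (M ^+ N).
Proof.
elim: N g => [|N IHN] g g0 b.
  rewrite expr0 => s us.
  apply: le_trans (_ : \sum_(i <- [:: (0 : 'cV[int]_0)]) \prod_i0 g i0 (i i0 0) <= _).
    apply: ler_sum_subseq => // [x|x _]; first by rewrite big_ord0.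
    by rewrite inE; apply/eqP/matrixP => -[].
  by rewrite big_seq1 big_ord0.
apply: (sbound_reindex_onto (@vcons_inj int N)).
  by move=> x _; exists (x 0 0, vtl x); rewrite vcons_eta.
rewrite exprS.
apply: (@sbound_le _ _ _ (fun p : int * 'cV[int]_N =>
   g ord0 p.1 * \prod_i g (lift ord0 i) (p.2 i 0))).
  move=> [a y]; rewrite big_ord_recl vcons0.
  rewrite (eq_bigr (fun i => g (lift ord0 i) (y i 0))) // => i _.
  by congr (g _ _); exact: vconsS.
apply: (sbound_prod (g := g ord0)
  (h := fun y : 'cV[int]_N => \prod_i g (lift ord0 i) (y i 0))) => //.
- by move=> y; rewrite prodr_ge0.
- exact: (IHN (fun i => g (lift ord0 i))).
Qed.

End VectorBounds.

(** * Theta transformation in one variable *)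

(** A total sum with default 0, to be read only through [usumP] or [usum_eq]. *)
Definition usum (R : realType) (I : choiceType) (f : I -> R[i]) : R[i] :=
  xget 0 (hsum f).

Section Usum.
Variables (R : realType) (I : choiceType).
Implicit Types f : I -> R[i].

Lemma usum_eq f s : hsum f s -> usum f = s.
Proof.
move=> h; rewrite /usum; case: xgetP => [t -> ht|/(_ s)]; last by [].
exact: hsum_uniq ht h.
Qed.

Lemma usumP f : asum f -> hsum f (usum f).
Proof. by move=> /asum_hsum[s hs]; rewrite (usum_eq hs). Qed.

Lemma eq_usum f f' : f =1 f' -> usum f = usum f'.
Proof. by move=> /funext ->. Qed.

Lemma usum_le f M : sbound (fun i => normc (f i)) M -> normc (usum f) <= M.
Proof. move=> b; have h : asum f by exists M.
exact: hsum_normc_le (usumP h) b. Qed.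

End Usum.

(** * A mean value inequality for complex-valued paths *)

Section C11.
Variable R : realType.

(* [f] is differentiable on [0, 1] with derivative [f'], with a quadratic
   remainder: this is all that a mean value inequality needs. *)
Definition C11 (f f' : R -> R[i]) := exists K B : R, forall s s' : R,
  0 <= s <= 1 -> 0 <= s' <= 1 ->
  [/\ normc (f s' - f s - (s' - s)%:C * f' s) <= K * (s' - s) ^+ 2,
      normc (f s) <= B & normc (f' s) <= B].

Lemma C11_K f f' : C11 f f' -> exists2 K : R, 0 <= K & forall s s' : R,
  0 <= s <= 1 -> 0 <= s' <= 1 ->
  [/\ normc (f s' - f s - (s' - s)%:C * f' s) <= K * (s' - s) ^+ 2,
      normc (f s) <= K & normc (f' s) <= K].
Proof.
move=> [K [B h]]; exists (`|K| + `|B|); first by rewrite addr_ge0.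
move=> s s' hs hs'; have [h1 h2 h3] := h s s' hs hs'.
have k1 := ler_norm K; have k2 := ler_norm B.
have k3 := normr_ge0 K; have k4 := normr_ge0 B.
split; [|by lra..].
by apply: le_trans h1 _; rewrite ler_wpM2r ?sqr_ge0 //; lra.
Qed.

Lemma C11_cst (c : R[i]) : C11 (fun=> c) (fun=> 0).
Proof.
exists 0, (normc c) => s s' _ _; rewrite mulr0 subrr subr0 normc0 mul0r.
by split=> //; exact: normc_ge0.
Qed.

Lemma C11_id : C11 (fun s => s%:C) (fun=> 1).
Proof.
exists 0, 1 => s s' /andP[s0 s1] _; rewrite mulr1 -!rmorphB subrr normc0 mul0r.
by rewrite normc_real normc1 ger0_norm.
Qed.

Lemma unit_dist (s s' : R) : 0 <= s <= 1 -> 0 <= s' <= 1 -> `|s' - s| <= 1.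
Proof. by move=> /andP[? ?] /andP[? ?]; rewrite ler_norml; apply/andP; split; lra. Qed.

Lemma C11_lip f f' : C11 f f' -> exists2 K : R, 0 <= K & forall s s' : R,
  0 <= s <= 1 -> 0 <= s' <= 1 -> normc (f s' - f s) <= K * `|s' - s|.
Proof.
move=> /C11_K[K K0 h]; exists (2 * K); first by rewrite mulr_ge0.
move=> s s' hs hs'; have [h1 h2 h3] := h s s' hs hs'.
rewrite (_ : f s' - f s = f s' - f s - (s' - s)%:C * f' s + (s' - s)%:C * f' s); last by ring.
apply: le_trans (normcD _ _) _; rewrite normcM normc_real.
have d := unit_dist hs hs'; have d0 := normr_ge0 (s' - s).
have e : (s' - s) ^+ 2 = `|s' - s| ^+ 2 by rewrite real_normK ?num_real.
rewrite e in h1; have : K * `|s' - s| ^+ 2 <= K * `|s' - s|.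
  by rewrite ler_wpM2l // expr2 ler_piMr.
have : `|s' - s| * normc (f' s) <= `|s' - s| * K by rewrite ler_wpM2l.
lra.
Qed.

Lemma C11_mul f f' g g' : C11 f f' -> C11 g g' ->
  C11 (fun s => f s * g s) (fun s => f' s * g s + f s * g' s).
Proof.
move=> hf hg; have [Kf Kf0 lf] := C11_lip hf; have [Kg Kg0 lg] := C11_lip hg.
have [K1 K10 h1] := C11_K hf; have [K2 K20 h2] := C11_K hg.
exists (K1 * K2 + K1 * K2 + Kf * Kg), (K1 * K2 + K1 * K2) => s s' hs hs'.
have [a1 a2 a3] := h1 s s' hs hs'; have [b1 b2 b3] := h2 s s' hs hs'.
have le2 (x y : R[i]) : normc x <= K1 -> normc y <= K2 -> normc (x * y) <= K1 * K2.
  by move=> hx hy; rewrite normcM ler_pM ?normc_ge0.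
split.
- rewrite (_ : _ - _ = (f s' - f s - (s' - s)%:C * f' s) * g s +
     f s * (g s' - g s - (s' - s)%:C * g' s) + (f s' - f s) * (g s' - g s)); last by ring.
  apply: le_trans (normcD _ _) _; rewrite [leRHS]mulrDl; apply: lerD.
    apply: le_trans (normcD _ _) _; rewrite [leRHS]mulrDl !normcM; apply: lerD.
      by rewrite mulrAC; apply: ler_pM; rewrite ?normc_ge0.
    by rewrite -mulrA; apply: ler_pM; rewrite ?normc_ge0.
  have e : (s' - s) ^+ 2 = `|s' - s| ^+ 2 by rewrite real_normK ?num_real.
  rewrite normcM e expr2 mulrACA; apply: ler_pM; rewrite ?normc_ge0 //; [exact: lf|exact: lg].
- apply: le_trans (le2 _ _ a2 b2) _; rewrite lerDl mulr_ge0 //.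
- by apply: le_trans (normcD _ _) _; apply: lerD; apply: le2.
Qed.

Lemma C11_cexp u u' : C11 u u' -> C11 (fun s => cexp (u s)) (fun s => u' s * cexp (u s)).
Proof.
move=> hu; have [L L0 lu] := C11_lip hu; have [K K0 h] := C11_K hu.
exists (16 * L ^+ 2 * expR K + K * expR K), (expR K + K * expR K) => s s' hs hs'.
have [a1 a2 a3] := h s s' hs hs'.
have E s0 : 0 <= s0 <= 1 -> normc (cexp (u s0)) <= expR K.
  move=> hs0; have [_ b2 _] := h s0 s0 hs0 hs0; apply: normc_cexp_le.
  by apply: le_trans b2; apply: le_trans (normc_Re _); exact: ler_norm.
have e0 := expR_ge0 K.
split.
- rewrite (_ : _ - _ = (cexp (u s') - cexp (u s) - cexp (u s) * (u s' - u s)) +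
    cexp (u s) * (u s' - u s - (s' - s)%:C * u' s)); last by ring.
  apply: le_trans (normcD _ _) _; rewrite [leRHS]mulrDl; apply: lerD.
    apply: le_trans (cexp_taylor2 _ _) _.
    have e : (s' - s) ^+ 2 = `|s' - s| ^+ 2 by rewrite real_normK ?num_real.
    have h2 : normc (u s' - u s) ^+ 2 <= (L * `|s' - s|) ^+ 2.
      by apply: lerXn2r; rewrite ?nnegrE ?normc_ge0 ?mulr_ge0 // lu.
    have := lerD (E s hs) (E s' hs') => h3.
    apply: le_trans (ler_pM _ _ (ler_wpM2l _ h2) h3) _;
      rewrite ?mulr_ge0 ?addr_ge0 ?normc_ge0 ?sqr_ge0 //.
    by rewrite e exprMn le_eqVlt; apply/orP; left; apply/eqP; ring.
  rewrite normcM [K * _]mulrC -mulrA; apply: ler_pM; rewrite ?normc_ge0 ?E //.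
- by apply: le_trans (E s hs) _; rewrite lerDl mulr_ge0.
- rewrite normcM; apply: le_trans (_ : K * expR K <= _).
    by apply: ler_pM; rewrite ?normc_ge0 ?E.
  by rewrite lerDr.
Qed.

(** On a mesh of [M] steps the quadratic remainders add up to at most [K / M], which is below any
    [e], while the linear terms contribute at most [A]. *)
Lemma C11_mean f f' (A : R) : C11 f f' ->
  (forall s, 0 <= s <= 1 -> normc (f' s) <= A) -> normc (f 1 - f 0) <= A.
Proof.
move=> /C11_K[K K0 h] hA; apply/ler_addgt0Pr => e e0.
pose M := (Num.bound (K / e)).+1.
have Mp : 0 < (M%:R : R) by rewrite ltr0n.
have KM : K / M%:R <= e.
  rewrite ler_pdivrMr // mulrC -ler_pdivrMr //; apply/ltW.
  have K' : 0 <= K / e by rewrite divr_ge0 // ltW.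
  by apply: lt_trans (archi_boundP K') _; rewrite ltr_nat ltnS.
have step (i : nat) : (i < M)%N ->
    normc (f (i.+1%:R / M%:R) - f (i%:R / M%:R)) <= (A + e) / M%:R.
  move=> iM; set s := i%:R / _; set s' := i.+1%:R / _.
  have hs : 0 <= s <= 1.
    by rewrite divr_ge0 //= ler_pdivrMr // mul1r ler_nat ltnW.
  have hs' : 0 <= s' <= 1 by rewrite divr_ge0 //= ler_pdivrMr // mul1r ler_nat.
  have d : s' - s = M%:R^-1 by rewrite /s' /s -mulrBl -natrB // subSnn mul1r.
  have [h1 _ _] := h s s' hs hs'; have h2 := hA s hs.
  rewrite (_ : f s' - f s = f s' - f s - (s' - s)%:C * f' s + (s' - s)%:C * f' s); last by ring.
  apply: le_trans (normcD _ _) _; rewrite addrC mulrDl; apply: lerD.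
    rewrite normcM normc_real d ger0_norm ?invr_ge0 // mulrC ler_wpM2r ?invr_ge0 //.
  apply: le_trans h1 _; rewrite d expr2 mulrA ler_wpM2r ?invr_ge0 //.
have -> : f 1 - f 0 = \sum_(0 <= i < M) (f (i.+1%:R / M%:R) - f (i%:R / M%:R)).
  by rewrite telescope_sumr // divff ?gt_eqF // mul0r.
apply: le_trans (normc_sum _ _ _) _.
apply: le_trans (_ : \sum_(0 <= i < M) (A + e) / M%:R <= _).
  by rewrite !big_nat; apply: ler_sum => i /andP[_]; exact: step.
by rewrite sumr_const_nat subn0 -[leLHS]mulr_natr divfK ?gt_eqF.
Qed.

End C11.

(** * Riemann sums of Gaussians over the real line *)

Section RiemannSums.
Variable R : realType.
Implicit Types F G : R -> R[i].

(** The decay under which Riemann sums of all meshes are bounded by the same [24 * K]. *)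
Definition adm F (K : R) := forall x : R, normc (F x) <= K / (1 + x ^+ 2).

(** The Riemann sum of mesh [1 / l] over the whole line; it stands in for an integral that is never
    formed. *)
Definition Rl (l : nat) F : R[i] :=
  usum (fun n : int => (l%:R)^-1 * F (n%:~R / l%:R)).

Lemma sqr1_gt0 (x : R) : 0 < 1 + x ^+ 2.
Proof. by rewrite ltr_wpDr ?sqr_ge0. Qed.

Lemma adm_ge0 F K : adm F K -> 0 <= K.
Proof.
by move=> /(_ 0); rewrite expr0n /= addr0 divr1; apply: le_trans; exact: normc_ge0.
Qed.

Lemma Rl_sbound l F K : (0 < l)%N -> adm F K ->
  sbound (fun n : int => normc ((l%:R)^-1 * F (n%:~R / l%:R))) (24 * K).
Proof.
move=> l0 hF; have K0 := adm_ge0 hF.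
have lp : 0 < (l%:R : R) by rewrite ltr0n.
have k0 : 0 <= K / (l%:R : R) by rewrite divr_ge0 // ltW.
apply: (@sbound_leM _ _ _ (K / l%:R * (24 * l%:R))).
  by rewrite mulrCA divfK ?gt_eqF // lexx.
apply: sbound_le (sboundZ k0 (inv1sq_shift 0 l0)) => n.
by rewrite addr0 normcM normcV normc_nat mulrC [leRHS]mulrAC ler_wpM2r ?invr_ge0 ?(ltW lp).
Qed.

Lemma Rl_asum l F K : (0 < l)%N -> adm F K ->
  asum (fun n : int => (l%:R)^-1 * F (n%:~R / l%:R)).
Proof. by move=> l0 hF; exists (24 * K); apply: Rl_sbound. Qed.

Lemma Rl_le l F K : (0 < l)%N -> adm F K -> normc (Rl l F) <= 24 * K.
Proof. by move=> l0 hF; apply/usum_le/Rl_sbound. Qed.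

Lemma admZ (c : R[i]) F K : adm F K -> adm (fun x => c * F x) (normc c * K).
Proof. by move=> hF x; rewrite normcM -mulrA ler_wpM2l ?normc_ge0. Qed.

Lemma RlD l F G K K' : (0 < l)%N -> adm F K -> adm G K' ->
  Rl l (fun x => F x + G x) = Rl l F + Rl l G.
Proof.
move=> l0 hF hG; apply: usum_eq.
apply: eq_hsum (hsumD (usumP (Rl_asum l0 hF)) (usumP (Rl_asum l0 hG))) => n.
by rewrite mulrDr.
Qed.

Lemma RlZ l c F K : (0 < l)%N -> adm F K -> Rl l (fun x => c * F x) = c * Rl l F.
Proof.
move=> l0 hF; apply: usum_eq; apply: eq_hsum (hsumZ c (usumP (Rl_asum l0 hF))) => n.
by rewrite mulrCA.
Qed.

Lemma Rl_shift l F K : (0 < l)%N -> adm F K ->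
  hsum (fun n : int => (l%:R)^-1 * F (n%:~R / l%:R + (l%:R)^-1)) (Rl l F).
Proof.
move=> l0 hF; have := usumP (Rl_asum l0 hF).
pose h (n : int) := n + 1.
have ih : injective h by move=> n n' /addIr.
rewrite -(hsum_reindex (h := h)) //; last by move=> n _; exists (n - 1); rewrite /h subrK.
by apply: eq_hsum => n; rewrite /h intrD1 mulrDl mul1r.
Qed.

(** The increments of [F] over one mesh step sum to 0 by translation invariance, so the Riemann sum
    of [F'] consists of Taylor errors only. *)
Lemma Rl_derive l F F' K K1 K2 : (0 < l)%N -> adm F K -> adm F' K1 ->
  (forall x, normc (F (x + (l%:R)^-1) - F x - (l%:R)^-1 * F' x) <=
    K2 / l%:R ^+ 2 / (1 + x ^+ 2)) ->
  normc (Rl l F') <= 24 * K2 / l%:R.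
Proof.
move=> l0 hF hF' h; have lp : 0 < (l%:R : R) by rewrite ltr0n.
have ln0 : (l%:R : R[i]) != 0 by rewrite pnatr_eq0 -lt0n.
pose E x := F' x - l%:R * (F (x + (l%:R)^-1) - F x).
have hE : adm E (K2 / l%:R).
  move=> x; rewrite /E.
  rewrite (_ : _ - _ = - l%:R * (F (x + (l%:R)^-1) - F x - (l%:R)^-1 * F' x)); last by field.
  rewrite normcM normcN normc_nat; apply: le_trans (ler_wpM2l (ltW lp) (h x)) _.
  rewrite le_eqVlt; apply/orP; left; apply/eqP; field.
  by rewrite !gt_eqF ?sqr1_gt0.
rewrite (_ : Rl l F' = Rl l E); first by rewrite -mulrA; exact: Rl_le.
apply: usum_eq.
have h0 := hsumB (Rl_shift l0 hF) (usumP (Rl_asum l0 hF)).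
rewrite subrr in h0.
have := hsumD (usumP (Rl_asum l0 hE)) (hsumZ l%:R h0).
rewrite mulr0 addr0; apply: eq_hsum => n; rewrite /E; field.
exact: ln0.
Qed.

Definition gau (al be : R[i]) (x : R) : R[i] :=
  cexp (- al * (x ^+ 2)%:C + be * x%:C).

Lemma normc_gau al be x : normc (gau al be x) =
  expR (- (complex.Re al * x ^+ 2) + complex.Re be * x).
Proof.
rewrite normc_cexp; congr expR; rewrite ReD !ReM ReN /=; ring.
Qed.

(** The constant depends only on a lower bound of [Re al] and an upper bound of [|be|], so it holds
    along whole paths of parameters. The point [y] may differ from [x] by a mesh step. *)
Lemma gau_bound (a b : R) (p : nat) : 0 < a -> 0 <= b ->
  exists2 K : R, 0 <= K & forall (al be : R[i]) (x y : R) (w : R[i]) (c : R),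
    a <= complex.Re al -> normc be <= b -> `|y - x| <= 1 ->
    normc w <= c * (1 + x ^+ 2) ^+ p ->
    normc (w * gau al be y) <= c * K / (1 + x ^+ 2).
Proof.
move=> a0 b0; have [K K0 hK] := gauss_poly_bound p.+1 a0 b0.
exists (3 ^+ p.+1 * K); first by rewrite mulr_ge0 ?exprn_ge0.
move=> al be x y w c ha hb hxy hw.
have y0 := sqr1_gt0 y; have x0 := sqr1_gt0 x.
rewrite normcM ler_pdivlMr //.
have g1 : normc (gau al be y) <= expR (- (a * y ^+ 2) + b * `|y|).
  rewrite normc_gau ler_expR; apply: lerD.
    by rewrite lerN2 ler_wpM2r ?sqr_ge0.
  apply: le_trans (ler_norm _) _; rewrite normrM ler_wpM2r //.
  exact: le_trans (normc_Re _) hb.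
have g0 := normc_ge0 (gau al be y).
have xy : 1 + x ^+ 2 <= 3 * (1 + y ^+ 2).
  have d1 : (y - x) ^+ 2 <= 1.
    by rewrite -(@real_normK _ (y - x)) ?num_real // -(expr1n R 2); apply: lerXn2r; rewrite ?nnegrE.
  have := sqr_ge0 (y - 2 * (y - x)); have := sqr_ge0 (y + (y - x)); nra.
have g2 : (1 + x ^+ 2) ^+ p.+1 * normc (gau al be y) <= 3 ^+ p.+1 * K.
  apply: le_trans (_ : (3 * (1 + y ^+ 2)) ^+ p.+1 * normc (gau al be y) <= _).
    by rewrite ler_wpM2r //; apply: lerXn2r; rewrite ?nnegrE ?mulr_ge0 ?(ltW x0) ?(ltW y0).
  rewrite exprMn -mulrA ler_wpM2l ?exprn_ge0 //.
  by apply: le_trans (hK y); rewrite ler_wpM2l // exprn_ge0 // ltW.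
have c0 : 0 <= c.
  have := le_trans (normc_ge0 _) hw; rewrite pmulr_lge0 // exprn_gt0 //.
apply: le_trans (_ : c * ((1 + x ^+ 2) ^+ p.+1 * normc (gau al be y)) <= _).
  rewrite [_ ^+ p.+1]exprSr (_ : c * _ = c * (1 + x ^+ 2) ^+ p * normc (gau al be y) * (1 + x ^+ 2)); last by ring.
  by apply: ler_wpM2r; [nneg|apply: ler_wpM2r].
by rewrite ler_wpM2l.
Qed.

Lemma pow1_ge1 (x : R) p : 1 <= (1 + x ^+ 2) ^+ p.
Proof. by rewrite exprn_ege1 // lerDl sqr_ge0. Qed.

Lemma normx_le (x : R) : `|x| <= 1 + x ^+ 2.
Proof.
have := sqr_ge0 (`|x| - 1); rewrite sqrrB1 real_normK ?num_real // => h.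
have := normr_ge0 x; lra.
Qed.

Lemma sqx_le (x : R) : x ^+ 2 <= 1 + x ^+ 2.
Proof. by rewrite lerDr. Qed.

Lemma gau_adm (a b : R) (p : nat) al be (w : R -> R[i]) (c : R) :
  0 < complex.Re al ->
  (forall x, normc (w x) <= c * (1 + x ^+ 2) ^+ p) ->
  exists K, adm (fun x => w x * gau al be x) K.
Proof.
move=> a0 hw; have [K K0 h] := gau_bound p a0 (normc_ge0 be).
by exists (c * K) => x; apply: h => //; rewrite ?lexx ?subrr ?normr0.
Qed.

Lemma gau_adm_poly al be (c0 c1 c2 : R[i]) : 0 < complex.Re al ->
  exists K, adm (fun x => (c0 + c1 * x%:C + c2 * (x ^+ 2)%:C) * gau al be x) K.
Proof.
move=> a0; apply: (@gau_adm 0 0 1 _ _ _ (normc c0 + normc c1 + normc c2)) => // x.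
rewrite expr1 !mulrDl; apply: le_trans (normcD _ _) _; apply: lerD.
  apply: le_trans (normcD _ _) _; apply: lerD; last first.
    by rewrite normcM normc_real ler_wpM2l ?normc_ge0 ?normx_le.
  by rewrite ler_peMr ?normc_ge0 // -[leRHS]expr1 pow1_ge1.
by rewrite normcM normc_real ger0_norm ?sqr_ge0 // ler_wpM2l ?normc_ge0 ?sqx_le.
Qed.

(* Summing the increments of [(c0 + c1 x) gau] over a full period gives 0: a
   discrete integration by parts. *)
Lemma gau_parts (a A b : R) (c0 c1 : R[i]) : 0 < a -> 0 <= A -> 0 <= b ->
  exists2 K : R, 0 <= K & forall (l : nat) (al be : R[i]), (0 < l)%N ->
  a <= complex.Re al -> normc al <= A -> normc be <= b ->
  normc (Rl l (fun x => (c1 + (c0 + c1 * x%:C) * (be - 2 * al * x%:C)) * gau al be x))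
    <= K / l%:R.
Proof.
move=> a0 A0 b0; have [K K0 hK] := gau_bound 4 a0 b0.
pose cc := normc c0 + normc c1; pose C := 2 * A + b.
have cc0 : 0 <= cc by rewrite addr_ge0 ?normc_ge0.
have C0 : 0 <= C by rewrite addr_ge0 ?mulr_ge0.
pose D := 2 * (8 * C ^+ 2 * (2 * cc)) + (cc * (A + C)).
have D0 : 0 <= D by rewrite /D; nneg.
exists (24 * (D * K)); first by rewrite !mulr_ge0.
move=> l al be l0 ha hA hb.
have are : 0 < complex.Re al by apply: lt_le_trans ha.
have lp : 0 < (l%:R : R) by rewrite ltr0n.
set h := ((l%:R)^-1 : R); have hp : 0 < h by rewrite invr_gt0.
have h1 : h <= 1 by rewrite invf_le1 ?ltr1n // ler1n.
have [K1 ad1] := gau_adm_poly be c0 c1 0 are.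
have [K2 ad2] := gau_adm_poly be (c1 + c0 * be) (c1 * be - 2 * al * c0) (- (2 * al * c1)) are.
apply: (@Rl_derive l (fun x => (c0 + c1 * x%:C) * gau al be x) _ K1 K2 (D * K)) => //.
- by move=> x; have := ad1 x; rewrite mul0r addr0.
- move=> x; have := ad2 x; congr (normc (_ * _) <= _).
  by rewrite rmorphXn /=; ring.
move=> x; pose g := gau al be x; pose g' := gau al be (x + h).
pose v := (- al * ((x + h) ^+ 2)%:C + be * (x + h)%:C) - (- al * (x ^+ 2)%:C + be * x%:C).
have tay := cexp_taylor2 (- al * (x ^+ 2)%:C + be * x%:C) (- al * ((x + h) ^+ 2)%:C + be * (x + h)%:C).
rewrite -/v -[cexp _]/g' -/(gau al be x) -/g in tay.
have vE : v = h%:C * (be - 2 * al * x%:C) - al * (h ^+ 2)%:C.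
  by rewrite /v !rmorphXn /= !rmorphD /=; ring.
have hc : (l%:R)^-1 = h%:C by rewrite fmorphV /= -natC.
rewrite hc -/g -/g'.
set y := 1 + x ^+ 2.
have y1 : 1 <= y by rewrite /y lerDl sqr_ge0.
have y0 : 0 < y by rewrite (lt_le_trans _ y1).
have xy : `|x| <= y by exact: normx_le.
have vle : normc v <= h * (C * y).
  rewrite vE; apply: le_trans (normcB _ _) _.
  rewrite !normcM !normc_real (ger0_norm (ltW hp)) (ger0_norm (sqr_ge0 _)).
  have e1 : normc (be - 2 * al * x%:C) <= b + 2 * A * `|x|.
    apply: le_trans (normcB _ _) _; apply: lerD => //.
    rewrite !normcM normc_nat normc_real ler_wpM2r // ler_wpM2l //.
  have e2 : normc al * h ^+ 2 <= A * h by rewrite expr2 mulrA ler_wpM2r ?(ltW hp) //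
    -[leRHS]mulr1 ler_pM ?normc_ge0 ?(ltW hp).
  have e3 : h * normc (be - 2 * al * x%:C) <= h * (b + 2 * A * `|x|) by rewrite ler_wpM2l // ltW.
  have e4 : b + 2 * A * `|x| + A <= C * y.
    have : 2 * `|x| <= y.
      by have := sqr_ge0 (`|x| - 1); rewrite sqrrB1 real_normK ?num_real // /y; lra.
    move=> e5; have : A * (2 * `|x|) <= A * y by rewrite ler_wpM2l.
    have : b <= b * y by rewrite ler_peMr.
    have : A <= A * y by rewrite ler_peMr.
    by rewrite /C; lra.
  have : h * (b + 2 * A * `|x| + A) <= h * (C * y) by rewrite ler_wpM2l // ltW.
  lra.
have wle (t : R) : `|t| <= y -> normc (c0 + c1 * t%:C) <= cc * y.
  move=> ht; apply: le_trans (normcD _ _) _; rewrite [leRHS]mulrDl; apply: lerD.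
    by rewrite ler_peMr ?normc_ge0.
  by rewrite normcM normc_real ler_wpM2l ?normc_ge0.
pose e2 := g' - g - g * v.
have -> : (c0 + c1 * (x + h)%:C) * g' - (c0 + c1 * x%:C) * g -
    h%:C * ((c1 + (c0 + c1 * x%:C) * (be - 2 * al * x%:C)) * g) =
  (c0 + c1 * (x + h)%:C) * e2 +
  ((c0 + c1 * x%:C) * (- al * (h ^+ 2)%:C) + c1 * h%:C * v) * g.
  by rewrite /e2 vE !rmorphXn /= !rmorphD /=; ring.
have g1 := hK al be x x _ _ ha hb; have g2 := hK al be x (x + h) _ _ ha hb.
have hn : `|x + h - x| <= 1 by rewrite addrAC subrr add0r ger0_norm ?(ltW hp).
have hx : `|x - x| <= 1 by rewrite subrr normr0.
apply: le_trans (normcD _ _) _.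
rewrite (_ : D * K / l%:R ^+ 2 / (1 + x ^+ 2) =
    2 * (8 * (h * C) ^+ 2 * (2 * cc)) * K / y + (cc * (A + C)) * h ^+ 2 * K / y); last first.
  by rewrite /h -/y /D; field; rewrite !gt_eqF.
apply: lerD.
  have x2 : normc (c0 + c1 * (x + h)%:C) <= 2 * cc * y.
    apply: le_trans (_ : normc ((c0 + c1 * x%:C) + c1 * h%:C) <= _).
      by rewrite rmorphD /= mulrDr addrA lexx.
    apply: le_trans (normcD _ _) _; have := wle x xy.
    rewrite normcM normc_real ger0_norm ?(ltW hp) //.
    have : normc c1 * h <= cc * y.
      by apply: ler_pM; rewrite ?normc_ge0 ?(ltW hp) // ?lerDr ?normc_ge0 // (le_trans h1).
    lra.
  have V2 : normc v ^+ 2 <= (h * C) ^+ 2 * y ^+ 2.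
    by rewrite -exprMn -mulrA; apply: lerXn2r => //; rewrite nnegrE; nneg.
  have W (G : R[i]) : 0 <= normc G -> normc (c0 + c1 * (x + h)%:C) * (8 * normc v ^+ 2 * normc G) <=
     8 * (h * C) ^+ 2 * (2 * cc) * y ^+ 4 * normc G.
    move=> G0; rewrite mulrA ler_wpM2r //.
    apply: le_trans (ler_pM _ _ x2 (ler_wpM2l _ V2)) _; [nneg ..|].
    rewrite (_ : 2 * cc * y * _ = 8 * (h * C) ^+ 2 * (2 * cc) * y ^+ 3); last by ring.
    apply: ler_wpM2l; first nneg.
    by rewrite ler_weXn2l.
  pose cst := 8 * (h * C) ^+ 2 * (2 * cc).
  have cst0 : 0 <= cst by rewrite /cst; nneg.
  have B (t : R) : `|t - x| <= 1 -> cst * y ^+ 4 * normc (gau al be t) <= cst * K / y.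
    move=> ht; have := hK al be x t ((cst * y ^+ 4)%:C) cst ha hb ht.
    have c4 : 0 <= cst * y ^+ 4 by nneg.
    by rewrite normcM normc_real (ger0_norm c4); apply; rewrite lexx.
  rewrite normcM; apply: le_trans (ler_wpM2l (normc_ge0 _) tay) _.
  rewrite mulrDr mulrDr; apply: le_trans (lerD (W g (normc_ge0 _)) (W g' (normc_ge0 _))) _.
  apply: le_trans (lerD (B x hx) (B (x + h) hn)) _.
  by rewrite le_eqVlt; apply/orP; left; apply/eqP; rewrite /cst; ring.
apply: (hK al be x x) => //; rewrite -/y.
apply: le_trans (normcD _ _) _; rewrite !normcM normcN !normc_real.
rewrite (ger0_norm (ltW hp)) (ger0_norm (sqr_ge0 _)).
have q1 : normc (c0 + c1 * x%:C) * (normc al * h ^+ 2) <= cc * y * (A * h ^+ 2).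
  by apply: ler_pM; [nneg|nneg|exact: wle|apply: ler_wpM2r; [nneg|]].
have q2 : normc c1 * h * normc v <= cc * h * (h * (C * y)).
  by apply: ler_pM; [nneg|nneg|apply: ler_wpM2r; [nneg|rewrite lerDr normc_ge0]|].
apply: le_trans (lerD q1 q2) _.
rewrite (_ : _ + _ = cc * (A + C) * h ^+ 2 * y); last by ring.
apply: ler_wpM2l; first nneg.
by rewrite -[leLHS]expr1 ler_weXn2l.
Qed.

(** Differentiation of a Riemann sum in its parameters: the termwise quadratic remainders are again
    admissible, with a constant proportional to [(s' - s) ^ 2]. *)
Lemma gau_C11 (l : nat) (a : R) (al al' be be' : R -> R[i]) : (0 < l)%N -> 0 < a ->
  C11 al al' -> C11 be be' -> (forall s : R, 0 <= s <= 1 -> a <= complex.Re (al s)) ->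
  C11 (fun s => Rl l (gau (al s) (be s)))
      (fun s => Rl l (fun x => (be' s * x%:C - al' s * (x ^+ 2)%:C) * gau (al s) (be s) x)).
Proof.
move=> l0 a0 Ca Cb are.
have [K1 K10 h1] := C11_K Ca; have [K2 K20 h2] := C11_K Cb.
have [L1 L10 l1] := C11_lip Ca; have [L2 L20 l2] := C11_lip Cb.
have [K K0 hK] := gau_bound 3 a0 K20.
have bnd s : 0 <= s <= 1 -> normc (be s) <= K2.
  by move=> hs; have [_ ? _] := h2 s s hs hs.
have y1 (x : R) : 1 <= 1 + x ^+ 2 by rewrite lerDl sqr_ge0.
have pw (x : R) (i j : nat) : (i <= j)%N -> (1 + x ^+ 2) ^+ i <= (1 + x ^+ 2) ^+ j.
  by move=> ij; rewrite ler_weXn2l.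
have A0 s : 0 <= s <= 1 -> adm (gau (al s) (be s)) K.
  move=> hs x; have := hK (al s) (be s) x x 1 1 (are _ hs) (bnd _ hs).
  by rewrite subrr normr0 !mul1r normc1 => ->//; rewrite pow1_ge1.
have A1 s : 0 <= s <= 1 -> adm (fun x => (be' s * x%:C - al' s * (x ^+ 2)%:C) * gau (al s) (be s) x) ((K1 + K2) * K).
  move=> hs x; apply: hK; rewrite ?are ?bnd ?subrr ?normr0 //.
  have [_ _ q1] := h1 s s hs hs; have [_ _ q2] := h2 s s hs hs.
  apply: le_trans (normcB _ _) _; rewrite !normcM !normc_real (ger0_norm (sqr_ge0 _)) addrC mulrDl.
  apply: lerD.
    apply: ler_pM; rewrite ?normc_ge0 ?sqr_ge0 //.
    by apply: le_trans (sqx_le x) _; rewrite -[leLHS]expr1 pw.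
  apply: ler_pM; rewrite ?normc_ge0 //.
  by apply: le_trans (normx_le x) _; rewrite -[leLHS]expr1 pw.
pose C := 16 * (L1 + L2) ^+ 2 + (K1 + K2).
have C0 : 0 <= C by rewrite /C !(addr_ge0, mulr_ge0) ?sqr_ge0.
exists (24 * (C * K)), (24 * K + 24 * ((K1 + K2) * K)) => s s' hs hs'.
split; last 2 first.
- apply: le_trans (Rl_le l0 (A0 s hs)) _; rewrite lerDl !mulr_ge0 ?addr_ge0 //.
- apply: le_trans (Rl_le l0 (A1 s hs)) _; rewrite lerDr !mulr_ge0 //.
set d := s' - s.
pose E x := gau (al s') (be s') x - gau (al s) (be s) x -
  d%:C * ((be' s * x%:C - al' s * (x ^+ 2)%:C) * gau (al s) (be s) x).
have hE : adm E (C * K * d ^+ 2).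
  move=> x; set y := 1 + x ^+ 2.
  pose u := - al s * (x ^+ 2)%:C + be s * x%:C.
  pose u' := - al s' * (x ^+ 2)%:C + be s' * x%:C.
  pose v := u' - u.
  have tay := cexp_taylor2 u u'; rewrite -/v -/(gau (al s) (be s) x) -/(gau (al s') (be s') x) in tay.
  set g := gau (al s) (be s) x in tay *; set g' := gau (al s') (be s') x in tay *.
  have EE : E x = (g' - g - g * v) + (v - d%:C * (be' s * x%:C - al' s * (x ^+ 2)%:C)) * g.
    by rewrite /E -/g -/g'; ring.
  have yy0 : 0 < y by rewrite sqr1_gt0.
  have d2 : d ^+ 2 = `|d| ^+ 2 by rewrite real_normK ?num_real.
  have vle : normc v <= (L1 + L2) * `|d| * y.
    rewrite (_ : v = (be s' - be s) * x%:C - (al s' - al s) * (x ^+ 2)%:C); last by rewrite /v /u /u'; ring.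
    apply: le_trans (normcB _ _) _; rewrite !normcM !normc_real (ger0_norm (sqr_ge0 x)).
    rewrite addrC !mulrDl; apply: lerD; apply: ler_pM; rewrite ?normc_ge0 ?sqr_ge0 ?l1 ?l2 //.
      exact: sqx_le.
    exact: normx_le.
  have V2 : normc v ^+ 2 <= (L1 + L2) ^+ 2 * d ^+ 2 * y ^+ 2.
    by rewrite d2 -!exprMn; apply: lerXn2r => //; rewrite nnegrE; nneg.
  pose cst := 8 * ((L1 + L2) ^+ 2 * d ^+ 2).
  have cst0 : 0 <= cst by rewrite /cst; nneg.
  have B r : 0 <= r <= 1 -> 8 * normc v ^+ 2 * normc (gau (al r) (be r) x) <= cst * K / y.
    move=> hr; have := hK (al r) (be r) x x ((8 * normc v ^+ 2)%:C) cst (are r hr) (bnd r hr).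
    have c4 : 0 <= 8 * normc v ^+ 2 by nneg.
    rewrite normcM normc_real (ger0_norm c4) subrr normr0; apply=> //.
    rewrite /cst -mulrA ler_wpM2l //; apply: le_trans V2 _.
    by apply: ler_wpM2l; [nneg|rewrite pw].
  rewrite EE; apply: le_trans (normcD _ _) _.
  rewrite (_ : C * K * d ^+ 2 / (1 + x ^+ 2) = (cst * K / y + cst * K / y) + (K1 + K2) * d ^+ 2 * K / y); last first.
    by rewrite /C /cst -/y; field; rewrite gt_eqF.
  apply: lerD.
    apply: le_trans tay _; rewrite mulrDr; apply: lerD; exact: B.
  apply: hK; rewrite ?are ?bnd ?subrr ?normr0 //.
  have [q1 _ _] := h1 s s' hs hs'; have [q2 _ _] := h2 s s' hs hs'.
  rewrite (_ : v - _ = (be s' - be s - d%:C * be' s) * x%:C - (al s' - al s - d%:C * al' s) * (x ^+ 2)%:C); last by rewrite /v /u /u'; ring.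
  apply: le_trans (normcB _ _) _; rewrite !normcM !normc_real (ger0_norm (sqr_ge0 x)) addrC.
  rewrite !mulrDl; apply: lerD; apply: ler_pM; rewrite ?normc_ge0 ?sqr_ge0 //.
    by apply: le_trans (sqx_le x) _; rewrite -[leLHS]expr1 pw.
  by apply: le_trans (normx_le x) _; rewrite -[leLHS]expr1 pw.
have -> : Rl l (gau (al s') (be s')) - Rl l (gau (al s) (be s)) - d%:C *
    Rl l (fun x => (be' s * x%:C - al' s * (x ^+ 2)%:C) * gau (al s) (be s) x) = Rl l E.
  apply/esym/usum_eq.
  have := hsumB (hsumB (usumP (Rl_asum l0 (A0 s' hs'))) (usumP (Rl_asum l0 (A0 s hs))))
    (hsumZ d%:C (usumP (Rl_asum l0 (A1 s hs)))).
  by apply: eq_hsum => n; rewrite /E; ring.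
by rewrite -mulrA; apply: Rl_le.
Qed.

End RiemannSums.

(** * Asymptotics and Fourier decay of Gaussian Riemann sums *)

Section GaussianRiemann.
Variable R : realType.
Implicit Types al be : R[i].

(** This replaces a shift of contour. Along the path [s * be] the derivative of the compensated sum
    is the Riemann sum of an exact derivative in [x], hence of order [1 / l] by [gau_parts];
    [C11_mean] integrates this bound. *)
Lemma Rl_gau_shift al be : 0 < complex.Re al ->
  exists2 K : R, 0 <= K & forall l, (0 < l)%N ->
    normc (cexp (- (be ^+ 2 / (4 * al))) * Rl l (gau al be) - Rl l (gau al 0)) <= K / l%:R.
Proof.
move=> a0.
have al0 : al != 0 by apply: contraTneq a0 => ->; rewrite ltxx.
have [K K0 hK] := gau_parts 1 0 a0 (normc_ge0 al) (normc_ge0 be).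
(* [ka] is the factor for which [2 s c + be x = ka (s be - 2 al x)], the logarithmic derivative of
   the Gaussian in [x]. *)
pose c := - (be ^+ 2 / (4 * al)); pose ka := - (be / (2 * al)).
exists (expR (normc c) * (normc ka * K)); first by rewrite !mulr_ge0 ?expR_ge0 ?normc_ge0.
move=> l l0.
have Cu := C11_mul (C11_mul (@C11_id R) (@C11_id R)) (C11_cst c).
have Cb := C11_mul (@C11_id R) (C11_cst be).
have ha (s : R) : 0 <= s <= 1 -> complex.Re al <= complex.Re al by rewrite lexx.
have CR := gau_C11 l0 a0 (C11_cst al) Cb ha.
have Cphi := C11_mul (C11_cexp Cu) CR.
apply: (le_trans _ (C11_mean (A := expR (normc c) * (normc ka * K) / l%:R) Cphi _)).
  by rewrite /= !mul1r !mul0r cexp0 mul1r lexx.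
move=> s hs; have /andP[s0 s1] := hs.
have [K1 ad1] := gau_adm_poly (s%:C * be) 1 0 0 a0.
have [K2 ad2] := gau_adm_poly (s%:C * be) (s%:C * be) (- (2 * al)) 0 a0.
have [K3 ad3] := gau_adm_poly (s%:C * be) 0 be 0 a0.
pose u := s%:C * s%:C * c.
have -> : ((1 * s%:C + s%:C * 1) * c + s%:C * s%:C * 0) * cexp u * Rl l (gau al (s%:C * be)) +
  cexp u * Rl l (fun x => ((1 * be + s%:C * 0) * x%:C - 0 * (x ^+ 2)%:C) * gau al (s%:C * be) x)
  = cexp u * (ka * Rl l (fun x => (0 + (1 + 0 * x%:C) * (s%:C * be - 2 * al * x%:C)) * gau al (s%:C * be) x)).
  have e1 : Rl l (gau al (s%:C * be)) = Rl l (fun x => (1 + 0 * x%:C + 0 * (x ^+ 2)%:C) * gau al (s%:C * be) x).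
    by apply: eq_usum => n; ring.
  have e2 : Rl l (fun x => (0 + (1 + 0 * x%:C) * (s%:C * be - 2 * al * x%:C)) * gau al (s%:C * be) x)
     = Rl l (fun x => (s%:C * be + - (2 * al) * x%:C + 0 * (x ^+ 2)%:C) * gau al (s%:C * be) x).
    by apply: eq_usum => n; ring.
  have e3 : Rl l (fun x => ((1 * be + s%:C * 0) * x%:C - 0 * (x ^+ 2)%:C) * gau al (s%:C * be) x)
     = Rl l (fun x => (0 + be * x%:C + 0 * (x ^+ 2)%:C) * gau al (s%:C * be) x).
    by apply: eq_usum => n; ring.
  rewrite e1 e2 e3 mulrAC [X in X + _]mulrC -mulrDr; congr (_ * _).
  rewrite -(RlZ _ l0 ad1) -(RlZ _ l0 ad2) -(RlD l0 (admZ _ ad1) ad3).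
  apply: eq_usum => n; rewrite /c /ka; field.
  by rewrite pnatr_eq0 -lt0n l0.
rewrite normcM -[leRHS]mulrA; apply: ler_pM; [nneg|nneg| |].
  apply: normc_cexp_le; apply: le_trans (_ : normc u <= _).
    by apply: le_trans (normc_Re _); exact: ler_norm.
  rewrite /u !normcM !normc_real ger0_norm // ler_piMl ?normc_ge0 //.
  by rewrite -[leRHS]mulr1 ler_pM.
rewrite normcM -[leRHS]mulrA; apply: ler_wpM2l; first nneg.
apply: hK => //; rewrite ?lexx // normcM normc_real ger0_norm //.
by rewrite ler_piMl ?normc_ge0.
Qed.

Lemma cos_segment (th s : R) : `|th| < pi / 2 -> 0 <= s <= 1 -> cos th <= cos (s * th).
Proof.
have ca (x : R) : cos x = cos `|x| by case: (ger0P x) => // _; rewrite cosN.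
move=> ht /andP[s0 s1]; rewrite ca (ca (s * th)) normrM (ger0_norm s0).
set t := `|th|; have t0 : 0 <= t by exact: normr_ge0.
have pp := pi_gt0 R.
have st : s * t <= t by rewrite ler_piMl.
have [->//|ne] := eqVneq (s * t) t; apply/ltW.
rewrite ltr_cos ?in_itv /=.
- by rewrite lt_neqAle ne.
- by rewrite mulr_ge0 //=; apply: le_trans st _; rewrite /t; lra.
- by rewrite t0 /=; rewrite /t; lra.
Qed.

(** This replaces a rotation of contour. Along [pi exp (s ze)] the derivative of the sum,
    compensated by [exp (s ze / 2)], is [ze / 2] times the Riemann sum of the derivative of [x]
    times the Gaussian. *)
Lemma Rl_gau_rot (ze : R[i]) : `|complex.Im ze| < pi / 2 ->
  exists2 K : R, 0 <= K & forall l, (0 < l)%N ->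
    normc (cexp (ze / 2) * Rl l (gau ((pi : R)%:C * cexp ze) 0) - Rl l (gau (pi : R)%:C 0)) <= K / l%:R.
Proof.
move=> him; have pp := pi_gt0 R.
have cp : 0 < cos (complex.Im ze).
  by rewrite cos_gt0_pihalf //; move: him; rewrite ltr_norml; case/andP=> h1 h2; apply/andP; split; lra.
(* A lower bound of the real part on the whole path: [cos (s t) >= cos t] for [|t| < pi / 2] and [s]
   in [[0, 1]]. *)
pose a := pi * (expR (- `|complex.Re ze|) * cos (complex.Im ze)).
have a0 : 0 < a by rewrite !mulr_gt0 ?expR_gt0.
pose A : R := pi * expR (normc ze).
have A0 : 0 <= A by rewrite mulr_ge0 ?expR_ge0 ?ltW.
have [K K0 hK] := gau_parts 0 1 a0 A0 (lexx 0).
exists (expR (normc ze) * (normc (ze / 2) * K)); first by rewrite !mulr_ge0 ?expR_ge0 ?normc_ge0.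
move=> l l0.
pose ex s := cexp (s%:C * ze).
have Ca := C11_mul (C11_cst (pi : R)%:C) (C11_cexp (C11_mul (@C11_id R) (C11_cst ze))).
have Cu := C11_mul (@C11_id R) (C11_cst (ze / 2)).
have ReE (s : R) : complex.Re ((pi : R)%:C * cexp (s%:C * ze)) =
   pi * (expR (s * complex.Re ze) * cos (s * complex.Im ze)).
  by rewrite ReMC /cexp /= ?ReMC ?ImMC.
have ha (s : R) : 0 <= s <= 1 -> a <= complex.Re ((pi : R)%:C * cexp (s%:C * ze)).
  move=> hs; have /andP[s0 s1] := hs.
  rewrite ReE ler_pM2l //; apply: ler_pM; rewrite ?expR_ge0 ?(ltW cp) ?cos_segment //.
  rewrite ler_expR; have := ler_norm (- (s * complex.Re ze)).
  rewrite normrN normrM (ger0_norm s0) => h1.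
  have : s * `|complex.Re ze| <= `|complex.Re ze| by rewrite ler_piMl.
  lra.
have CR := gau_C11 l0 a0 Ca (C11_cst 0) ha.
have Cphi := C11_mul (C11_cexp Cu) CR.
apply: (le_trans _ (C11_mean (A := expR (normc ze) * (normc (ze / 2) * K) / l%:R) Cphi _)).
  by rewrite /= !mul1r !mul0r cexp0 mul1r mulr1 lexx.
move=> s hs; have /andP[s0 s1] := hs.
set al := (pi : R)%:C * cexp (s%:C * ze).
have are : 0 < complex.Re al by apply: lt_le_trans (ha s hs).
have [K1 ad1] := gau_adm_poly 0 1 0 0 are.
have [K2 ad2] := gau_adm_poly 0 1 0 (- (2 * al)) are.
have [K3 ad3] := gau_adm_poly 0 0 0 (- (ze * al)) are.
set u := s%:C * (ze / 2).
have -> : (1 * (ze / 2) + s%:C * 0) * cexp u * Rl l (gau al 0) +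
   cexp u * Rl l (fun x => (0 * x%:C - (0 * cexp (s%:C * ze) +
     (pi : R)%:C * ((1 * ze + s%:C * 0) * cexp (s%:C * ze))) * (x ^+ 2)%:C) * gau al 0 x)
  = cexp u * (ze / 2 * Rl l (fun x => (1 + (0 + 1 * x%:C) * (0 - 2 * al * x%:C)) * gau al 0 x)).
  have e1 : Rl l (gau al 0) = Rl l (fun x => (1 + 0 * x%:C + 0 * (x ^+ 2)%:C) * gau al 0 x).
    by apply: eq_usum => n; ring.
  have e2 : Rl l (fun x => (1 + (0 + 1 * x%:C) * (0 - 2 * al * x%:C)) * gau al 0 x)
     = Rl l (fun x => (1 + 0 * x%:C + - (2 * al) * (x ^+ 2)%:C) * gau al 0 x).
    by apply: eq_usum => n; rewrite rmorphXn /=; ring.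
  have e3 : Rl l (fun x => (0 * x%:C - (0 * cexp (s%:C * ze) +
     (pi : R)%:C * ((1 * ze + s%:C * 0) * cexp (s%:C * ze))) * (x ^+ 2)%:C) * gau al 0 x)
     = Rl l (fun x => (0 + 0 * x%:C + - (ze * al) * (x ^+ 2)%:C) * gau al 0 x).
    by apply: eq_usum => n; rewrite /al; ring.
  rewrite e1 e2 e3 mulrAC [X in X + _]mulrC -mulrDr; congr (_ * _).
  rewrite -(RlZ _ l0 ad1) -(RlZ _ l0 ad2) -(RlD l0 (admZ _ ad1) ad3).
  by apply: eq_usum => n; field; rewrite pnatr_eq0 -lt0n l0.
rewrite normcM -[leRHS]mulrA; apply: ler_pM; [nneg|nneg| |].
  apply: normc_cexp_le; apply: le_trans (_ : normc u <= _).
    by apply: le_trans (normc_Re _); exact: ler_norm.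
  rewrite /u !normcM normcV normc_nat !normc_real ger0_norm //.
  have z0 := normc_ge0 ze; have : s * (normc ze / 2) <= normc ze / 2 by rewrite ler_piMl ?divr_ge0.
  lra.
rewrite normcM -[leRHS]mulrA; apply: ler_wpM2l; first nneg.
apply: hK => //; rewrite ?normc0 //; first exact: ha.
rewrite /al normcM normc_real (ger0_norm (ltW pp)) ler_wpM2l ?(ltW pp) //.
apply: normc_cexp_le; apply: le_trans (_ : normc (s%:C * ze) <= _).
  by apply: le_trans (normc_Re _); exact: ler_norm.
by rewrite normcM normc_real (ger0_norm s0) ler_piMl ?normc_ge0.
Qed.

Lemma Re_pi_cexp (ze : R[i]) : `|complex.Im ze| < pi / 2 ->
  0 < complex.Re ((pi : R)%:C * cexp ze).
Proof.
move=> him; rewrite ReMC /cexp /= !mulr_gt0 ?pi_gt0 ?expR_gt0 //.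
by rewrite cos_gt0_pihalf //; move: him; rewrite ltr_norml; case/andP=> h1 h2; apply/andP; split; lra.
Qed.

Lemma pi_neq0 : (pi : R)%:C != 0 :> R[i].
Proof. by rewrite -normc_eq0 normc_real normr_eq0 gt_eqF ?pi_gt0. Qed.

(** Shift and rotation together reduce every Gaussian to the standard one, whose Riemann sums are
    kept as an unknown factor at this stage. *)
Lemma Rl_gau_asymp (ze be : R[i]) : `|complex.Im ze| < pi / 2 ->
  exists2 K : R, 0 <= K & forall l, (0 < l)%N ->
    normc (Rl l (gau ((pi : R)%:C * cexp ze) be) -
      cexp (be ^+ 2 / (4 * ((pi : R)%:C * cexp ze)) - ze / 2) * Rl l (gau (pi : R)%:C 0)) <= K / l%:R.
Proof.
move=> him; set al := (pi : R)%:C * cexp ze.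
have [K1 K10 h1] := Rl_gau_shift be (Re_pi_cexp him); rewrite -/al in h1.
have [K2 K20 h2] := Rl_gau_rot him; rewrite -/al in h2.
set c := be ^+ 2 / (4 * al) in h1 *.
exists (normc (cexp c) * K1 + normc (cexp (c - ze / 2)) * K2); first by nneg.
move=> l l0; have {}h1 := h1 l l0; have {}h2 := h2 l l0.
rewrite (_ : _ - _ = cexp c * (cexp (- c) * Rl l (gau al be) - Rl l (gau al 0)) +
   cexp (c - ze / 2) * (cexp (ze / 2) * Rl l (gau al 0) - Rl l (gau (pi : R)%:C 0))); last first.
  have e1 : cexp c * cexp (- c) = 1 by rewrite -cexpD subrr cexp0.
  have e2 : cexp (c - ze / 2) * cexp (ze / 2) = cexp c by rewrite -cexpD subrK.
  by rewrite !mulrBr !mulrA e1 e2; ring.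
apply: le_trans (normcD _ _) _; rewrite !normcM mulrDl -!mulrA.
by apply: lerD; apply: ler_wpM2l => //; nneg.
Qed.

(** The [h ^ 2] term of the exponent is kept explicit, so that in a symmetric second difference the
    terms odd in [h] cancel and an error of order [h ^ 2] remains. *)
Lemma gau_increment al be : 0 < complex.Re al ->
  exists2 K : R, 0 <= K & forall x h : R, `|h| <= 1 ->
  normc (gau al be (x + h) - gau al be x -
    gau al be x * (h%:C * (be - 2 * al * x%:C) - al * (h ^+ 2)%:C)) <= K * h ^+ 2 / (1 + x ^+ 2).
Proof.
move=> a0; have [K K0 hK] := gau_bound 2 a0 (normc_ge0 be).
pose C := 3 * normc al + normc be.
exists (16 * C ^+ 2 * K); first by rewrite /C; nneg.
move=> x h h1; set y := 1 + x ^+ 2.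
pose u := - al * (x ^+ 2)%:C + be * x%:C.
pose u' := - al * ((x + h) ^+ 2)%:C + be * (x + h)%:C.
have tay := cexp_taylor2 u u'; rewrite -/(gau al be x) -/(gau al be (x + h)) in tay.
have vE : u' - u = h%:C * (be - 2 * al * x%:C) - al * (h ^+ 2)%:C.
  by rewrite /u /u' !rmorphXn /= !rmorphD /=; ring.
rewrite vE in tay; apply: le_trans tay _.
set v := h%:C * _ - _.
have y1 : 1 <= y by rewrite /y lerDl sqr_ge0.
have y0 : 0 < y by rewrite (lt_le_trans _ y1).
have hh : h ^+ 2 <= `|h|.
  by rewrite -real_normK ?num_real // expr2 ler_piMr.
have vle : normc v <= `|h| * (C * y).
  apply: le_trans (normcB _ _) _; rewrite !normcM !normc_real (ger0_norm (sqr_ge0 _)).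
  have e1 : normc (be - 2 * al * x%:C) <= normc be + 2 * normc al * `|x|.
    by apply: le_trans (normcB _ _) _; rewrite !normcM normc_nat normc_real.
  have e2 : normc al * h ^+ 2 <= normc al * `|h| by rewrite ler_wpM2l ?normc_ge0.
  have e3 : `|h| * normc (be - 2 * al * x%:C) <= `|h| * (normc be + 2 * normc al * `|x|).
    by rewrite ler_wpM2l.
  have e4 : normc be + 2 * normc al * `|x| + normc al <= C * y.
    have e5 : `|x| <= y by exact: normx_le.
    have n0 := normc_ge0 al; have n1 := normc_ge0 be.
    have : normc al * `|x| <= normc al * y by rewrite ler_wpM2l.
    have : normc be <= normc be * y by rewrite ler_peMr.
    have : normc al <= normc al * y by rewrite ler_peMr.
    by rewrite /C; lra.
  have : `|h| * (normc be + 2 * normc al * `|x| + normc al) <= `|h| * (C * y) by rewrite ler_wpM2l.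
  lra.
pose cst := 8 * (C ^+ 2 * h ^+ 2).
have C0 : 0 <= C by rewrite /C; nneg.
have V2 : 8 * normc v ^+ 2 <= cst * y ^+ 2.
  rewrite /cst -mulrA; apply: ler_wpM2l => //.
  rewrite -[h ^+ 2]real_normK ?num_real // -!exprMn.
  apply: lerXn2r; rewrite ?nnegrE; [nneg|nneg|].
  by apply: le_trans vle _; rewrite mulrA [X in X * y]mulrC.
have B (t : R) : `|t - x| <= 1 -> 8 * normc v ^+ 2 * normc (gau al be t) <= cst * K / y.
  move=> ht; have := hK al be x t ((8 * normc v ^+ 2)%:C) cst (lexx _) (lexx _) ht.
  have c4 : 0 <= 8 * normc v ^+ 2 by nneg.
  by rewrite normcM normc_real (ger0_norm c4); apply.
rewrite mulrDr; apply: le_trans (lerD (B x _) (B (x + h) _)) _.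
- by rewrite subrr normr0.
- by rewrite addrAC subrr add0r.
by rewrite le_eqVlt; apply/orP; left; apply/eqP; rewrite /cst; ring.
Qed.

Lemma Rl_shiftN (l : nat) (F : R -> R[i]) K : (0 < l)%N -> adm F K ->
  hsum (fun n : int => (l%:R)^-1 * F (n%:~R / l%:R - (l%:R)^-1)) (Rl l F).
Proof.
move=> l0 hF; have := usumP (Rl_asum l0 hF).
pose h (n : int) := n - 1.
have ih : injective h by move=> n n' /addIr.
rewrite -(hsum_reindex (h := h)) //; last by move=> n _; exists (n + 1); rewrite /h addrK.
by apply: eq_hsum => n; rewrite /h intrB mulrBl mul1r.
Qed.

(** A discrete double integration by parts. A second difference multiplies the sum by
    [- 4 sin (pi r / l) ^ 2], while the second difference of the Gaussian is of order [1 / l ^ 2].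
    Since [|r| <= l / 2], the sine is comparable to [r / l], so the bound is uniform in [l]. *)
Lemma gau_fourier_decay al be : 0 < complex.Re al ->
  exists2 K : R, 0 <= K & forall (l : nat) (r : int), (0 < l)%N -> (2 * `|r| <= l)%N ->
    normc (Rl l (gau al (be - 2 * ipi R * r%:~R))) <= K / (1 + r%:~R ^+ 2).
Proof.
move=> a0; have [K K0 hK] := gau_increment be a0.
have [K' K'0 hK'] := gau_bound 0 a0 (normc_ge0 be).
have pp := pi_gt0 R.
have gE (r : int) (x : R) : gau al (be - 2 * ipi R * r%:~R) x =
    gau al be x * cexp (- (2 * ipi R * r%:~R * x%:C)).
  by rewrite /gau -cexpD; congr cexp; ring.
have nE (r : int) (x : R) : normc (cexp (- (2 * ipi R * r%:~R * x%:C))) = 1.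
  rewrite normc_cexp ReN !ReM !ImM intC /= (_ : - _ = 0) ?expR0 //; ring.
have ad (r : int) : adm (gau al (be - 2 * ipi R * r%:~R)) K'.
  move=> x; rewrite gE normcM nE mulr1.
  have := hK' al be x x 1 1; rewrite !mul1r subrr normr0 !lexx normc1 expr0 lexx.
  by apply.
pose K2 := 2 * (normc al * K' + K).
have K20 : 0 <= K2 by rewrite /K2; nneg.
exists (24 * K' + 24 * K2); first by nneg.
move=> l r l0 rl; set T := Rl l _.
have lp : 0 < (l%:R : R) by rewrite ltr0n.
set h : R := (l%:R)^-1; have hp : 0 < h by rewrite invr_gt0.
have h1 : h <= 1 by rewrite invf_le1 ?ler1n.
pose th : R := r%:~R / l%:R.
pose om := cexp (- (2 * ipi R * th%:C)).
have hc : (l%:R)^-1 = h%:C by rewrite fmorphV /= -natC.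
have rl' : r%:~R * h%:C = th%:C by rewrite intC -rmorphM.
have e1 := Rl_shift l0 (ad r); have e2 := Rl_shiftN l0 (ad r).
have e3 := usumP (Rl_asum l0 (ad r)); rewrite -/T -/h in e1 e2 e3.
(* The factors [om^-1] and [om] undo the phase acquired by a translation of one step, so the three
   sums combine into a second difference of the unmodulated Gaussian. *)
have S := hsumD (hsumZ om^-1 e1) (hsumD (hsumZ om e2) (hsumZ (-2) e3)).
have : normc (om^-1 * T + (om * T + -2 * T)) <= 24 * (K2 * h ^+ 2).
  apply: hsum_normc_le S _.
  pose G (x : R) := (gau al be (x + h) + gau al be (x - h) - 2 * gau al be x) * cexp (- (2 * ipi R * r%:~R * x%:C)).
  have adG : adm G (K2 * h ^+ 2).
    move=> x; rewrite /G normcM nE mulr1.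
    have i1 := hK x h; have i2 := hK x (- h).
    rewrite normrN (ger0_norm (ltW hp)) in i1 i2; move: (i1 h1) (i2 h1).
    rewrite !sqrrN => {}i1 {}i2.
    pose A1 := gau al be (x + h) - gau al be x - gau al be x * (h%:C * (be - 2 * al * x%:C) - al * (h ^+ 2)%:C).
    pose A2 := gau al be (x - h) - gau al be x - gau al be x * ((- h)%:C * (be - 2 * al * x%:C) - al * (h ^+ 2)%:C).
    rewrite (_ : _ - _ = A1 + A2 + (- (2 * al * (h ^+ 2)%:C)) * gau al be x); last first.
      by rewrite /A1 /A2 rmorphN /=; ring.
    apply: le_trans (normcD _ _) _.
    have i3 : normc (- (2 * al * (h ^+ 2)%:C) * gau al be x) <= 2 * normc al * h ^+ 2 * K' / (1 + x ^+ 2).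
      apply: hK'; rewrite ?lexx ?subrr ?normr0 // expr0 mulr1.
      by rewrite normcN !normcM normc_nat normc_real (ger0_norm (sqr_ge0 _)).
    have i4 := normcD A1 A2.
    apply: le_trans (lerD i4 i3) _.
    apply: le_trans (lerD (lerD i1 i2) (lexx _)) _.
    by rewrite le_eqVlt; apply/orP; left; apply/eqP; rewrite /K2; field; rewrite gt_eqF ?sqr1_gt0.
  apply: sbound_le (Rl_sbound l0 adG) => n.
  rewrite le_eqVlt; apply/orP; left; apply/eqP; congr normc.
  rewrite /G !gE !rmorphD !rmorphN /= /om.
  set x := (n%:~R / l%:R : R).
  have om0 : cexp (- (2 * ipi R * th%:C)) != 0 := cexp_neq0 _.
  have -> : cexp (- (2 * ipi R * r%:~R * (x%:C + h%:C))) =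
     cexp (- (2 * ipi R * r%:~R * x%:C)) * cexp (- (2 * ipi R * th%:C)).
    by rewrite -cexpD -rl'; congr cexp; ring.
  have -> : cexp (- (2 * ipi R * r%:~R * (x%:C - h%:C))) =
     cexp (- (2 * ipi R * r%:~R * x%:C)) / cexp (- (2 * ipi R * th%:C)).
    by rewrite -cexpB -rl'; congr cexp; ring.
  by field; rewrite om0 pnatr_eq0 -lt0n l0.
have -> : om^-1 * T + (om * T + -2 * T) = (om^-1 + om - 2) * T by ring.
have omE : normc (om^-1 + om - 2) = 4 * sin (pi * th) ^+ 2.
  have re0 : complex.Re (2 * ipi R * th%:C) = 0 by rewrite !ReM /=; ring.
  have im0 : complex.Im (2 * ipi R * th%:C) = pi * th + pi * th by rewrite !ImM !ReM /=; ring.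
  have -> : om^-1 + om - 2 = (2 * cos (pi * th + pi * th) - 2)%:C.
    rewrite /om -cexpN opprK /cexp ReN ImN re0 im0 oppr0 expR0 cosN sinN !mul1r.
    apply/eqP; rewrite eq_complex /=; apply/andP; split; apply/eqP; ring.
  have c2 := cos2Dsin2 (pi * th).
  rewrite normc_real cosD distrC ger0_norm; have := sqr_ge0 (sin (pi * th)); nra.
have thb : `|pi * th| <= pi / 2.
  rewrite normrM (ger0_norm (ltW pp)) ler_pM2l // /th normrM normfV (ger0_norm (ltW lp)).
  rewrite ler_pdivrMr // mulrC ler_pdivlMr //.
  rewrite -intr_norm (_ : 2 = 2%:~R) // -intrM [l%:R]pmulrn ler_int; lia.
have sn : th ^+ 2 <= 4 * sin (pi * th) ^+ 2.
  have t0 : 0 <= `|pi * th| <= pi / 2 by rewrite normr_ge0.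
  have := sin_ge_half t0.
  have -> : sin (pi * th) ^+ 2 = sin `|pi * th| ^+ 2.
    case: (ger0P (pi * th)) => // _; by rewrite sinN sqrrN.
  move=> hs.
  have : (`|pi * th| / 2) ^+ 2 <= sin `|pi * th| ^+ 2.
    by apply: lerXn2r => //; rewrite nnegrE; [rewrite divr_ge0|apply: le_trans hs; rewrite divr_ge0].
  have -> : (`|pi * th| / 2) ^+ 2 = (pi * th) ^+ 2 / 4.
    by rewrite exprMn real_normK ?num_real // exprVn; congr (_ / _); ring.
  have p1 : 1 <= (pi : R) ^+ 2.
    have p2 : 2 <= (pi : R) by exact: pi_ge2.
    by rewrite expr2; nra.
  rewrite exprMn; have := sqr_ge0 th; nra.
rewrite normcM omE => main.
have r1 : r%:~R ^+ 2 * normc T <= 24 * K2.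
  have : th ^+ 2 * normc T <= 24 * (K2 * h ^+ 2).
    by apply: le_trans main; rewrite ler_wpM2r ?normc_ge0.
  have -> : th ^+ 2 = r%:~R ^+ 2 * h ^+ 2 by rewrite /th exprMn.
  rewrite mulrAC mulrA ler_pM2r // exprn_gt0 //.
have r2 := Rl_le l0 (ad r); rewrite -/T in r2.
rewrite ler_pdivlMr ?sqr1_gt0 //; nra.
Qed.

End GaussianRiemann.

(** * Poisson summation for Gaussians *)

Section Theta1.
Variable R : realType.
Implicit Types al be ze : R[i].

Lemma hsum_fin (K : finType) (f : K -> R[i]) : hsum f (\sum_k f k).
Proof.
move=> e e0; exists [fset x in enum K]%fset => J sub.
rewrite (perm_big (index_enum K)) ?subrr ?normc0 //.
apply: uniq_perm; rewrite ?fset_uniq ?index_enum_uniq // => k.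
rewrite mem_index_enum; apply: (fsubsetP sub).
by rewrite in_fset mem_enum.
Qed.

Lemma hsum_real_ge (I : choiceType) (g : I -> R) (s : R[i]) i :
  (forall i, 0 <= g i) -> hsum (fun i => (g i)%:C) s -> g i <= normc s.
Proof.
move=> g0 hs; apply/ler_addgt0Pr => e e0; have [J hJ] := hs e e0.
have := hJ (i |` J)%fset (fsubsetU1 _ _); rewrite -rmorph_sum => h.
have le : g i <= \sum_(j <- (i |` J)%fset) g j.
  rewrite -[g i](big_seq1 +%R i g); apply: ler_sum_subseq => // j.
  by rewrite inE => /eqP ->; rewrite fset1U1.
have h2 : normc (\sum_(j <- (i |` J)%fset) g j)%:C <= normc s + e.
  rewrite -[X in normc X](subrK s) addrC; apply: le_trans (normcD _ _) _.
  by rewrite lerD2l ltW.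
by apply: le_trans le _; apply: le_trans h2; rewrite normc_real ler_norm.
Qed.

Lemma adm_int_asum (F : R -> R[i]) K : adm F K ->
  asum (fun n : int => F n%:~R).
Proof.
move=> h; have [M b] := Rl_asum (l := 1) isT h; exists M.
by apply: sbound_le b => n; rewrite invr1 divr1 mul1r.
Qed.

Lemma gau_int_asum al be : 0 < complex.Re al -> asum (fun n : int => gau al be n%:~R).
Proof.
move=> a0; have [K ad] := gau_adm_poly be 1 0 0 a0.
apply: eq_asum (adm_int_asum ad) => n.
by rewrite !mul0r !addr0 mul1r.
Qed.

(** The frequencies run over a full period of length [2 (j + 1)]; only sample points
    [n / (2 (j + 1))] that are integers survive, and each survives with total weight 1. *)
Lemma poisson_window al be (j : nat) : 0 < complex.Re al ->
  hsum (fun r : int => if (- (j.+1)%:Z <= r) && (r < (j.+1)%:Z)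
     then Rl (2 * j.+1) (gau al (be - 2 * ipi R * r%:~R)) else 0)
    (usum (fun n : int => gau al be n%:~R)).
Proof.
move=> a0; set l' := j.+1; set l := (2 * l')%N.
have l0 : (0 < l)%N by [].
have ln0 : (l%:R : R[i]) != 0 by rewrite pnatr_eq0.
pose h (i : 'I_l) : int := (i : nat)%:Z - l'%:Z.
have ih : injective h by move=> i i' /addIr [] /val_inj.
rewrite -(hsum_reindex (h := h)) //; last first.
  move=> r; case: ifP => [/andP[r1 r2] _|]; last by rewrite eqxx.
  have rl : (absz (GRing.add (r : int) l'%:Z) < l)%N by rewrite /l; lia.
  exists (Ordinal rl); rewrite /h /=; lia.
have -> : (fun i : 'I_l => if (- l'%:Z <= h i) && (h i < l'%:Z)
    then Rl l (gau al (be - 2 * ipi R * (h i)%:~R)) else 0) =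
    (fun i : 'I_l => Rl l (gau al (be - 2 * ipi R * (h i)%:~R))).
  apply/funext => i; rewrite ifT //; have := ltn_ord i; rewrite /h /l.
  by move=> il; apply/andP; split; lia.
suff -> : usum (fun n : int => gau al be n%:~R) =
    \sum_(i < l) Rl l (gau al (be - 2 * ipi R * (h i)%:~R)) by exact: hsum_fin.
have ad (i : 'I_l) : exists K, adm (gau al (be - 2 * ipi R * (h i)%:~R)) K.
  have [K hK] := gau_adm_poly (be - 2 * ipi R * (h i)%:~R) 1 0 0 a0.
  by exists K => x; have := hK x; rewrite !mul0r !addr0 mul1r.
have hs : hsum (fun n : int => \sum_(i < l) (l%:R)^-1 *
    gau al (be - 2 * ipi R * (h i)%:~R) (n%:~R / l%:R))
    (\sum_(i < l) Rl l (gau al (be - 2 * ipi R * (h i)%:~R))).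
  by apply: hsum_bigsum => i; have [K hK] := ad i; apply: usumP; apply: Rl_asum hK.
apply: usum_eq.
pose m (k : int) := k * l%:Z.
have im : injective m by apply: mulIf; rewrite eqz_nat -lt0n.
move: hs; rewrite -(hsum_reindex (h := m)) //.
  apply: eq_hsum => k.
  have kE : (m k)%:~R / l%:R = k%:~R :> R.
    by rewrite /m intrM -pmulrn mulfK // pnatr_eq0.
  rewrite kE.
  have -> : \sum_(i < l) (l%:R)^-1 * gau al (be - 2 * ipi R * (h i)%:~R) k%:~R =
     \sum_(i < l) (l%:R)^-1 * gau al be k%:~R.
    apply: eq_bigr => i _; congr (_ * _); rewrite /gau.
    rewrite (_ : - al * (k%:~R ^+ 2)%:C + (be - 2 * ipi R * (h i)%:~R) * k%:~R%:C =
      - al * (k%:~R ^+ 2)%:C + be * k%:~R%:C + 2 * ipi R * (- (h i * k))%:~R) ?cexpDint //.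
    by rewrite mulrNz intrM (intC _ k); ring.
  by rewrite sumr_const card_ord -[LHS]mulr_natl mulrA mulfV // mul1r.
move=> n; apply: contraNP => hn.
have dv : ~~ (l%:Z %| - n)%Z.
  apply/negP; rewrite rpredN => /dvdzP[q qE]; apply: hn; exists q; rewrite qE //.
have := root_sum R l'%:Z (- n) l0; rewrite (negbTE dv) => rs.
apply/eqP.
rewrite (eq_bigr (fun i : 'I_l => (l%:R)^-1 * gau al be (n%:~R / l%:R) *
   cexp (2 * ipi R * (((i : nat)%:Z - l'%:Z)%:~R * (- n)%:~R / l%:R)))).
  by rewrite -mulr_sumr rs mulr0.
move=> i _; rewrite /gau -[RHS]mulrA -cexpD; congr (_ * cexp _).
have -> : (n%:~R / l%:R : R)%:C = n%:~R / l%:R :> R[i].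
  by rewrite rmorphM /= fmorphV /= -intC -natC.
rewrite /h [(- n)%:~R]mulrNz; field; exact: ln0.
Qed.

Lemma window_mem (j : nat) (r : int) : (`|r|%N <= j)%N ->
  (- (j.+1)%:Z <= r) && (r < (j.+1)%:Z).
Proof. by move=> h; apply/andP; split; lia. Qed.

Lemma window_abs (j : nat) (r : int) : - (j.+1)%:Z <= r -> r < (j.+1)%:Z ->
  (2 * `|r| <= 2 * j.+1)%N.
Proof. lia. Qed.

Lemma leq_ltn_double (a j : nat) : (a <= j)%N -> (a < 2 * j.+1)%N.
Proof. lia. Qed.

(** The limit of [poisson_window] expresses the Gaussian sum as the limit of [rho j] times its dual
    sum. For the self-dual Gaussian both sums are the same [H0] with [|H0| >= 1], which forces
    [rho j] to tend to 1. *)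
Lemma poisson_gau ze be : `|complex.Im ze| < pi / 2 ->
  let al := (pi : R)%:C * cexp ze in
  let V := fun r : int => cexp ((be - 2 * ipi R * r%:~R) ^+ 2 / (4 * al) - ze / 2) in
  asum V /\ hsum V (usum (fun n : int => gau al be n%:~R)).
Proof.
move=> him.
(* The dual family is again Gaussian, with [ze'] replaced by [- ze']; its summability follows from
   that of the primal one. *)
have VE (ze' be' : R[i]) (r : int) :
    cexp ((be' - 2 * ipi R * r%:~R) ^+ 2 / (4 * ((pi : R)%:C * cexp ze')) - ze' / 2) =
    cexp (be' ^+ 2 / (4 * ((pi : R)%:C * cexp ze')) - ze' / 2) *
    gau ((pi : R)%:C * cexp (- ze')) (- ('i * be' / cexp ze')) r%:~R.
  rewrite /gau -cexpD; congr cexp; rewrite cexpN ipiE rmorphXn /= -intC.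
  move: (pi_neq0 R) r%:~R; move: (pi : R)%:C => P P0 rr.
  have -> : (be' - 2 * ('i * P) * rr) ^+ 2 =
    be' ^+ 2 - 4 * ('i * P * be' * rr) + 4 * ('i ^+ 2 * P ^+ 2 * rr ^+ 2) by ring.
  by rewrite sqr_i; field; rewrite cexp_neq0 P0.
have aV (ze' be' : R[i]) : `|complex.Im ze'| < pi / 2 ->
   asum (fun r : int => cexp ((be' - 2 * ipi R * r%:~R) ^+ 2 / (4 * ((pi : R)%:C * cexp ze')) - ze' / 2)).
  move=> h; have h' : `|complex.Im (- ze')| < pi / 2 by rewrite ImN normrN.
  have [M b] := gau_int_asum (- ('i * be' / cexp ze')) (Re_pi_cexp h').
  eexists; apply: sbound_le (sboundZ (normc_ge0 (cexp (be' ^+ 2 / (4 * ((pi : R)%:C * cexp ze')) - ze' / 2))) b).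
  by move=> r; rewrite VE normcM.
pose rho j := Rl (2 * j.+1) (gau (pi : R)%:C 0) : R[i].
have pi0 : 0 < complex.Re ((pi : R)%:C) by rewrite /= pi_gt0.
have [Kr hKr] : exists K, forall j, normc (rho j) <= K.
  have [K hK] := gau_adm_poly 0 1 0 0 pi0; exists (24 * K) => j.
  apply: Rl_le => // x; have := hK x; rewrite !mul0r !addr0 mul1r //.
(* The convergence of [rho] is not known yet, so dominated convergence is applied to the difference
   of the two families, whose termwise limit is 0. *)
have main (ze' be' v : R[i]) : `|complex.Im ze'| < pi / 2 ->
   hsum (fun r : int => cexp ((be' - 2 * ipi R * r%:~R) ^+ 2 / (4 * ((pi : R)%:C * cexp ze')) - ze' / 2)) v ->
   forall e : R, 0 < e -> exists L, forall j, (L <= j)%N ->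
   normc (usum (fun n : int => gau ((pi : R)%:C * cexp ze') be' n%:~R) - rho j * v) < e.
  move=> h hv; set al := (pi : R)%:C * cexp ze'.
  have are : 0 < complex.Re al := Re_pi_cexp h.
  set V := fun r : int => _ in hv.
  have [K K0 hK] := gau_fourier_decay be' are.
  have [M bM] := aV ze' be' h.
  pose W j (r : int) := if (- (j.+1)%:Z <= r) && (r < (j.+1)%:Z)
     then Rl (2 * j.+1) (gau al (be' - 2 * ipi R * r%:~R)) else 0.
  have Kr0 : 0 <= Kr by apply: le_trans (hKr 0%N); exact: normc_ge0.
  move=> e e0.
  have := @tannery R int (fun j r => W j r - rho j * V r) (fun=> 0)
    (fun j => usum (fun n : int => gau al be' n%:~R) - rho j * v)
    (fun r => K * (1 + r%:~R ^+ 2)^-1 + Kr * normc (V r)) (K * 8 + Kr * M) 0.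
  move=> /(_ _ _ _ _ _ e e0); rewrite [X in _ -> _ -> _ -> _ -> _ -> X](_ : _ =
    exists L, forall j, (L <= j)%N -> normc (usum (fun n : int => gau al be' n%:~R) - rho j * v) < e); last first.
    by apply/propext; split=> -[L hL]; exists L => j /hL; rewrite subr0.
  apply.
  - by move=> j; apply: hsumB; [exact: poisson_window|exact: hsumZ].
  - move=> j r; apply: le_trans (normcB _ _) _; apply: lerD.
      rewrite /W; case: ifP => [/andP[r1 r2]|_]; last first.
        by rewrite normc0 mulr_ge0 // invr_ge0 ltW ?sqr1_gt0.
      by apply: hK => //; exact: window_abs.
    by rewrite normcM ler_wpM2r ?normc_ge0.
  - apply: sboundD; apply: sboundZ => //; exact: inv1sq_int.
  - move=> r d d0.
    have [K2 K20 hK2] := Rl_gau_asymp (be' - 2 * ipi R * r%:~R) h.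
    exists (maxn `|r|%N (Num.bound (K2 / d))) => j; rewrite geq_max => /andP[j1 j2].
    rewrite subr0 /W (window_mem j1).
    rewrite [rho j * _]mulrC; apply: le_lt_trans (hK2 _ _) _ => //.
    have lp : 0 < ((2 * j.+1)%N%:R : R) by rewrite ltr0n.
    rewrite ltr_pdivrMr // mulrC -ltr_pdivrMr //.
    have K' : 0 <= K2 / d by rewrite divr_ge0 // ltW.
    by apply: lt_trans (archi_boundP K') _; rewrite ltr_nat leq_ltn_double.
  - exact: hsum0.
have h00 : `|complex.Im (0 : R[i])| < pi / 2 by rewrite /= normr0 divr_gt0 ?pi_gt0.
pose H0 := usum (fun n : int => gau (pi : R)%:C 0 n%:~R) : R[i].
have hH0 : hsum (fun n : int => gau (pi : R)%:C 0 n%:~R) H0 by apply: usumP; apply: gau_int_asum.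
have gr (x : R) : gau (pi : R)%:C 0 x = (expR (- (pi * x ^+ 2)))%:C.
  by rewrite /gau mul0r addr0 -rmorphN -rmorphM cexp_real mulNr.
have H1 : 1 <= normc H0.
  have := @hsum_real_ge int (fun n : int => expR (- (pi * n%:~R ^+ 2))) H0 0.
  rewrite expr0n mulr0 oppr0 expR0; apply; first by move=> n; exact: expR_ge0.
  by apply: eq_hsum hH0 => n; rewrite gr.
(* The case [ze = 0], [be = 0]: the difference is [(1 - rho j) * H0], and [|H0| >= 1]. *)
have rho1 (e : R) : 0 < e -> exists L, forall j, (L <= j)%N -> normc (1 - rho j) < e.
  move=> e0.
  have hv : hsum (fun r : int => cexp ((0 - 2 * ipi R * r%:~R) ^+ 2 / (4 * ((pi : R)%:C * cexp 0)) - 0 / 2)) H0.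
    apply: eq_hsum hH0 => r; rewrite /gau cexp0; congr cexp.
    rewrite ipiE rmorphXn /= -intC; move: (pi_neq0 R) r%:~R; move: (pi : R)%:C => P P0 rr.
    have -> : (0 - 2 * ('i * P) * rr) ^+ 2 = 4 * ('i ^+ 2 * P ^+ 2 * rr ^+ 2) by ring.
    by rewrite sqr_i; field.
  have [L hL] := main 0 0 H0 h00 hv e e0; exists L => j /hL.
  rewrite cexp0 mulr1 -/H0 -[X in X - _]mul1r -mulrBl normcM; apply: le_lt_trans.
  by rewrite ler_peMr ?normc_ge0.
move=> al V; have av : asum V by exact: aV.
split=> //; have [v hv] := asum_hsum av.
suff -> : usum (fun n : int => gau al be n%:~R) = v by [].
apply/eqP; rewrite -subr_eq0; apply/eqP; apply: normc_eps0 => e e0.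
have e20 : 0 < e / 2 by rewrite divr_gt0.
have [L1 h1] := main ze be v him hv _ e20.
have n0 : 0 < normc v + 1 by rewrite ltr_wpDl ?normc_ge0.
have [L2 h2] := rho1 (e / 2 / (normc v + 1)) (divr_gt0 e20 n0).
have := h1 (maxn L1 L2) (leq_maxl _ _); have := h2 (maxn L1 L2) (leq_maxr _ _).
set rr := rho _; set H := usum _; rewrite ltr_pdivlMr // => b1 b2.
rewrite (_ : H - v = (H - rr * v) - (1 - rr) * v); last by ring.
apply: le_lt_trans (normcB _ _) _; rewrite [e]splitr; apply: ltr_leD => //.
rewrite normcM; apply/ltW; apply: le_lt_trans b1.
by rewrite ler_wpM2l ?normc_ge0 // lerDl.
Qed.

Lemma sqrt_expR (a : R) : 0 < a -> Num.sqrt a = expR (ln a / 2).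
Proof.
move=> a0; have e : a = expR (ln a / 2) ^+ 2.
  by rewrite -expRM_natr divfK // lnK.
by rewrite {1}e sqrtr_sqr ger0_norm ?expR_ge0.
Qed.

(** The logarithm [ze] fixes the branch of the root of [t]. The positive factor [a] is kept apart
    because it will be the pivot of a Schur complement. *)
Lemma theta1 ze (z : R[i]) (a : R) : `|complex.Im ze| < pi / 2 -> 0 < a ->
  let t := cexp ze * a%:C in
  [/\ asum (fun n : int => cexp (- ((pi : R)%:C * t * (n%:~R + z) ^+ 2))),
      asum (fun r : int => cexp (- ((pi : R)%:C / t * r%:~R ^+ 2) + 2 * ipi R * r%:~R * z)) &
      usum (fun n : int => cexp (- ((pi : R)%:C * t * (n%:~R + z) ^+ 2))) =
      cexp (- (ze / 2)) / (Num.sqrt a)%:C *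
      usum (fun r : int => cexp (- ((pi : R)%:C / t * r%:~R ^+ 2) + 2 * ipi R * r%:~R * z))].
Proof.
move=> him a0 t; pose ze' := ze + (ln a)%:C.
have him' : `|complex.Im ze'| < pi / 2 by rewrite ImD /= addr0.
have tE : cexp ze' = t by rewrite cexpD cexp_real lnK.
have t0 : t != 0 by rewrite -tE cexp_neq0.
pose be := - (2 * (pi : R)%:C * t * z).
have [aV hV] := poisson_gau be him'; rewrite tE in aV hV.
set al := (pi : R)%:C * t in aV hV *.
have are : 0 < complex.Re al by rewrite /al -tE; exact: Re_pi_cexp.
have e1 (n : int) : cexp (- (al * (n%:~R + z) ^+ 2)) = cexp (- (al * z ^+ 2)) * gau al be n%:~R.
  by rewrite /gau -cexpD /be /al rmorphXn /= -intC; congr cexp; ring.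
pose c := cexp (al * z ^+ 2 - ze' / 2).
have e2 (r : int) : cexp ((be - 2 * ipi R * r%:~R) ^+ 2 / (4 * al) - ze' / 2) =
    c * cexp (- ((pi : R)%:C / t * r%:~R ^+ 2) + 2 * ipi R * r%:~R * z).
  rewrite -cexpD; congr cexp; rewrite /be /al ipiE.
  move: (pi_neq0 R) r%:~R; move: (pi : R)%:C => P P0 rr.
  have -> : (- (2 * P * t * z) - 2 * ('i * P) * rr) ^+ 2 =
    4 * (P * t * z) ^+ 2 + 8 * (P ^+ 2 * t * z * 'i * rr) + 4 * ('i ^+ 2 * P ^+ 2 * rr ^+ 2) by ring.
  by rewrite sqr_i; field; rewrite t0 P0.
have c0 : c != 0 := cexp_neq0 _.
have A1 : asum (fun n : int => cexp (- (al * (n%:~R + z) ^+ 2))).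
  have [M b] := gau_int_asum be are.
  eexists; apply: sbound_le (sboundZ (normc_ge0 (cexp (- (al * z ^+ 2)))) b) => n.
  by rewrite e1 normcM.
have A2 : asum (fun r : int => cexp (- ((pi : R)%:C / t * r%:~R ^+ 2) + 2 * ipi R * r%:~R * z)).
  have [M b] := aV.
  eexists; apply: sbound_le (sboundZ (normc_ge0 c^-1) b) => r.
  by rewrite e2 -[leRHS]normcM mulKf.
split=> //.
pose u2 := usum (fun r : int => cexp (- ((pi : R)%:C / t * r%:~R ^+ 2) + 2 * ipi R * r%:~R * z)).
rewrite -/u2.
apply: usum_eq.
have h2 : hsum (fun r : int => cexp ((be - 2 * ipi R * r%:~R) ^+ 2 / (4 * al) - ze' / 2)) (c * u2).
  by apply: eq_hsum (hsumZ c (usumP A2)) => r; rewrite e2.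
have e3 := hsum_uniq hV h2.
have := hsumZ (cexp (- (al * z ^+ 2))) (usumP (gau_int_asum be are)); rewrite e3.
have -> : cexp (- (al * z ^+ 2)) * (c * u2) = cexp (- (ze / 2)) / (Num.sqrt a)%:C * u2.
  rewrite mulrA; congr (_ * _); rewrite /c -cexpD (sqrt_expR a0) -cexp_real -cexpB; congr cexp.
  by rewrite /ze' rmorphM fmorphV /= -natC; field.
by apply: eq_hsum => n; rewrite e1.
Qed.

End Theta1.

(** * Theta transformation for positive definite forms *)

Section Bilinear.
Variable F : comNzRingType.
Variable N : nat.
Implicit Types (A : 'M[F]_N) (x y : 'cV[F]_N).

Definition dot x y : F := (x^T *m y) 0 0.
(** Unlike [bil], the matrix lives over the field, since Schur complements of an integral matrix are
    not integral. *)
Definition bl A x y : F := (x^T *m A *m y) 0 0.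

Lemma dotE x y : dot x y = \sum_i x i 0 * y i 0.
Proof. by rewrite /dot mxE; apply: eq_bigr => i _; rewrite mxE. Qed.

Lemma blE A x y : bl A x y = dot x (A *m y).
Proof. by rewrite /bl /dot mulmxA. Qed.

Lemma dotC x y : dot x y = dot y x.
Proof. by rewrite !dotE; apply: eq_bigr => i _; rewrite mulrC. Qed.

Lemma dotDl x x' y : dot (x + x') y = dot x y + dot x' y.
Proof. by rewrite /dot linearD /= mulmxDl mxE. Qed.
Lemma dotDr x y y' : dot x (y + y') = dot x y + dot x y'.
Proof. by rewrite /dot mulmxDr mxE. Qed.
Lemma dotZl c x y : dot (c *: x) y = c * dot x y.
Proof. by rewrite /dot linearZ /= -scalemxAl mxE. Qed.
Lemma dotZr c x y : dot x (c *: y) = c * dot x y.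
Proof. by rewrite /dot -scalemxAr mxE. Qed.
Lemma dotNl x y : dot (- x) y = - dot x y.
Proof. by rewrite -scaleN1r dotZl mulN1r. Qed.
Lemma dotNr x y : dot x (- y) = - dot x y.
Proof. by rewrite -scaleN1r dotZr mulN1r. Qed.
Lemma dot0l y : dot 0 y = 0.
Proof. by rewrite /dot trmx0 mul0mx mxE. Qed.

Lemma dot_mulmx A x y : dot x (A *m y) = dot (A^T *m x) y.
Proof. by rewrite /dot trmx_mul trmxK mulmxA. Qed.

Lemma blDl A x x' y : bl A (x + x') y = bl A x y + bl A x' y.
Proof. by rewrite !blE dotDl. Qed.
Lemma blDr A x y y' : bl A x (y + y') = bl A x y + bl A x y'.
Proof. by rewrite !blE mulmxDr dotDr. Qed.
Lemma blZl A c x y : bl A (c *: x) y = c * bl A x y.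
Proof. by rewrite !blE dotZl. Qed.
Lemma blZr A c x y : bl A x (c *: y) = c * bl A x y.
Proof. by rewrite !blE -scalemxAr dotZr. Qed.
Lemma blNl A x y : bl A (- x) y = - bl A x y.
Proof. by rewrite !blE dotNl. Qed.
Lemma blNr A x y : bl A x (- y) = - bl A x y.
Proof. by rewrite !blE mulmxN dotNr. Qed.
Lemma bl_sym A x y : A^T = A -> bl A x y = bl A y x.
Proof. by move=> sA; rewrite !blE dot_mulmx sA dotC. Qed.

Lemma bl_sqrD A x y : A^T = A ->
  bl A (x + y) (x + y) = bl A x x + 2 * bl A x y + bl A y y.
Proof. by move=> sA; rewrite !blDl !blDr (bl_sym y x sA); ring. Qed.

End Bilinear.

Section BilinearMap.
Variables (F F' : comNzRingType) (f : {rmorphism F -> F'}) (N : nat).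

Lemma dot_map (x y : 'cV[F]_N) : dot (map_mx f x) (map_mx f y) = f (dot x y).
Proof.
by rewrite !dotE rmorph_sum /=; apply: eq_bigr => i _; rewrite !mxE rmorphM.
Qed.

Lemma bl_map A (x y : 'cV[F]_N) : bl (map_mx f A) (map_mx f x) (map_mx f y) = f (bl A x y).
Proof. by rewrite !blE -map_mxM dot_map. Qed.

End BilinearMap.

(** * Schur complements *)

Section Schur.
Variables (F : fieldType) (N : nat).
Implicit Types (A : 'M[F]_N.+1).

Definition sA A : F := A 0 0.
Definition sb A : 'cV[F]_N := \col_i A (lift ord0 i) 0.
Definition schur A : 'M[F]_N :=
  (\matrix_(i, j) A (lift ord0 i) (lift ord0 j)) - (sA A)^-1 *: (sb A *m (sb A)^T).

Lemma dot_cons a b (x y : 'cV[F]_N) : dot (vcons a x) (vcons b y) = a * b + dot x y.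
Proof.
rewrite !dotE big_ord_recl !vcons0; congr (_ + _).
by apply: eq_bigr => i _; rewrite !vconsS.
Qed.

Lemma vconsD a b (x y : 'cV[F]_N) : vcons a x + vcons b y = vcons (a + b) (x + y).
Proof. by apply/matrixP => i j; rewrite !mxE; case: unliftP => [k _|_]; rewrite ?mxE. Qed.

Lemma mul_cons A a (x : 'cV[F]_N) : A^T = A -> A *m vcons a x =
  vcons (sA A * a + dot (sb A) x) (a *: sb A + schur A *m x + (dot (sb A) x / sA A) *: sb A).
Proof.
move=> sym.
have symE i j : A i j = A j i by rewrite -[in LHS]sym mxE.
apply/matrixP => i j; rewrite (ord1 j) mxE big_ord_recl vcons0.
case: (unliftP ord0 i) => [k ->|->].
  have sE : (schur A *m x) k 0 = \sum_m A (lift ord0 k) (lift ord0 m) * x m 0 -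
      dot (sb A) x / sA A * A (lift ord0 k) 0.
    rewrite mxE dotE !mulr_suml -sumrB; apply: eq_bigr => m _.
    by rewrite !mxE big_ord1 !mxE; ring.
  rewrite vconsS [RHS](_ : _ = a * A (lift ord0 k) 0 + (schur A *m x) k 0 +
      dot (sb A) x / sA A * A (lift ord0 k) 0); last by rewrite !mxE.
  rewrite sE addrA subrK mulrC; congr (_ + _).
  by apply: eq_bigr => m _; rewrite vconsS.
rewrite vcons0 dotE; congr (_ + _).
by apply: eq_bigr => m _; rewrite vconsS !mxE symE.
Qed.

Lemma bl_schur A a (x : 'cV[F]_N) : A^T = A -> sA A != 0 ->
  bl A (vcons a x) (vcons a x) =
  sA A * (a + dot (sb A) x / sA A) ^+ 2 + bl (schur A) x x.
Proof.
move=> sym a0; rewrite !blE mul_cons // dot_cons !dotDr !dotZr [dot x (sb A)]dotC.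
by field.
Qed.

Lemma schur_sym A : A^T = A -> (schur A)^T = schur A.
Proof.
move=> sym; rewrite /schur linearB /= linearZ /= trmx_mul trmxK; congr (_ - _).
by apply/matrixP => i j; rewrite !mxE -[in LHS]sym mxE.
Qed.

(** Multiplication by a unitriangular block matrix clears the first column below the pivot. *)
Lemma det_schur A : A^T = A -> sA A != 0 -> \det A = sA A * \det (schur A).
Proof.
move=> sym a0.
pose L : 'M[F]_(1 + N) := block_mx 1%:M 0 (- (sA A)^-1 *: sb A) 1%:M.
have dL : \det L = 1 by rewrite det_lblock !det1 mulr1.
have e : L *m (A : 'M[F]_(1 + N)) = block_mx (sA A)%:M (sb A)^T 0 (schur A).
  rewrite -[A in LHS](@submxK _ 1 N 1 N) mulmx_block !mul1mx !mul0mx !addr0.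
  have r1 : @rshift 1 N =1 lift (ord0 : 'I_N.+1) by move=> i; apply/val_inj.
  have u : ulsubmx (A : 'M[F]_(1 + N)) = (sA A)%:M.
    apply/matrixP => i j; rewrite !mxE !ord1 eqxx mulr1n /sA; congr (A _ _); exact/val_inj.
  have d : dlsubmx (A : 'M[F]_(1 + N)) = sb A.
    by apply/matrixP => i j; rewrite !mxE !ord1 r1; congr (A _ _); exact/val_inj.
  have ur : ursubmx (A : 'M[F]_(1 + N)) = (sb A)^T.
    apply/matrixP => i j; rewrite !mxE !ord1 r1 -[in LHS]sym mxE; congr (A _ _); exact/val_inj.
  rewrite u d ur; congr block_mx.
    by rewrite -scalemxAl mul_mx_scalar scalerA mulNr mulVf // scaleN1r addNr.
  rewrite addrC -scalemxAl scaleNr /schur; congr (_ - _).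
  by apply/matrixP => i j; rewrite !mxE !r1.
by have := congr1 (fun M => \det M) e; rewrite /= det_mulmx dL mul1r det_ublock det_scalar1 => <-.
Qed.

Definition qd n (A : 'M[F]_n) (h : 'cV[F]_n) := dot h (invmx A *m h).

Lemma qd_schur A a (h : 'cV[F]_N) : A^T = A -> sA A != 0 ->
  A \in unitmx -> schur A \in unitmx ->
  qd A (vcons a h) = a ^+ 2 / sA A + qd (schur A) (h - (a / sA A) *: sb A).
Proof.
move=> sym a0 uA uS.
(* Block elimination solves [A v = vcons a h]; the inverse form is then read off from [v]. *)
pose v' := invmx (schur A) *m (h - (a / sA A) *: sb A).
pose v := vcons ((a - dot (sb A) v') / sA A) v'.
have Av : A *m v = vcons a h.
  rewrite mul_cons //; congr vcons; first by field.
  rewrite /v' mulKVmx // -/v'; rewrite mulrBl scalerBl.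
  by rewrite addrAC subrK addrC subrK.
have -> : qd A (vcons a h) = dot (vcons a h) v by rewrite /qd -Av mulKmx.
rewrite dot_cons /qd -/v' dotDl dotNl dotZl; field.
exact: a0.
Qed.

Lemma qd_sqrB n (A : 'M[F]_n) (h b : 'cV[F]_n) (c : F) : A^T = A -> A \in unitmx ->
  qd A (h - c *: b) = qd A h - 2 * c * dot h (invmx A *m b) + c ^+ 2 * qd A b.
Proof.
move=> sym uA; have si : (invmx A)^T = invmx A by rewrite trmx_inv sym.
rewrite /qd mulmxBr -scalemxAr !dotDl !dotDr !dotNl !dotNr !dotZl !dotZr.
by rewrite [dot b (invmx A *m h)]dot_mulmx si [dot (_ *m b) h]dotC; ring.
Qed.

End Schur.

(** * Positive definite forms and Gaussian majorants *)

Section PosDef.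
Variable R : realType.

Definition posdef N (A : 'M[R]_N) := forall x : 'cV[R]_N, x != 0 -> 0 < bl A x x.

Lemma posdef_ge0 N (A : 'M[R]_N) x : posdef A -> 0 <= bl A x x.
Proof.
move=> pA; have [->|/pA/ltW//] := eqVneq x 0; by rewrite blE dot0l.
Qed.

Lemma posdef_unit N (A : 'M[R]_N) : posdef A -> A \in unitmx.
Proof.
move=> pA; rewrite unitmxE unitfE; apply/negP => /det0P[v v0 vA].
have := pA v^T; rewrite -trmx0 (inj_eq trmx_inj) => /(_ v0).
by rewrite /bl trmxK vA mul0mx mxE ltxx.
Qed.

Lemma posdef_CS N (A : 'M[R]_N) (x y : 'cV[R]_N) : A^T = A -> posdef A ->
  bl A x y ^+ 2 <= bl A x x * bl A y y.
Proof.
move=> sym pA; have [->|y0] := eqVneq y 0.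
  by rewrite !blE mulmx0 [dot x 0]dotC !dot0l expr0n mulr0.
have q0 := pA y y0; set q := bl A y y in q0 *; set p := bl A x y; set X := bl A x x.
have := posdef_ge0 (q *: x - p *: y) pA.
rewrite -scaleNr bl_sqrD // !blZl !blZr -/q -/p -/X => h.
have : 0 <= q * (q * X - p ^+ 2).
  by apply: le_trans h _; rewrite le_eqVlt; apply/orP; left; apply/eqP; ring.
by rewrite pmulr_rge0 // subr_ge0 mulrC.
Qed.

Lemma dot_delta N (x : 'cV[R]_N) i : dot x (delta_mx i 0) = x i 0.
Proof.
rewrite dotE (bigD1 i) //= big1 ?addr0; first by rewrite mxE !eqxx mulr1.
by move=> j ji; rewrite mxE (negbTE ji) mulr0.
Qed.

(** The coordinate [x i] is the product of [x] with [A^-1 e_i] for the form [A], so Cauchy-Schwarz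
    bounds it. This gives an explicit constant in place of a compactness or eigenvalue argument. *)
Lemma posdef_lower N (A : 'M[R]_N) : A^T = A -> posdef A ->
  exists2 e : R, 0 < e & forall x : 'cV[R]_N, e * \sum_i x i 0 ^+ 2 <= bl A x x.
Proof.
move=> sym pA; have uA := posdef_unit pA.
pose T := 1 + \sum_i bl A (invmx A *m delta_mx i 0) (invmx A *m delta_mx i 0).
have T0 : 0 < T by rewrite ltr_wpDr // sumr_ge0 // => i _; exact: posdef_ge0.
exists T^-1; first by rewrite invr_gt0.
move=> x; rewrite mulrC ler_pdivrMr // /T mulrDr mulr1 mulr_sumr.
apply: ler_wpDl; first exact: posdef_ge0.
apply: ler_sum => i _.
have := posdef_CS x (invmx A *m delta_mx i 0) sym pA.
by rewrite {1}blE mulKVmx // dot_delta.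
Qed.

(** The same argument in dual coordinates: [h i] is the product of [e_i] and [A^-1 h] for the form
    [A]. *)
Lemma qd_lower N (A : 'M[R]_N) : A^T = A -> posdef A ->
  exists2 e : R, 0 < e & forall h : 'cV[R]_N, e * \sum_i h i 0 ^+ 2 <= qd A h.
Proof.
move=> sym pA; have uA := posdef_unit pA.
pose T := 1 + \sum_i bl A (delta_mx i 0) (delta_mx i 0).
have T0 : 0 < T by rewrite ltr_wpDr // sumr_ge0 // => i _; exact: posdef_ge0.
exists T^-1; first by rewrite invr_gt0.
move=> h; pose v := invmx A *m h.
have qE : qd A h = bl A v v by rewrite /qd blE /v mulKVmx // dotC.
rewrite mulrC ler_pdivrMr // qE /T mulrDr mulr1 mulr_sumr.
apply: ler_wpDl; first exact: posdef_ge0.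
apply: ler_sum => i _.
have := posdef_CS (delta_mx i 0) v sym pA.
by rewrite {1}blE /v mulKVmx // dotC dot_delta mulrC.
Qed.

Lemma posdef_sA N (A : 'M[R]_N.+1) : posdef A -> 0 < sA A.
Proof.
move=> pA; have := pA (delta_mx 0 0); rewrite blE dotC dot_delta.
rewrite /sA mxE (bigD1 0) //= big1 => [|j j0]; last by rewrite mxE (negbTE j0) mulr0.
rewrite mxE !eqxx mulr1 addr0; apply; apply/negP => /eqP/matrixP/(_ 0 0).
by rewrite !mxE !eqxx => /eqP; rewrite oner_eq0.
Qed.

Lemma posdef_schur N (A : 'M[R]_N.+1) : A^T = A -> posdef A -> posdef (schur A).
Proof.
move=> sym pA x x0; have a0 := posdef_sA pA.
have := pA (vcons (- (dot (sb A) x / sA A)) x).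
rewrite bl_schur ?gt_eqF // addNr expr0n mulr0 add0r; apply.
apply: contraNneq x0 => /(congr1 (@vtl R N)); rewrite vtl_cons => ->.
by apply/eqP/matrixP => i j; rewrite !mxE.
Qed.

Lemma gaussN_asum N (f : 'cV[int]_N -> R[i]) (e b c : R) : 0 < e -> 0 <= b -> 0 <= c ->
  (forall x, normc (f x) <= c * expR (\sum_i (- (e * (x i 0)%:~R ^+ 2) + b * `|(x i 0)%:~R|))) ->
  asum f.
Proof.
move=> e0 b0 c0 h; have [K K0 hK] := gauss_poly_bound 1 e0 b0.
pose g (i : 'I_N) (n : int) := expR (- (e * n%:~R ^+ 2) + b * `|n%:~R|) : R.
have bg : sbound (fun x : 'cV[int]_N => \prod_i g i (x i 0)) ((K * 8) ^+ N).
  apply: sbound_vec => [i n|i]; first exact: expR_ge0.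
  apply: sbound_le (sboundZ K0 (inv1sq_int R)) => n.
  by rewrite /g ler_pdivlMr ?sqr1_gt0 // mulrC -[1 + _]expr1.
apply: asum_le (sboundZ c0 bg) => x.
by apply: le_trans (h x) _; rewrite expR_sum.
Qed.

Lemma gaussN_asum' N (q : 'cV[int]_N -> R) (e : R) (s c : R[i]) (b : 'cV[R[i]]_N) :
  0 < complex.Re s -> 0 < e ->
  (forall x : 'cV[int]_N, e * \sum_i (x i 0)%:~R ^+ 2 <= q x) ->
  asum (fun x : 'cV[int]_N => cexp (- (s * (q x)%:C) + dot (intv R[i] x) b + c)).
Proof.
move=> s0 e0 hq.
pose be := \sum_i normc (b i 0).
have be0 : 0 <= be by apply: sumr_ge0 => i _; exact: normc_ge0.
apply: (@gaussN_asum N _ (complex.Re s * e) be (expR (complex.Re c))) => //.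
  exact: mulr_gt0.
move=> x; rewrite normc_cexp -expRD ler_expR !ReD addrC lerD2l ReN ReM /= mulr0 subr0.
rewrite big_split /=; apply: lerD.
  by rewrite sumrN lerN2 -mulr_sumr -mulrA ler_wpM2l // ltW.
rewrite dotE; elim/big_rec2: _ => [//|i u v _ IH].
rewrite ReD; apply: lerD => //; rewrite mxE intC ReMC.
apply: le_trans (ler_norm _) _; rewrite normrM mulrC ler_wpM2r //.
apply: le_trans (normc_Re _) _; rewrite /be (bigD1 i) //= lerDl.
by apply: sumr_ge0 => k _; exact: normc_ge0.
Qed.

End PosDef.

(** * The theta transformation by induction on the dimension *)

Section ThetaN.
Variable R : realType.
Local Notation Cm := (map_mx (real_complex R)).

Definition theta_primal N (A : 'M[R]_N) (t : R[i]) (z : 'cV[R[i]]_N) (y : 'cV[int]_N) : R[i] :=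
  cexp (- ((pi : R)%:C * t * bl (Cm A) (intv R[i] y + z) (intv R[i] y + z))).

Definition theta_dual N (A : 'M[R]_N) (t : R[i]) (z : 'cV[R[i]]_N) (h : 'cV[int]_N) : R[i] :=
  cexp (- ((pi : R)%:C / t * (qd A (intv R h))%:C) + 2 * ipi R * dot (intv R[i] h) z).

Lemma intvC N (y : 'cV[int]_N) : intv R[i] y = Cm (intv R y).
Proof. by apply/matrixP => i j; rewrite !mxE intC. Qed.

Lemma intv_sqr N (y : 'cV[int]_N) : \sum_i (intv R y) i 0 ^+ 2 = \sum_i (y i 0)%:~R ^+ 2.
Proof. by apply: eq_bigr => i _; rewrite mxE. Qed.

Lemma theta_primal_asum N (A : 'M[R]_N) (t : R[i]) z : A^T = A -> posdef A ->
  0 < complex.Re t -> asum (theta_primal A t z).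
Proof.
move=> sym pA t0; have [e e0 he] := posdef_lower sym pA.
have s0 : 0 < complex.Re ((pi : R)%:C * t) by rewrite ReMC mulr_gt0 ?pi_gt0.
have symC : (Cm A)^T = Cm A by apply/matrixP => i j; rewrite !mxE -[in LHS]sym mxE.
have hx (x : 'cV[int]_N) : e * \sum_i (x i 0)%:~R ^+ 2 <= bl A (intv R x) (intv R x).
  by rewrite -intv_sqr.
apply: eq_asum (gaussN_asum' (- ((pi : R)%:C * t * bl (Cm A) z z))
  (- (2 * ((pi : R)%:C * t)) *: (Cm A *m z)) s0 e0 hx) => y; rewrite /theta_primal; congr cexp.
rewrite bl_sqrD // dotZr -blE -bl_map -intvC; ring.
Qed.

Lemma theta_dual_asum N (A : 'M[R]_N) (t : R[i]) z : A^T = A -> posdef A ->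
  0 < complex.Re (t^-1) -> asum (theta_dual A t z).
Proof.
move=> sym pA t0; have [e e0 he] := qd_lower sym pA.
have s0 : 0 < complex.Re ((pi : R)%:C / t) by rewrite ReMC mulr_gt0 ?pi_gt0.
have hx (x : 'cV[int]_N) : e * \sum_i (x i 0)%:~R ^+ 2 <= qd A (intv R x).
  by rewrite -intv_sqr.
apply: eq_asum (gaussN_asum' 0 ((2 * ipi R) *: z) s0 e0 hx) => y.
by rewrite /theta_dual addr0 dotZr.
Qed.

Lemma hsum_cV0 (f : 'cV[int]_0 -> R[i]) : hsum f (f 0).
Proof.
pose h (_ : unit) : 'cV[int]_0 := 0.
have ih : injective h by move=> [] [].
rewrite -(hsum_reindex (h := h)) //; last by move=> x _; exists tt; apply/matrixP => -[].
have := hsum_fin (fun u : unit => f (h u)).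
by rewrite (bigD1 tt) //= big1 ?addr0 // => -[].
Qed.

Lemma intv_cons (F : fieldType) N a (y : 'cV[int]_N) :
  intv F (vcons a y) = vcons (a%:~R) (intv F y).
Proof. by apply/matrixP => i j; rewrite !mxE; case: unliftP => [k _|_]; rewrite ?mxE. Qed.

Lemma Cm_sA N (A : 'M[R]_N.+1) : sA (Cm A) = (sA A)%:C.
Proof. by rewrite /sA mxE. Qed.

Lemma Cm_sb N (A : 'M[R]_N.+1) : sb (Cm A) = Cm (sb A).
Proof. by apply/matrixP => i j; rewrite !mxE. Qed.

Lemma Cm_schur N (A : 'M[R]_N.+1) : schur (Cm A) = Cm (schur A).
Proof.
apply/matrixP => i j; rewrite !mxE !big_ord1 !mxE Cm_sA -fmorphV.
by rewrite rmorphB rmorphM /= rmorphM.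
Qed.

(** The first coordinate is transformed by [theta1] with the pivot as scale. After exchanging the
    sums, each dual frequency [h0] leaves a theta series of the Schur complement at a shifted
    argument, to which the induction hypothesis applies. *)
Theorem thetaN N (A : 'M[R]_N) (ze : R[i]) (z : 'cV[R[i]]_N) :
  A^T = A -> posdef A -> `|complex.Im ze| < pi / 2 ->
  usum (theta_primal A (cexp ze) z) =
  cexp (- (N%:R * ze / 2)) / (Num.sqrt (\det A))%:C * usum (theta_dual A (cexp ze) z).
Proof.
move=> sym pA him.
set t := cexp ze; have t0 : t != 0 := cexp_neq0 _.
have pi0 := pi_gt0 R.
have ret : 0 < complex.Re t.
  have := Re_pi_cexp him; rewrite -/t ReMC pmulr_rgt0 //.
have ret' : 0 < complex.Re t^-1.
  have h' : `|complex.Im (- ze)| < pi / 2 by rewrite ImN normrN.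
  by have := Re_pi_cexp h'; rewrite cexpN -/t ReMC pmulr_rgt0.
elim: N A z sym pA => [|N IHN] A z sym pA.
  rewrite (usum_eq (hsum_cV0 _)) (usum_eq (hsum_cV0 _)) /theta_primal /theta_dual.
  rewrite det_mx00 sqrtr1 !mul0r oppr0 cexp0 divr1 mul1r.
  have d0 (F : comNzRingType) (x y : 'cV[F]_0) : dot x y = 0 by rewrite dotE big_ord0.
  by rewrite blE /qd !d0 !mulr0 oppr0 addr0.
pose a := sA A; pose b := sb A; pose S := schur A.
have a0 : 0 < a := posdef_sA pA.
have an0 : a != 0 by rewrite gt_eqF.
have ac0 : a%:C != 0 by rewrite -normc_eq0 normc_real normr_eq0.
have symS : S^T = S := schur_sym sym.
have pS : posdef S := posdef_schur sym pA.
have uS := posdef_unit pS; have uA := posdef_unit pA.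
have symC (n : nat) (B : 'M[R]_n) : B^T = B -> (Cm B)^T = Cm B.
  by move=> sB; apply/matrixP => i j; rewrite !mxE -[in LHS]sB mxE.
pose z0 := z 0 0; pose z' := vtl z.
have zE : z = vcons z0 z' by rewrite vcons_eta.
(* Minus the centre of the Gaussian in the first coordinate once the square is completed. *)
pose w (y' : 'cV[int]_N) := z0 + dot (Cm b) (intv R[i] y' + z') / a%:C.
have prim (y0 : int) (y' : 'cV[int]_N) : theta_primal A t z (vcons y0 y') =
   theta_primal S t z' y' * cexp (- ((pi : R)%:C * (t * a%:C) * (y0%:~R + w y') ^+ 2)).
  rewrite /theta_primal -cexpD; congr cexp.
  rewrite intv_cons {1 2}zE vconsD bl_schur ?symC ?Cm_sA // Cm_sb Cm_schur -/a -/b -/S.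
  by rewrite /w; ring.
have [B [BE bB]] : exists B : 'cV[R]_N, S *m B = b /\ dot b B = qd S b.
  by exists (invmx S *m b); rewrite mulKVmx.
pose ka (h0 : int) : R[i] := - ('i * h0%:~R / (t * a%:C)).
(* The transformed first coordinate leaves an exponent linear in [y']; completing the square for the
   Schur complement turns it into this complex shift along [B = S^-1 b]. *)
pose w' (h0 : int) : 'cV[R[i]]_N := ka h0 *: Cm B.
pose k (h0 : int) := cexp (- ((pi : R)%:C / (t * a%:C) * h0%:~R ^+ 2) +
   2 * ipi R * h0%:~R * z0 - (pi : R)%:C / t * (h0%:~R / a%:C) ^+ 2 * (qd S b)%:C).
pose G (p : 'cV[int]_N * int) := theta_primal S t z' p.1 *
   cexp (- ((pi : R)%:C / (t * a%:C) * p.2%:~R ^+ 2) + 2 * ipi R * p.2%:~R * w p.1).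
have GE (y' : 'cV[int]_N) (h0 : int) : G (y', h0) = k h0 * theta_primal S t (z' + w' h0) y'.
  rewrite /G /= /theta_primal /k -!cexpD; congr cexp.
  rewrite (addrA (intv R[i] y') z') [bl (Cm S) (_ + w' h0) _]bl_sqrD ?symC //.
  set x := intv R[i] y' + z'.
  have e1 : bl (Cm S) x (w' h0) = ka h0 * dot (Cm b) x.
    by rewrite /w' blZr blE -map_mxM BE [dot x _]dotC.
  have e2 : bl (Cm S) (w' h0) (w' h0) = ka h0 ^+ 2 * (qd S b)%:C.
    by rewrite /w' blZr blZl blE -map_mxM BE dot_map [dot B b]dotC bB; ring.
  rewrite e1 e2 /w -/x /ka ipiE.
  move: (pi : R)%:C (qd S b)%:C (bl (Cm S) x x) (dot (Cm b) x) h0%:~R => P q X d h.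
  have -> : (- ('i * h / (t * a%:C))) ^+ 2 = 'i ^+ 2 * (h / (t * a%:C)) ^+ 2 by ring.
  rewrite sqr_i; field.
  by rewrite t0 ac0.
have dual (h0 : int) (h' : 'cV[int]_N) :
   theta_dual A t z (vcons h0 h') = k h0 * theta_dual S t (z' + w' h0) h'.
  rewrite /theta_dual /k -!cexpD; congr cexp.
  rewrite !intv_cons qd_schur // -/a -/b -/S qd_sqrB // {1}zE dot_cons dotDr dotZr.
  have -> : invmx S *m b = B by rewrite -BE mulKmx.
  have -> : dot (intv R[i] h') (Cm B) = (dot (intv R h') B)%:C by rewrite intvC dot_map.
  rewrite /ka ipiE (intC R h0).
  move: (qd S b) (qd S _) (dot _ B) (dot _ z') (h0%:~R : R) => q X d e h.
  have -> : (h ^+ 2 / a + (X - 2 * (h / a) * d + (h / a) ^+ 2 * q))%:C =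
    h%:C ^+ 2 / a%:C + (X%:C - 2 * (h%:C / a%:C) * d%:C + (h%:C / a%:C) ^+ 2 * q%:C).
    by field.
  move: (pi : R)%:C q%:C X%:C d%:C h%:C => {q X d h} P q X d h.
  have -> : 2 * ('i * P) * (e + - ('i * h / (t * a%:C)) * d) =
    2 * ('i * P) * e - 2 * ('i ^+ 2 * P * h / (t * a%:C) * d) by ring.
  rewrite sqr_i; field.
  by rewrite t0 ac0.
pose c1 := cexp (- (ze / 2)) / (Num.sqrt a)%:C.
pose c2 := cexp (- (N%:R * ze / 2)) / (Num.sqrt (\det S))%:C.
have cc : cexp (- (N.+1%:R * ze / 2)) / (Num.sqrt (\det A))%:C = c1 * c2.
  rewrite (det_schur sym an0) -/S -/a (sqrtrM _ (ltW a0)) rmorphM /= invfM.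
  rewrite /c1 /c2 mulrACA -cexpD; congr (cexp _ * _).
  by rewrite -natr1; field.
have aP := theta_primal_asum z sym pA ret; have aD := theta_dual_asum z sym pA ret'.
have aPS (u : 'cV[R[i]]_N) := theta_primal_asum u symS pS ret.
have aDS (u : 'cV[R[i]]_N) := theta_dual_asum u symS pS ret'.
(* The dependence of [w y'] on [y'] is a real shift, which changes only the phase in the sum over
   [h0]; in modulus the family is a product. *)
have aG : asum G.
  have [M1 b1] := aPS z'.
  have [_ [M2 b2] _] := theta1 (z0 + dot (Cm b) z' / a%:C) him a0; rewrite -/t in b2.
  exists (M1 * M2); apply: sbound_le (sbound_prod _ _ b1 b2) => [[y' h0]|y'|h0]; try exact: normc_ge0.
  rewrite /G [leLHS]normcM -[(y', h0).1]/y' -[(y', h0).2]/h0.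
  apply: ler_wpM2l; first exact: normc_ge0.
  rewrite [leLHS]normc_cexp [leRHS]normc_cexp ler_expR [leLHS]ReD [leRHS]ReD lerD2l.
  have -> : w y' = z0 + dot (Cm b) z' / a%:C + (dot b (intv R y') / a)%:C.
    rewrite /w dotDr intvC dot_map rmorphM fmorphV /=; ring.
  have -> (r : R) : complex.Re (2 * ipi R * h0%:~R * (z0 + dot (Cm b) z' / a%:C + r%:C)) =
     complex.Re (2 * ipi R * h0%:~R * (z0 + dot (Cm b) z' / a%:C)).
    rewrite mulrDr ReD intC !ReM !ImM /=; ring.
  exact: lexx.
pose sw (p : 'cV[int]_N * int) : 'cV[int]_N.+1 := vcons p.2 p.1.
have isw : injective sw.
  by move=> [y1 n1] [y2 n2] /(@vcons_inj _ _ (n1, y1) (n2, y2)) [-> ->].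
have hP : hsum (fun p => theta_primal A t z (sw p)) (usum (theta_primal A t z)).
  apply/(hsum_reindex (h := sw)) => //; last exact: usumP.
  by move=> x _; exists (vtl x, x 0 0); rewrite /sw vcons_eta.
have hT : hsum (fun y' => theta_primal S t z' y' * (c1 * usum (fun h0 : int =>
    cexp (- ((pi : R)%:C / (t * a%:C) * h0%:~R ^+ 2) + 2 * ipi R * h0%:~R * w y'))))
    (usum (theta_primal A t z)).
  apply: (hsum_pair hP) => y'.
  have [q1 q2 q3] := theta1 (w y') him a0; rewrite -/t -/a in q1 q2 q3.
  have := hsumZ (theta_primal S t z' y') (usumP q1); rewrite q3.
  by apply: eq_hsum => y0; rewrite /sw /= prim.
have hG : hsum (fun y' => theta_primal S t z' y' * usum (fun h0 : int =>
    cexp (- ((pi : R)%:C / (t * a%:C) * h0%:~R ^+ 2) + 2 * ipi R * h0%:~R * w y')))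
    (c2 * usum (theta_dual A t z)).
  apply/(@hsum_swap _ _ _ (fun y' h0 => G (y', h0)) _
     (fun h0 => k h0 * (c2 * usum (theta_dual S t (z' + w' h0))))) => //.
  - move=> y'; have [_ q2 _] := theta1 (w y') him a0; rewrite -/t -/a in q2.
    by apply: eq_hsum (hsumZ (theta_primal S t z' y') (usumP q2)) => h0.
  - move=> h0; rewrite -IHN //.
    by apply: eq_hsum (hsumZ (k h0) (usumP (aPS (z' + w' h0)))) => y'; rewrite GE.
  pose vc (p : int * 'cV[int]_N) : 'cV[int]_N.+1 := vcons p.1 p.2.
  have hD : hsum (fun p => theta_dual A t z (vc p)) (usum (theta_dual A t z)).
    apply/(hsum_reindex (h := vc)) => //; last exact: usumP.
      exact: vcons_inj.
    by move=> x _; exists (x 0 0, vtl x); rewrite /vc vcons_eta.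
  have hD' : hsum (fun h0 => k h0 * usum (theta_dual S t (z' + w' h0))) (usum (theta_dual A t z)).
    apply: (hsum_pair hD) => h0.
    by apply: eq_hsum (hsumZ (k h0) (usumP (aDS (z' + w' h0)))) => h'; rewrite /vc /= dual.
  by apply: eq_hsum (hsumZ c2 hD') => h0; rewrite mulrCA.
rewrite cc -mulrA; apply: hsum_uniq hT _.
by apply: eq_hsum (hsumZ c1 hG) => y'; rewrite mulrCA.
Qed.

End ThetaN.

(** * The Lipschitz formula with a rational twist *)

Section Lipschitz.
Variable R : realType.

Lemma sbound_nat (g : nat -> R) M : (forall n, 0 <= g n) ->
  (forall n, \sum_(i < n) g i <= M) -> sbound g M.
Proof.
move=> g0 h s us; pose m := (\max_(i <- s) i).+1.
apply: le_trans (_ : \sum_(n <- iota 0 m) g n <= _).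
  apply: ler_sum_subseq => // i si.
  by rewrite mem_iota /= add0n ltnS; apply: (leq_bigmax_seq (F := id)).
by have := h m; rewrite -(big_mkord xpredT g) /index_iota subn0.
Qed.

(** Multiplication by [1 - x] lowers [i] by Pascal's rule, up to a boundary term with a favourable
    sign. *)
Lemma negbin_bound (x : R) (i : nat) : 0 <= x < 1 ->
  sbound (fun r : nat => ('C(r + i, i))%:R * x ^+ r) ((1 - x) ^- i.+1).
Proof.
move=> /andP[x0 x1]; have y0 : 0 < 1 - x by rewrite subr_gt0.
apply: sbound_nat => [r|n]; first by rewrite mulr_ge0 ?exprn_ge0.
elim: i n => [|i IHi] n.
  have e : (1 - x) * \sum_(r < n) ('C(r + 0, 0))%:R * x ^+ r = 1 - x ^+ n.
    rewrite -opprB mulNr -[RHS]opprB subrX1; congr (- (_ * _)).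
    by apply: eq_bigr => r _; rewrite bin0 mul1r.
  rewrite expr1 -[leRHS]mul1r ler_pdivlMr // mulrC e lerBlDr lerDl exprn_ge0 //.
have e : (1 - x) * \sum_(r < n) ('C(r + i.+1, i.+1))%:R * x ^+ r =
   \sum_(r < n) ('C(r + i, i))%:R * x ^+ r - ('C(n + i, i.+1))%:R * x ^+ n.
  elim: n => [|n IHn]; first by rewrite !big_ord0 mulr0 add0n bin_small // mul0r subr0.
  rewrite !big_ord_recr /= mulrDr IHn addnS ?addSn !binS !natrD exprS; ring.
rewrite exprS invfM mulrC ler_pdivlMr // mulrC e.
by apply: le_trans (IHi n); rewrite gerBl mulr_ge0 ?exprn_ge0.
Qed.

Lemma negbin_asum (X : R[i]) i : normc X < 1 ->
  asum (fun r : nat => ('C(r + i, i))%:R * X ^+ r).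
Proof.
move=> X1; eexists; apply: sbound_le (negbin_bound i _); last first.
  by apply/andP; split; [exact: normc_ge0|exact: X1].
by move=> r; rewrite normcM normcX normc_nat.
Qed.

(** The same recursion on the full sums, where no boundary term is left. *)
Lemma negbin_hsum (X : R[i]) i : normc X < 1 ->
  hsum (fun r : nat => ('C(r + i, i))%:R * X ^+ r) ((1 - X) ^- i.+1).
Proof.
move=> X1.
have X10 : 1 - X != 0.
  by rewrite subr_eq0; apply: contraTneq X1 => <-; rewrite normc1 ltxx.
have shift (f : nat -> R[i]) s : hsum f s ->
    hsum (fun r => if r is r'.+1 then X * f r' else 0) (X * s).
  move=> hs; rewrite -(hsum_reindex (h := succn)) => [| |[|r]]; last 2 first.
  - by rewrite eqxx.
  - by move=> _; exists r.
  - exact: hsumZ.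
  - exact: succn_inj.
have step (f g : nat -> R[i]) : asum f ->
    (forall r, f r - (if r is r'.+1 then X * f r' else 0) = g r) ->
    hsum g ((1 - X) * usum f).
  move=> af e; have := hsumB (usumP af) (shift _ _ (usumP af)).
  rewrite -[X in X - _]mul1r -mulrBl; apply: eq_hsum => r; exact: e.
elim: i => [|i IHi].
  have a0 := negbin_asum 0 X1.
  have h1 : hsum (fun r : nat => if r is 0%N then 1 else 0 : R[i]) ((1 - X) * usum (fun r : nat => ('C(r + 0, 0))%:R * X ^+ r)).
    apply: step => // -[|r]; first by rewrite subr0 bin0 expr0 mulr1.
    by rewrite !bin0 !mul1r exprS subrr.
  have h2 : hsum (fun r : nat => if r is 0%N then 1 else 0 : R[i]) 1.
    pose h (_ : unit) := 0%N.
    rewrite -(hsum_reindex (h := h)); last 2 first.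
    - by move=> [] [].
    - by move=> [|r]; rewrite ?eqxx //; exists tt.
    have := hsum_fin (fun _ : unit => 1 : R[i]).
    by rewrite (bigD1 tt) //= big1 ?addr0 // => -[].
  have e := hsum_uniq h1 h2.
  have -> : (1 - X) ^- 1 = usum (fun r : nat => ('C(r + 0, 0))%:R * X ^+ r).
    by rewrite expr1; apply: (mulfI X10); rewrite mulfV // e.
  exact: usumP.
have a1 := negbin_asum i.+1 X1.
have h1 : hsum (fun r : nat => ('C(r + i, i))%:R * X ^+ r)
    ((1 - X) * usum (fun r : nat => ('C(r + i.+1, i.+1))%:R * X ^+ r)).
  apply: step => // -[|r]; first by rewrite subr0 !add0n !binn.
  by rewrite addnS binS addSn natrD exprS addnS; ring.
have e := hsum_uniq h1 IHi.
have -> : (1 - X) ^- i.+2 = usum (fun r : nat => ('C(r + i.+1, i.+1))%:R * X ^+ r).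
  by apply: (mulfI X10); rewrite e exprS invfM mulrA mulfV // mul1r.
exact: usumP.
Qed.

(* Coefficients of r ^ j on the basis of the binomials 'C(r + i, i). *)
Fixpoint pcoef (j i : nat) : R[i] :=
  if j is j'.+1 then
    (if i is i'.+1 then i%:R * pcoef j' i' else 0) - i.+1%:R * pcoef j' i
  else (i == 0%N)%:R.

Lemma pcoef_small j i : (j < i)%N -> pcoef j i = 0.
Proof.
elim: j i => [|j IHj] [|i] //= ji.
rewrite !IHj ?mulr0 ?subr0 //; exact: ltnW.
Qed.

(** The coefficient of the highest pole, and hence the factorial in the Lipschitz formula. *)
Lemma pcoef_diag j : pcoef j j = (j`!)%:R.
Proof.
elim: j => [//|j IHj]; rewrite [pcoef _ _]/= -/pcoef IHj pcoef_small // mulr0 subr0.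
by rewrite factS natrM.
Qed.

Lemma pow_pcoef j r : (r%:R : R[i]) ^+ j = \sum_(i < j.+1) pcoef j i * ('C(r + i, i))%:R.
Proof.
elim: j => [|j IHj]; first by rewrite big_ord1 expr0 /= bin0 mulr1.
have key i : (r%:R : R[i]) * ('C(r + i, i))%:R =
    i.+1%:R * ('C(r + i.+1, i.+1))%:R - i.+1%:R * ('C(r + i, i))%:R.
  have -> : i.+1%:R * ('C(r + i.+1, i.+1))%:R = (r%:R + i.+1%:R) * ('C(r + i, i))%:R :> R[i].
    by rewrite addnS -natrM -mul_bin_diag /= natrM -natrD addnS.
  by ring.
rewrite exprS IHj mulr_sumr.
have -> : \sum_(i < j.+1) r%:R * (pcoef j i * ('C(r + i, i))%:R) =
   \sum_(i < j.+1) i.+1%:R * pcoef j i * ('C(r + i.+1, i.+1))%:R -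
   \sum_(i < j.+1) i.+1%:R * pcoef j i * ('C(r + i, i))%:R.
  rewrite -sumrB; apply: eq_bigr => i _; rewrite mulrCA key; ring.
pose G1 (i : nat) := (if i is i'.+1 then i%:R * pcoef j i' else 0) * ('C(r + i, i))%:R.
pose G2 (i : nat) := i.+1%:R * pcoef j i * ('C(r + i, i))%:R.
have -> : \sum_(i < j.+2) pcoef j.+1 i * ('C(r + i, i))%:R =
   \sum_(i < j.+2) G1 i - \sum_(i < j.+2) G2 i.
  by rewrite -sumrB; apply: eq_bigr => i _; rewrite /G1 /G2 -mulrBl.
congr (_ - _).
  by rewrite [RHS]big_ord_recl /G1 mul0r add0r.
by rewrite [RHS]big_ord_recr /= /G2 pcoef_small // mulr0 mul0r addr0.
Qed.

(** The terms of the polylogarithm of order [- j] at [exp (2 pi i w)]. *)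
Definition polylog (j : nat) (w : R[i]) (s : nat) : R[i] :=
  s%:R ^+ j * cexp (2 * ipi R * w) ^+ s.

Definition qvar (w : R[i]) := cexp (2 * ipi R * w).

Lemma normc_qvar w : normc (qvar w) = expR (- (2 * pi * complex.Im w)).
Proof.
rewrite normc_cexp; congr expR; rewrite !ReM !ImM /=; ring.
Qed.

Lemma qvar_lt1 w : 0 < complex.Im w -> normc (qvar w) < 1.
Proof.
move=> w0; rewrite normc_qvar expR_lt1 oppr_lt0 !mulr_gt0 ?pi_gt0 //.
Qed.

Lemma polylog_hsum j w : 0 < complex.Im w ->
  hsum (polylog j w) (\sum_(i < j.+1) pcoef j i * (1 - qvar w) ^- i.+1).
Proof.
move=> /qvar_lt1 X1.
have := @hsum_bigsum R _ _ (index_enum 'I_j.+1) _ _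
  (fun i : 'I_j.+1 => hsumZ (pcoef j i) (negbin_hsum i X1)).
apply: eq_hsum => s; rewrite /polylog pow_pcoef mulr_suml.
by apply: eq_bigr => i _; rewrite mulrA.
Qed.

Lemma polylog_asum j w : 0 < complex.Im w -> asum (polylog j w).
Proof.
move=> w0; have X1 := qvar_lt1 w0.
have [M hM] : exists M, sbound (fun s => normc (\sum_(i < j.+1) pcoef j i * (('C(s + i, i))%:R * qvar w ^+ s))) M.
  elim: (index_enum 'I_j.+1) => [|i r [M hM]].
    by exists 0 => s us; rewrite big1 // => k _; rewrite big_nil normc0.
  have [M' hM'] := negbin_asum i X1.
  exists (normc (pcoef j i) * M' + M).
  apply: sbound_le (sboundD (sboundZ (normc_ge0 _) hM') hM) => s.
  by rewrite big_cons; apply: le_trans (normcD _ _) _; rewrite lerD2r normcM.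
exists M; apply: sbound_le hM => s; rewrite /polylog pow_pcoef mulr_suml.
by under eq_bigr => i _ do rewrite -mulrA.
Qed.

Lemma sin_pi_lower (x : R) : `|x| <= 3 / 4 -> `|x| / 4 <= `|sin (pi * x)|.
Proof.
move=> hx; have pp := pi_gt0 R; have p2 := pi_ge2 R.
have [y y0 [yx ->]] : exists2 y : R, 0 <= y & y = `|x| /\ `|sin (pi * x)| = `|sin (pi * y)|.
  exists `|x|; first exact: normr_ge0.
  split=> //; case: (ger0P x) => // _; by rewrite mulrN sinN normrN.
rewrite -yx; rewrite -yx in hx; apply: le_trans (ler_norm _).
have [y1|y1] := leP y (1 / 2).
  have := @sin_ge_half R (pi * y); rewrite mulr_ge0 ?(ltW pp) //= => /(_ _) h.
  apply: le_trans (h _); last by nra.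
  nra.
have -> : sin (pi * y) = sin (pi * (1 - y)).
  by rewrite mulrBr mulr1 sinB sinpi cospi mul0r sub0r mulN1r opprK.
have := @sin_ge_half R (pi * (1 - y)); rewrite mulr_ge0 ?(ltW pp) //=; last by lra.
move=> h; apply: le_trans (h _); nra.
Qed.

(** The zeros of [1 - qvar w] are the integers, and [|Re w| <= 3 / 4] leaves only 0. The bound 3/4
    is 1/2 from a frequency window plus 1/4 from the real part of [tau]. *)
Lemma one_sub_qvar_lower (V : R) : exists2 c : R, 0 < c & forall w : R[i],
  `|complex.Re w| <= 3 / 4 -> 0 < complex.Im w -> complex.Im w <= V ->
  c * normc w <= normc (1 - qvar w).
Proof.
have pp := pi_gt0 R; have p2 := pi_ge2 R.
pose rho0 := expR (- (2 * pi * V)) : R.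
have r0 : 0 < rho0 := expR_gt0 _.
exists (rho0 / 2); first by rewrite divr_gt0.
move=> w hx v0 vV; pose x := complex.Re w; pose v := complex.Im w.
rewrite -/x -/v in hx v0 vV.
have r1 : rho0 <= 1 by rewrite -expR0 ler_expR oppr_le0 !mulr_ge0 ?(ltW pp) //; lra.
pose rho := expR (- (2 * pi * v)).
have rr : rho0 <= rho by rewrite ler_expR lerN2 ler_wpM2l // mulr_ge0 // ltW.
have rp : 0 < rho := expR_gt0 _.
have e1 : 2 * pi * v * rho0 <= 1 - rho.
  have h : 1 + 2 * pi * v <= rho^-1 by rewrite -expRN opprK expR_ge1Dx.
  have : (1 + 2 * pi * v) * rho <= 1 by rewrite -ler_pdivlMr // mul1r.
  have : 2 * pi * v * rho0 <= 2 * pi * v * rho by rewrite ler_wpM2l // !mulr_ge0 // ltW.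
  lra.
have XE : qvar w = Complex (rho * cos (2 * pi * x)) (rho * sin (2 * pi * x)).
  have re0 : complex.Re (2 * ipi R * w) = - (2 * pi * v) by rewrite !ReM !ImM /=; ring.
  have im0 : complex.Im (2 * ipi R * w) = 2 * pi * x by rewrite !ImM ?ReM /=; ring.
  by rewrite /qvar /cexp re0 im0.
(* The first summand controls the imaginary part of [w], the second its real part. *)
have n2 : normc (1 - qvar w) ^+ 2 = (1 - rho) ^+ 2 + 4 * rho * sin (pi * x) ^+ 2.
  rewrite normc_sqr XE !ReD !ImD !ReN !ImN /=.
  have -> : 2 * pi * x = pi * x + pi * x by ring.
  rewrite cosD sinD; have h := cos2Dsin2 (pi * x).
  have -> : cos (pi * x) * cos (pi * x) = 1 - sin (pi * x) ^+ 2.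
    by rewrite -h addrK expr2.
  have h' : cos (pi * x) ^+ 2 = 1 - sin (pi * x) ^+ 2 by rewrite -h addrK.
  rewrite sub0r sqrrN.
  have -> : (rho * (sin (pi * x) * cos (pi * x) + cos (pi * x) * sin (pi * x))) ^+ 2 =
    4 * rho ^+ 2 * sin (pi * x) ^+ 2 * cos (pi * x) ^+ 2 by ring.
  rewrite h'; ring.
have s2 : x ^+ 2 / 16 <= sin (pi * x) ^+ 2.
  have h := sin_pi_lower hx.
  have : (`|x| / 4) ^+ 2 <= `|sin (pi * x)| ^+ 2.
    by apply: lerXn2r; rewrite ?nnegrE ?divr_ge0.
  rewrite exprMn !real_normK ?num_real //; lra.
rewrite -(@ler_pXn2r _ 2) ?nnegrE ?normc_ge0 ?mulr_ge0 ?normc_ge0 ?divr_ge0 ?(ltW r0) //.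
rewrite n2 exprMn normc_sqr -/x -/v.
have q1 : (2 * pi * v * rho0) ^+ 2 <= (1 - rho) ^+ 2.
  apply: lerXn2r; rewrite ?nnegrE ?mulr_ge0 ?(ltW pp) ?(ltW v0) ?(ltW r0) //.
  by apply: le_trans e1; rewrite !mulr_ge0 ?(ltW pp) ?(ltW v0) ?(ltW r0).
have q2 : rho0 * (x ^+ 2 / 16) <= rho * sin (pi * x) ^+ 2.
  by apply: ler_pM => //; rewrite ?(ltW r0) ?divr_ge0 ?sqr_ge0.
have q3 : rho0 ^+ 2 <= rho0 by rewrite expr2 ler_piMr ?(ltW r0).
have q4 : v ^+ 2 * rho0 ^+ 2 <= (2 * pi * v * rho0) ^+ 2.
  rewrite -exprMn; apply: lerXn2r; rewrite ?nnegrE ?mulr_ge0 ?(ltW pp) ?(ltW v0) ?(ltW r0) //.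
  rewrite ler_wpM2r ?(ltW r0) // ler_peMl ?(ltW v0) //; lra.
have q5 : rho0 ^+ 2 * (x ^+ 2 / 16) <= rho0 * (x ^+ 2 / 16).
  by rewrite ler_wpM2r // divr_ge0 ?sqr_ge0.
rewrite mulrDr exprMn (_ : (2^-1) ^+ 2 = 1 / 4 :> R); last by field.
have q6 := sqr_ge0 x; have q7 := sqr_ge0 v; have q8 := sqr_ge0 rho0.
have : 0 <= rho0 ^+ 2 * v ^+ 2 by rewrite mulr_ge0.
nra.
Qed.

Lemma lat_lower (tau : R[i]) : 0 < complex.Im tau -> exists2 d : R, 0 < d &
  forall x y : R, d * (x ^+ 2 + y ^+ 2) <= normc (x%:C * tau + y%:C) ^+ 2.
Proof.
case: tau => xi eta; rewrite [complex.Im _]/= => e0.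
pose T := 2 + (1 + 2 * xi ^+ 2) / eta ^+ 2.
have e2 : 0 < eta ^+ 2 by rewrite exprn_gt0.
have T0 : 0 < T by rewrite ltr_pwDl // divr_ge0 ?(ltW e2) // addr_ge0 // mulr_ge0 ?sqr_ge0.
exists T^-1; first by rewrite invr_gt0.
move=> x y; rewrite mulrC ler_pdivrMr // normc_sqr ReD ImD ReMC ImMC /= addr0.
pose Z := (x * xi + y) ^+ 2 + (x * eta) ^+ 2; rewrite -/Z.
have h1 : x ^+ 2 <= Z / eta ^+ 2.
  by rewrite ler_pdivlMr // -exprMn /Z lerDr sqr_ge0.
have h2 : y ^+ 2 <= 2 * Z + 2 * xi ^+ 2 * (Z / eta ^+ 2).
  have : 2 * xi ^+ 2 * x ^+ 2 <= 2 * xi ^+ 2 * (Z / eta ^+ 2) by rewrite ler_wpM2l // mulr_ge0 ?sqr_ge0.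
  have := sqr_ge0 (x * xi + (x * xi + y)); have := sqr_ge0 (x * eta).
  by rewrite /Z; nra.
apply: le_trans (lerD h1 h2) _; rewrite le_eqVlt; apply/orP; left; apply/eqP.
by rewrite /T; field; rewrite gt_eqF.
Qed.

Lemma powdiff_bound (n : nat) (C : R) : 0 <= C -> exists2 K : R, 0 <= K & forall x y : R[i],
  normc x <= C -> normc y <= C -> normc (x ^+ n - y ^+ n) <= K * normc (x - y).
Proof.
move=> C0; elim: n => [|n [K K0 IH]].
  by exists 0 => // x y _ _; rewrite !expr0 subrr normc0 mul0r.
exists (C * K + C ^+ n); first by rewrite addr_ge0 ?mulr_ge0 ?exprn_ge0.
move=> x y hx hy; rewrite !exprS.
rewrite (_ : _ - _ = x * (x ^+ n - y ^+ n) + (x - y) * y ^+ n); last by ring.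
apply: le_trans (normcD _ _) _; rewrite !normcM normcX mulrDl -mulrA; apply: lerD.
  by apply: ler_pM; rewrite ?normc_ge0 ?IH.
rewrite mulrC ler_wpM2r ?normc_ge0 //; apply: lerXn2r; rewrite ?nnegrE ?normc_ge0 //.
Qed.

Lemma normc_ipi2 : normc (2 * ipi R) = 2 * pi.
Proof. by rewrite ipiE !normcM normc_i normc_nat normc_real mul1r ger0_norm ?(ltW (pi_gt0 R)). Qed.

Lemma ipi2_neq0 : 2 * ipi R != 0.
Proof. by rewrite -normc_eq0 normc_ipi2 mulf_neq0 // gt_eqF ?pi_gt0. Qed.

(** The sum is a polynomial in [1 / (1 - qvar w)] of degree [j + 1]. Near 0 only the top power
    survives multiplication by [w ^ (j + 1)]. The first bound provides domination, the second the
    termwise limit. *)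
Lemma polylog_asymp (j : nat) (V : R) : exists2 K : R, 0 <= K & forall w : R[i],
  `|complex.Re w| <= 3 / 4 -> 0 < complex.Im w -> complex.Im w <= V ->
  normc (w ^+ j.+1 * usum (polylog j w)) <= K /\
  (normc w <= 1 ->
   normc (w ^+ j.+1 * usum (polylog j w) - (j`!)%:R / (- (2 * ipi R)) ^+ j.+1) <= K * normc w).
Proof.
have pp := pi_gt0 R.
have [c c0 hc] := one_sub_qvar_lower V.
have Cp : 0 <= c^-1 + (2 * pi)^-1 by rewrite addr_ge0 // invr_ge0 ?mulr_ge0 // ltW.
have [Kp Kp0 hKp] := powdiff_bound j.+1 Cp.
pose A := 1 + `|V|; have A1 : 1 <= A by rewrite lerDl.
have A0 : 0 <= A by lra.
pose Sm := \sum_(i < j.+1) normc (pcoef j i) * (c^-1) ^+ i.+1.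
have Sm0 : 0 <= Sm by apply: sumr_ge0 => i _; rewrite mulr_ge0 ?normc_ge0 ?exprn_ge0 // invr_ge0 ltW.
have c10 : 0 <= c^-1 by rewrite invr_ge0 ltW.
pose C1 := 16 * (2 * pi) * c^-1.
have C10 : 0 <= C1 by rewrite /C1 !mulr_ge0 // ltW.
exists (A ^+ j * Sm + Sm + (j`!)%:R * Kp * C1).
  by nneg.
move=> w hx v0 vV; have hw := hc w hx v0 vV.
have w0 : w != 0 by apply: contraTneq v0 => ->; rewrite ltxx.
have nw : 0 < normc w by rewrite normc_gt0.
have nX : 0 < normc (1 - qvar w) by apply: lt_le_trans hw; rewrite mulr_gt0.
have X0 : 1 - qvar w != 0 by rewrite -normc_gt0.
pose q := w / (1 - qvar w).
have qle : normc q <= c^-1.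
  rewrite /q normcM normcV ler_pdivrMr // mulrC ler_pdivlMr // mulrC; exact: hw.
rewrite (usum_eq (polylog_hsum j v0)) mulr_sumr.
have tE (i : 'I_j.+1) : w ^+ j.+1 * (pcoef j i * (1 - qvar w) ^- i.+1) =
    pcoef j i * w ^+ (j - i) * q ^+ i.+1.
  have ij : (i <= j)%N by rewrite -ltnS.
  rewrite /q expr_div_n -{1}(subnK ij) -addnS exprD; ring.
under eq_bigr => i _ do rewrite tE.
have tle (i : 'I_j.+1) (B : R) : normc w ^+ (j - i) <= B ->
    normc (pcoef j i * w ^+ (j - i) * q ^+ i.+1) <= B * (normc (pcoef j i) * (c^-1) ^+ i.+1).
  move=> hB; rewrite !normcM !normcX mulrAC mulrC [leRHS]mulrC.
  rewrite [normc w ^+ _ * _]mulrC; apply: ler_pM; [nneg|nneg| |exact: hB].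
  apply: ler_wpM2l; first nneg.
  by apply: lerXn2r; rewrite ?nnegrE ?normc_ge0.
have wA : normc w <= A.
  apply: le_trans (normc_le_ReIm _) _; have := ler_norm V; rewrite (ger0_norm (ltW v0)) /A.
  lra.
split.
  apply: le_trans (normc_sum _ _ _) _.
  apply: le_trans (_ : A ^+ j * Sm <= _).
    rewrite /Sm mulr_sumr; apply: ler_sum => i _; apply: tle.
    apply: le_trans (_ : A ^+ (j - i) <= _).
      by apply: lerXn2r; rewrite ?nnegrE ?normc_ge0.
    by rewrite ler_weXn2l // leq_subr.
  by rewrite -addrA lerDl; nneg.
move=> w1; pose q0 := (- (2 * ipi R))^-1.
have q0n : normc q0 = (2 * pi)^-1 by rewrite normcV normcN normc_ipi2.
rewrite big_ord_recr /= subnn expr0 mulr1 pcoef_diag.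
rewrite (_ : _ - _ = \sum_(i < j) pcoef j i * w ^+ (j - i) * q ^+ i.+1 +
   (j`!)%:R * (q ^+ j.+1 - q0 ^+ j.+1)); last by rewrite /q0 exprVn; ring.
apply: le_trans (normcD _ _) _; rewrite !mulrDl; apply: lerD.
  apply: ler_wpDl; first by rewrite !mulr_ge0 ?exprn_ge0 ?normc_ge0.
  apply: le_trans (normc_sum _ _ _) _; rewrite /Sm big_ord_recr /= mulrDl.
  apply: ler_wpDr; first by rewrite !mulr_ge0 ?normc_ge0 ?exprn_ge0.
  rewrite mulr_suml; apply: ler_sum => i _; rewrite [leRHS]mulrC.
  apply: (tle (widen_ord (leqnSn j) i)) => /=.
  have ij : (0 < j - i)%N by rewrite subn_gt0.
  rewrite -(prednK ij) exprS ler_piMr ?normc_ge0 //.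
  by apply: exprn_ile1; rewrite ?normc_ge0.
rewrite normcM normc_nat -!mulrA ler_wpM2l //.
apply: le_trans (hKp q q0 _ _) _.
- by apply: le_trans qle _; rewrite lerDl invr_ge0 mulr_ge0 // ltW.
- by rewrite q0n lerDr.
rewrite ler_wpM2l //.
have tay := cexp_taylor (2 * ipi R * w); rewrite -/(qvar w) in tay.
have re0 : complex.Re (2 * ipi R * w) <= 0.
  have -> : complex.Re (2 * ipi R * w) = - (2 * pi * complex.Im w) by rewrite !ReM !ImM /=; ring.
  by rewrite oppr_le0 !mulr_ge0 // ltW.
have e1 : expR (complex.Re (2 * ipi R * w)) <= 1 by rewrite -expR0 ler_expR.
have t2 : normc (qvar w - 1 - 2 * ipi R * w) <= 16 * (2 * pi * normc w) ^+ 2.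
  apply: le_trans tay _; rewrite normcM normc_ipi2.
  have := sqr_ge0 (2 * pi * normc w); nra.
rewrite (_ : q - q0 = - (q / (2 * ipi R * w)) * (qvar w - 1 - 2 * ipi R * w)); last first.
  rewrite /q /q0; move: ipi2_neq0; move: (2 * ipi R) => T T0; field.
  by rewrite w0 X0 T0.
rewrite [leLHS]normcM normcN [normc (q / _)]normcM normcV [normc (2 * ipi R * w)]normcM normc_ipi2.
have iw0 : 0 <= (2 * pi * normc w)^-1 by rewrite invr_ge0 !mulr_ge0 ?normc_ge0 // ltW.
apply: le_trans (ler_pM (mulr_ge0 (normc_ge0 _) iw0) (normc_ge0 _) (ler_wpM2r iw0 qle) t2) _.
rewrite le_eqVlt; apply/orP; left; apply/eqP; rewrite /C1; move: (pi : R) pp => P P0; field.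
by rewrite !gt_eqF.
Qed.

Lemma hsum_window (lw : nat) (F : int -> R[i]) :
  hsum (fun n : int => if (- lw%:Z <= n) && (n < lw%:Z) then F n else 0)
    (\sum_(i < 2 * lw) F ((i : nat)%:Z - lw%:Z)).
Proof.
pose h (i : 'I_(2 * lw)) : int := (i : nat)%:Z - lw%:Z.
have ih : injective h by move=> i i' /addIr [] /val_inj.
rewrite -(hsum_reindex (h := h)) //; last first.
  move=> r; case: ifP => [/andP[r1 r2] _|]; last by rewrite eqxx.
  have rl : (absz (GRing.add (r : int) lw%:Z) < 2 * lw)%N by lia.
  exists (Ordinal rl); rewrite /h /=; lia.
apply: eq_hsum (hsum_fin _) => i; rewrite /h ifT //.
by have := ltn_ord i => il; apply/andP; split; lia.
Qed.

Lemma normc_cexp_2pi_real (al : R) (w : R[i]) :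
  normc (cexp (2 * ipi R * al%:C * w)) = expR (- (2 * pi * al * complex.Im w)).
Proof.
rewrite normc_cexp; congr expR; rewrite !ReM !ImM /=; ring.
Qed.

Lemma dvd_shift_range (L : nat) (m c : int) : (0 < L)%N -> (L%:Z %| m + c)%Z ->
  exists r : int, r * L%:Z - c = m.
Proof. by move=> L0 /dvdzP[q qE]; exists q; rewrite -qE addrK. Qed.

Lemma window_absP (b : nat) (n : int) : (`|n| < b)%N -> (- b%:Z <= n) && (n < b%:Z).
Proof. by move=> h1; apply/andP; split; lia. Qed.

(** * The exact window identity and its limit *)

Section Twisted.
Variables (tau : R[i]) (p : int) (Q j : nat).
Hypotheses (t0 : 0 < complex.Im tau) (Q0 : (0 < Q)%N) (j0 : (0 < j)%N).
Let al : R := p%:~R / Q%:R.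

Definition lip_dual (r : int) : R[i] :=
  if al < r%:~R then (r%:~R - al)%:C ^+ j * cexp (2 * ipi R * r%:~R * tau) else 0.

Definition lip_prim (n : int) : R[i] :=
  (tau + n%:~R) ^- j.+1 * cexp (2 * ipi R * al%:C * (tau + n%:~R)).

(** The factor [Q] makes [Lr l' * al = 2 l' p] an integer, so that [Lr l' * (r - al)] is an integer
    [s] for every integer [r]. *)
Let Lr (l' : nat) : nat := (2 * (l' * Q))%N.

Let f (l' : nat) (s : int) : R[i] :=
  if (0 <= s) && ((Lr l')%:Z %| s + (2 * l')%:Z * p)%Z then
    (Lr l')%:R ^- j * (s%:~R ^+ j * cexp (2 * ipi R * ((s + (2 * l')%:Z * p)%:~R / (Lr l')%:R) * tau))
  else 0.

Let h (l' : nat) (r : int) : int := r * (Lr l')%:Z - (2 * l')%:Z * p.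

Let L0 l' : (0 < l')%N -> (0 < Lr l')%N.
Proof. by move=> l0; rewrite /Lr muln_gt0 /= muln_gt0 l0. Qed.

Let h_inj l' : (0 < l')%N -> injective (h l').
Proof.
move=> l0 r r' /addIr; apply: mulIf; rewrite eqz_nat -lt0n; exact: L0.
Qed.

Let f_supp l' s : (0 < l')%N -> f l' s != 0 -> exists r, h l' r = s.
Proof.
move=> l0; rewrite /f; case: ifP => [/andP[_ dv] _|]; last by rewrite eqxx.
by apply: dvd_shift_range dv; exact: L0.
Qed.

Let f_dual l' r : (0 < l')%N -> f l' (h l' r) = lip_dual r.
Proof.
move=> l0; have Lp : 0 < ((Lr l')%:R : R) by rewrite ltr0n L0.
have Qp : 0 < (Q%:R : R) by rewrite ltr0n.
have Ln0 : (Lr l')%:R != 0 :> R[i] by rewrite pnatr_eq0 -lt0n L0.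
have hE : (h l' r)%:~R = (Lr l')%:R * (r%:~R - al) :> R.
  rewrite /h rmorphB /= !intrM /= -!pmulrn /al /Lr !natrM; field.
  by rewrite gt_eqF.
have hEC : (h l' r)%:~R = (Lr l')%:R * (r%:~R - al)%:C :> R[i].
  by rewrite (intC R (h l' r)) hE rmorphM /= -natC.
have dv : ((Lr l')%:Z %| h l' r + (2 * l')%:Z * p)%Z by rewrite /h subrK dvdz_mull.
have mE : (h l' r + (2 * l')%:Z * p)%:~R / (Lr l')%:R = r%:~R :> R[i].
  by rewrite /h subrK intrM -pmulrn mulfK.
rewrite /f /lip_dual dv andbT mE -(ler0z R) hE pmulr_rge0 // subr_ge0 le_eqVlt.
have [e|ne] := eqVneq al r%:~R.
  by rewrite e ltxx /= hEC e subrr mulr0 expr0n eqn0Ngt j0 mul0r mulr0.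
rewrite /=; case: ifP => // _.
by rewrite hEC exprMn !mulrA mulVf ?mul1r ?expf_neq0.
Qed.

Let wv l' (n : int) := (tau + n%:~R) / (Lr l')%:R.

Let Im_wv l' n : complex.Im (wv l' n) = complex.Im tau / (Lr l')%:R.
Proof.
rewrite /wv (natC R (Lr l')) -fmorphV mulrC ImMC ImD (intC R n) /= addr0 mulrC //.
Qed.

Let Re_wv l' n : complex.Re (wv l' n) = (complex.Re tau + n%:~R) / (Lr l')%:R.
Proof. by rewrite /wv (natC R (Lr l')) -fmorphV mulrC ReMC ReD (intC R n) /= mulrC. Qed.

Let Im_wv_gt0 l' n : (0 < l')%N -> 0 < complex.Im (wv l' n).
Proof. by move=> l0; rewrite Im_wv divr_gt0 // ltr0n L0. Qed.

Let u l' (n : int) : R[i] := cexp (2 * ipi R * al%:C * (tau + n%:~R)) *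
  ((Lr l')%:R ^- j.+1 * usum (polylog j (wv l' n))).

(** Summing over a full period of [n] retains exactly the [s] for which [Lr l'] divides
    [s + 2 l' p], that is, those of the form [Lr l' * (r - al)]. *)
Let f_nat l' (s : nat) : (0 < l')%N ->
  \sum_(i < 2 * (l' * Q)) cexp (2 * ipi R * al%:C * (tau + ((i : nat)%:Z - (l' * Q)%:Z)%:~R)) *
    ((Lr l')%:R ^- j.+1 * polylog j (wv l' ((i : nat)%:Z - (l' * Q)%:Z)) s) = f l' s%:Z.
Proof.
move=> l0; have Ln0 : (Lr l')%:R != 0 :> R[i] by rewrite pnatr_eq0 -lt0n L0.
have Qn0 : Q%:R != 0 :> R[i] by rewrite pnatr_eq0 -lt0n.
have ln0 : l'%:R != 0 :> R[i] by rewrite pnatr_eq0 -lt0n.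
pose m : int := s%:Z + (2 * l')%:Z * p.
have alE : al%:C = p%:~R / Q%:R :> R[i] by rewrite /al rmorphM fmorphV /= -intC -natC.
have tE (n : int) : cexp (2 * ipi R * al%:C * (tau + n%:~R)) *
    ((Lr l')%:R ^- j.+1 * polylog j (wv l' n) s) =
    ((Lr l')%:R ^- j.+1 * (s%:R ^+ j * cexp (2 * ipi R * (m%:~R / (Lr l')%:R) * tau))) *
    cexp (2 * ipi R * (n%:~R * m%:~R / (Lr l')%:R)).
  rewrite /polylog -cexpMn.
  rewrite mulrCA [cexp _ * (_ * _)]mulrCA -cexpD -[RHS]mulrA -[X in _ = _ * X]mulrA -cexpD.
  congr (_ * (_ * cexp _)); rewrite /wv alE /m intrD intrM /Lr !natrM -!pmulrn !natrM; field.
  by rewrite ln0 Qn0.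
under eq_bigr => i _ do rewrite tE.
rewrite -mulr_sumr (root_sum R (l' * Q)%:Z m (L0 l0)) /f -/m /=.
case: ifP => dv; last by rewrite mulr0.
case/dvdzP: dv => q qE.
have -> : 2 * ipi R * ((- (l' * Q)%:Z)%:~R * m%:~R / (Lr l')%:R) = 2 * ipi R * (- (l' * Q)%:Z * q)%:~R.
  by rewrite qE !intrM -!pmulrn; field.
rewrite cexp_2pi_int mulr1 exprS invfM.
by rewrite mulrAC [_^-1 / _]mulrC -[X in X * _ = _]mulrA mulVf // mulr1 -pmulrn.
Qed.

(** Already at [l' = 1] the dual terms form a subfamily of a polylogarithm, up to a constant
    factor. *)
Lemma lip_dual_asum : asum lip_dual.
Proof.
have l1 : (0 < 1)%N by [].
suff : asum (f 1).
  move=> af; apply: eq_asum (fun r => f_dual r l1) _.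
  by apply/(asum_reindex (h := h 1)) => //; [exact: h_inj|move=> s; exact: f_supp].
apply/(asum_reindex (h := Posz)) => //; first by move=> ? ? [].
  by move=> [s|s] hs; [exists s|rewrite /f /= eqxx in hs].
have Lp : 0 < ((Lr 1)%:R : R) by rewrite ltr0n L0.
have w0 : 0 < complex.Im (tau / (Lr 1)%:R).
  by have := Im_wv_gt0 0 l1; rewrite /wv addr0.
have [M b] := polylog_asum j w0.
pose c := normc ((Lr 1)%:R ^- j) * normc (cexp (2 * ipi R * ((2%:Z * p)%:~R / (Lr 1)%:R) * tau)).
have c0 : 0 <= c by rewrite /c; nneg.
exists (c * M); apply: sbound_le (sboundZ c0 b) => s.
rewrite /f; case: ifP => [_|]; last by rewrite normc0 mulr_ge0 ?normc_ge0.
rewrite /c -!normcM le_eqVlt; apply/orP; left; apply/eqP; congr normc.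
rewrite /polylog -cexpMn -[RHS]mulrA [X in _ = _ * X]mulrCA -cexpD.
by congr (_ * (_ * cexp _)); rewrite muln1 intrD -pmulrn; ring.
Qed.

Lemma lip_window l' : (0 < l')%N ->
  hsum (fun n : int => if (- (l' * Q)%:Z <= n) && (n < (l' * Q)%:Z) then u l' n else 0)
    (usum lip_dual).
Proof.
move=> l0; have := hsum_window (l' * Q) (u l').
suff -> : \sum_(i < 2 * (l' * Q)) u l' ((i : nat)%:Z - (l' * Q)%:Z) = usum lip_dual by [].
have hs : hsum (fun s : nat => f l' s%:Z) (\sum_(i < 2 * (l' * Q)) u l' ((i : nat)%:Z - (l' * Q)%:Z)).
  have := @hsum_bigsum R _ _ (index_enum 'I_(2 * (l' * Q))) _ _ (fun i : 'I_(2 * (l' * Q)) =>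
    hsumZ (cexp (2 * ipi R * al%:C * (tau + ((i : nat)%:Z - (l' * Q)%:Z)%:~R)))
      (hsumZ ((Lr l')%:R ^- j.+1)
       (usumP (polylog_asum j (Im_wv_gt0 ((i : nat)%:Z - (l' * Q)%:Z) l0))))).
  by apply: eq_hsum => s; rewrite -f_nat.
apply/esym/usum_eq.
move: hs; rewrite (hsum_reindex (h := Posz) (f := f l')) //; last 2 first.
- by move=> ? ? [].
- by move=> [s|s] hs; [exists s|rewrite /f /= eqxx in hs].
rewrite -(hsum_reindex (h := h l')); last 2 first.
- exact: h_inj.
- by move=> s; exact: f_supp.
by apply: eq_hsum => r; rewrite f_dual.
Qed.

(** In [lip_window] the total does not depend on [l'], while each term tends to [q * lip_prim]. The
    decay [|tau + n| ^ - (j + 1)] with [j > 0] dominates, so the total must equal the limit of the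
    sums. *)
Theorem lipschitz : asum lip_prim /\
  usum lip_prim = (- (2 * ipi R)) ^+ j.+1 / (j`!)%:R * usum lip_dual.
Proof.
have pp := pi_gt0 R.
pose eta := complex.Im tau; pose xi := complex.Re tau.
have [K K0 hK] := polylog_asymp j eta.
have [d d0 hd] := lat_lower t0.
pose c0 := expR (- (2 * pi * al * eta)) : R.
have c00 : 0 <= c0 := expR_ge0 _.
have cE (n : int) : normc (cexp (2 * ipi R * al%:C * (tau + n%:~R))) = c0.
  by rewrite normc_cexp_2pi_real ImD (intC R n) /= addr0.
have tn0 (n : int) : tau + n%:~R != 0.
  apply/negP => /eqP /(congr1 (@complex.Im R)); rewrite ImD (intC R n) /= addr0 => e.
  by move: t0; rewrite e ltxx.
have lowt (n : int) : d * eta ^+ j.-1 * (1 + n%:~R ^+ 2) <= normc (tau + n%:~R) ^+ j.+1.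
  have h1 := hd 1 n%:~R; rewrite expr1n mul1r -intC in h1.
  have h2 : eta <= normc (tau + n%:~R).
    apply: le_trans (normc_Im _); rewrite ImD (intC R n) /= addr0; exact: ler_norm.
  have -> : j.+1 = (2 + j.-1)%N by rewrite addSn addSn add0n prednK.
  rewrite exprD mulrAC; apply: ler_pM; rewrite ?mulr_ge0 ?(ltW d0) ?exprn_ge0 ?(ltW t0) //.
    by rewrite addr_ge0 ?sqr_ge0.
  by apply: lerXn2r; rewrite ?nnegrE ?normc_ge0 // (ltW t0).
have de0 : 0 < d * eta ^+ j.-1 by rewrite mulr_gt0 // exprn_gt0.
have invle (n : int) : normc ((tau + n%:~R) ^- j.+1) <= (d * eta ^+ j.-1)^-1 * (1 + n%:~R ^+ 2)^-1.
  rewrite normcV normcX -invfM lef_pV2 ?posrE ?lowt //.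
    by rewrite exprn_gt0 // normc_gt0.
  by rewrite mulr_gt0 // sqr1_gt0.
(* From [l0] on, the real part of [tau] takes up at most a quarter of [Lr l'], and the window at
   most a half. *)
pose l0 := (Num.bound (2 * `|xi|)).+1.
have l0P l' : (l0 <= l')%N -> 4 * `|xi| <= (Lr l')%:R.
  move=> hl; have x0 : 0 <= 2 * `|xi| by rewrite mulr_ge0.
  have := archi_boundP x0 => hb.
  have h1 : ((Num.bound (2 * `|xi|))%:R : R) <= (l' * Q)%:R.
    by rewrite ler_nat; apply: leq_trans (leq_pmulr _ Q0); apply: ltnW.
  rewrite /Lr natrM; lra.
have wprop l' (n : int) : (l0 <= l')%N -> (- (l' * Q)%:Z <= n) && (n < (l' * Q)%:Z) ->
   [/\ `|complex.Re (wv l' n)| <= 3 / 4, 0 < complex.Im (wv l' n) & complex.Im (wv l' n) <= eta].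
  move=> hl /andP[n1 n2]; have l'0 : (0 < l')%N by apply: leq_trans hl.
  have Lp : 0 < ((Lr l')%:R : R) by rewrite ltr0n L0.
  split; last 1 first.
  - rewrite Im_wv ler_pdivrMr // ler_peMr ?(ltW t0) // -[1]/(1%:R) ler_nat; exact: L0.
  - rewrite Re_wv normrM normfV (ger0_norm (ltW Lp)) ler_pdivrMr //.
    apply: le_trans (ler_normD _ _) _.
    have h1 := l0P l' hl.
    have h2 : 2 * `|n%:~R| <= (Lr l')%:R :> R.
      rewrite -intr_norm (_ : 2 = 2%:~R) // -intrM [(Lr l')%:R]pmulrn ler_int /Lr; lia.
    rewrite -/xi; lra.
  - exact: Im_wv_gt0.
pose q := (j`!)%:R / (- (2 * ipi R)) ^+ j.+1 : R[i].
have q0 : q != 0.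
  by rewrite mulf_neq0 ?invr_eq0 ?expf_neq0 ?oppr_eq0 ?ipi2_neq0 // pnatr_eq0 -lt0n fact_gt0.
have uE l' n : (0 < l')%N -> u l' n = cexp (2 * ipi R * al%:C * (tau + n%:~R)) *
   ((tau + n%:~R) ^- j.+1 * (wv l' n ^+ j.+1 * usum (polylog j (wv l' n)))).
  move=> l'0; rewrite /u; congr (_ * _); rewrite mulrA; congr (_ * _).
  by rewrite /wv expr_div_n mulrA mulVf ?mul1r // expf_neq0.
pose g (n : int) : R := (c0 * ((d * eta ^+ j.-1)^-1 * K)) * (1 + n%:~R ^+ 2)^-1.
have g00 : 0 <= c0 * ((d * eta ^+ j.-1)^-1 * K) by rewrite !mulr_ge0 // invr_ge0 ltW.
have aprim : asum lip_prim.
  have c1 : 0 <= c0 * (d * eta ^+ j.-1)^-1 by rewrite mulr_ge0 // invr_ge0 ltW.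
  apply: asum_le (sboundZ c1 (inv1sq_int R)) => n.
  by rewrite /lip_prim normcM cE mulrC -mulrA ler_wpM2l.
split=> //.
have vE : hsum (fun n => q * lip_prim n) (q * usum lip_prim) by apply: hsumZ; exact: usumP.
suff e : usum lip_dual = q * usum lip_prim.
  rewrite e mulrA -[LHS]mul1r; congr (_ * _).
  rewrite /q; field.
  by rewrite ?expf_neq0 ?oppr_eq0 ?ipi2_neq0 // pnatr_eq0 -lt0n fact_gt0.
apply/eqP; rewrite -subr_eq0; apply/eqP; apply: normc_eps0 => e e0.
have := @tannery R int (fun idx n => if (- ((l0 + idx) * Q)%:Z <= n) && (n < ((l0 + idx) * Q)%:Z)
   then u (l0 + idx)%N n else 0) (fun n => q * lip_prim n) (fun=> usum lip_dual) g
   (c0 * ((d * eta ^+ j.-1)^-1 * K) * 8) (q * usum lip_prim).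
case/(_ _ _ _ _ _ e e0) => [idx|idx n|||//|L /(_ L (leqnn _)) //].
- by apply: lip_window.
- case: ifP => [win|_]; last by rewrite normc0 mulr_ge0 // invr_ge0 ltW ?sqr1_gt0.
  have [w1 w2 w3] := wprop _ _ (leq_addr idx l0) win.
  have [h1 _] := hK _ w1 w2 w3.
  rewrite uE // normcM cE normcM /g -!mulrA; apply: ler_wpM2l => //.
  by rewrite [leRHS]mulrA [leRHS]mulrAC; apply: ler_pM; rewrite ?normc_ge0.
- exact: sboundZ (inv1sq_int R).
- move=> n d' d'0.
  pose T := c0 * (normc ((tau + n%:~R) ^- j.+1) * (K * normc (tau + n%:~R))).
  have T0 : 0 <= T by rewrite /T; nneg.
  exists (maxn `|n|.+1 (maxn (Num.bound (T / d')) (Num.bound (normc (tau + n%:~R))))) => idx.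
  rewrite !geq_max => /and3P[i1 i2 i3].
  have Lge (b : nat) : (b <= idx)%N -> (b%:R : R) <= (Lr (l0 + idx))%:R.
    move=> bi; rewrite ler_nat /Lr; apply: leq_trans bi _.
    apply: leq_trans (leq_addl l0 idx) _; apply: leq_trans (leq_pmulr _ Q0) _.
    by rewrite mul2n -addnn leq_addr.
  have win : (- ((l0 + idx) * Q)%:Z <= n) && (n < ((l0 + idx) * Q)%:Z).
    have h1 : (`|n| < (l0 + idx) * Q)%N.
      apply: leq_trans i1 _; apply: leq_trans (leq_addl l0 idx) _; exact: leq_pmulr.
    exact: window_absP.
  have l'0 : (0 < l0 + idx)%N by [].
  have Lp : 0 < ((Lr (l0 + idx))%:R : R) by rewrite ltr0n L0.
  have [w1 w2 w3] := wprop _ _ (leq_addr idx l0) win.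
  have [_ h2] := hK _ w1 w2 w3.
  have nw : normc (wv (l0 + idx) n) = normc (tau + n%:~R) / (Lr (l0 + idx))%:R.
    by rewrite /wv normcM normcV normc_nat.
  have {}h2 := h2 _; rewrite win uE //.
  rewrite (_ : _ - _ = cexp (2 * ipi R * al%:C * (tau + n%:~R)) * ((tau + n%:~R) ^- j.+1 *
    (wv (l0 + idx) n ^+ j.+1 * usum (polylog j (wv (l0 + idx) n)) - q))); last by rewrite /lip_prim; ring.
  rewrite !normcM cE.
  apply: le_lt_trans (_ : T / (Lr (l0 + idx))%:R < _).
    rewrite /T -!mulrA; apply: ler_wpM2l => //; apply: ler_wpM2l; first exact: normc_ge0.
    rewrite -nw; apply: h2; rewrite nw ler_pdivrMr // mul1r.
    apply/ltW; apply: lt_le_trans (archi_boundP (normc_ge0 _)) _; exact: Lge.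
  rewrite ltr_pdivrMr // mulrC -ltr_pdivrMr //.
  have T1 : 0 <= T / d' by rewrite divr_ge0 // ltW.
  by apply: lt_le_trans (archi_boundP T1) _; exact: Lge.
Qed.

End Twisted.

End Lipschitz.

(** * The Eisenstein series: convergence and invariance *)

Section IntegralForms.
Variables (N : nat) (S : 'M[int]_N).
Hypotheses (symS : S^T = S) (evS : forall i, (2 %| S i i)%Z).

(** Off-diagonal terms occur in equal pairs by symmetry, and diagonal entries are even. *)
Lemma bl_even (x : 'cV[int]_N) : exists e : int, bl S x x = 2 * e.
Proof.
pose f i j := x i 0 * S i j * x j 0.
have fsym i j : f i j = f j i.
  by rewrite /f -[in LHS]symS mxE; ring.
have -> : bl S x x = \sum_i \sum_j f i j.
  rewrite blE dotE; apply: eq_bigr => i _; rewrite mxE mulr_sumr.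
  by apply: eq_bigr => j _; rewrite /f mulrA.
have split3 i : \sum_j f i j = \sum_(j : 'I_N | (j < i)%N) f i j + (f i i + \sum_(j : 'I_N | (i < j)%N) f i j).
  rewrite (bigID (fun j : 'I_N => (j < i)%N)) /=; congr (_ + _).
  rewrite (bigD1 i) /= ?ltnn //; congr (_ + _); apply: eq_bigl => j.
  by rewrite -leqNgt ltn_neqAle andbC eq_sym.
under eq_bigr => i _ do rewrite split3.
rewrite !big_split /=.
have -> : \sum_(i : 'I_N) \sum_(j : 'I_N | (j < i)%N) f i j =
    \sum_(i : 'I_N) \sum_(j : 'I_N | (i < j)%N) f i j.
  rewrite (exchange_big_dep predT) //=; apply: eq_bigr => j _; apply: eq_bigr => i _.
  exact: fsym.
have [d dE] : exists d : int, \sum_i f i i = 2 * d.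
  suff : (2 %| \sum_i f i i)%Z by case/dvdzP => q ->; exists q; rewrite mulrC.
  apply: rpred_sum => i _; rewrite /f mulrAC mulrC dvdz_mulr //.
by exists (\sum_(i : 'I_N) \sum_(j : 'I_N | (i < j)%N) f i j + d); rewrite dE; ring.
Qed.

Lemma bil_intv (F : comNzRingType) (x y : 'cV[int]_N) :
  bil S (intv F x) (intv F y) = (bl S x y)%:~R.
Proof. exact: (bl_map intr S x y). Qed.

End IntegralForms.

Lemma coprimez_bez (c d : int) : coprimez c d -> bez_a c d * d - bez_b c d * c = 1.
Proof.
move=> cd; rewrite /bez_a /bez_b; case: (egcdzP c d) => u v uv _ /=.
rewrite mulNr opprK addrC [LHS]uv; apply/eqP; exact: cd.
Qed.

Lemma coprimez_of_bez (a b c d : int) : a * d - b * c = 1 -> coprimez c d.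
Proof.
move=> h; apply/coprimezP; exists (- b, a) => /=; rewrite -h; ring.
Qed.

Section Eis.
Variables (R : realType) (N : nat) (S : 'M[int]_N) (k m : nat).
Hypotheses (hS : even_lattice R S) (hm : (0 < m)%N).
Local Notation Cm := (map_mx (real_complex R)).

Lemma symS : S^T = S. Proof. by case: hS. Qed.
Lemma evS i : (2 %| S i i)%Z. Proof. by case: hS. Qed.

Definition SR : 'M[R]_N := map_mx intr S.

Lemma symSR : SR^T = SR.
Proof. by apply/matrixP => i j; rewrite !mxE -[in LHS]symS mxE. Qed.

Lemma posSR : posdef SR.
Proof. by case: hS. Qed.

Lemma SC_sym : (map_mx intr S : 'M[R[i]]_N)^T = map_mx intr S.
Proof. by apply/matrixP => i j; rewrite !mxE -[in LHS]symS mxE. Qed.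

Lemma SCE : map_mx intr S = Cm SR.
Proof. by apply/matrixP => i j; rewrite !mxE intC. Qed.

Lemma bilE (x y : 'cV[R[i]]_N) : bil S x y = bl (Cm SR) x y.
Proof. by rewrite -SCE. Qed.

Lemma bil_even (x : 'cV[int]_N) : exists e : int,
  bil S (intv R[i] x) (intv R[i] x) = 2 * e%:~R.
Proof.
have [e eE] := bl_even symS evS x; exists e.
by rewrite bil_intv eE intrM.
Qed.

(** The summand with a free upper row [(a, b)]: reindexing produces products of matrices, whose
    upper rows differ from the Bezout choice in [eis_term]. *)
Definition eisT (c d a b : int) (x : 'cV[int]_N) (tau : R[i]) (z : 'cV[R[i]]_N) : R[i] :=
  let j := c%:~R * tau + d%:~R in
  let x' := intv R[i] x in
  j ^- k * cexp (ipi R * m%:R *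
    ((bil S x' x' * (a%:~R * tau + b%:~R) + 2 * bil S x' z - c%:~R * bil S z z) / j)).

Lemma eis_termE tau z (p : int * int * 'cV[int]_N) :
  eis_term S k m tau z p =
  eisT p.1.1 p.1.2 (bez_a p.1.1 p.1.2) (bez_b p.1.1 p.1.2) p.2 tau z.
Proof. by []. Qed.

Lemma jfac_neq0 (c d a b : int) (tau : R[i]) : 0 < complex.Im tau -> a * d - b * c = 1 ->
  c%:~R * tau + d%:~R != 0.
Proof.
move=> t0 h; apply/negP => /eqP e.
have := congr1 (@complex.Im R) e; rewrite ImD (intC R c) (intC R d) ImMC /= addr0 => /eqP.
rewrite mulf_eq0 (gt_eqF t0) orbF intr_eq0 => /eqP c0.
move: e; rewrite c0 mul0r add0r => /eqP; rewrite intr_eq0 => /eqP d0.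
by move: h; rewrite c0 d0 !mulr0 subrr.
Qed.

Lemma cexp_ipi_even (X Y : R[i]) (e : int) : X = Y + 2 * e%:~R ->
  cexp (ipi R * m%:R * X) = cexp (ipi R * m%:R * Y).
Proof.
move=> ->; rewrite (_ : _ * (_ + _) = ipi R * m%:R * Y + 2 * ipi R * (m%:Z * e)%:~R) ?cexpDint //.
by rewrite intrM -pmulrn; ring.
Qed.

(** Two upper rows differ by an integral multiple [t] of the lower row, which adds [t (x, x)], an
    even integer, to the bracket in the exponent. *)
Lemma eisT_indep c d a b a' b' x tau z : 0 < complex.Im tau ->
  a * d - b * c = 1 -> a' * d - b' * c = 1 ->
  eisT c d a b x tau z = eisT c d a' b' x tau z.
Proof.
move=> t0 h h'; have j0 := jfac_neq0 t0 h.
have [e eE] := bil_even x.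
pose t := a' * b - a * b'.
have ea : a = a' + t * c.
  have : a * (1 - (a' * d - b' * c)) - a' * (1 - (a * d - b * c)) = 0 by rewrite h h' subrr !mulr0 subrr.
  move=> e0; apply/eqP; rewrite -subr_eq0 -e0; apply/eqP; rewrite /t; ring.
have eb : b = b' + t * d.
  have : b * (1 - (a' * d - b' * c)) - b' * (1 - (a * d - b * c)) = 0 by rewrite h h' subrr !mulr0 subrr.
  move=> e0; apply/eqP; rewrite -subr_eq0 -e0; apply/eqP; rewrite /t; ring.
rewrite /eisT; congr (_ * _); apply: (@cexp_ipi_even _ _ (e * t)).
rewrite eE {1}ea {1}eb !intrD !intrM; field.
exact: j0.
Qed.

Definition eisF tau z (p : int * int * 'cV[int]_N) : R[i] :=
  if coprimez p.1.1 p.1.2 then eis_term S k m tau z p else 0.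

Lemma mem_eis_index (p : int * int * 'cV[int]_N) :
  (p \in eis_index N) = coprimez p.1.1 p.1.2.
Proof. by apply/idP/idP; rewrite inE. Qed.

Lemma eis_csum tau z s : hsum (eisF tau z) s ->
  csummable (eis_index N) (eis_term S k m tau z) /\
  csum (eis_index N) (eis_term S k m tau z) = s.
Proof.
by move=> hs; apply: hsum_csum; apply: eq_hsum hs => p; rewrite mem_eis_index.
Qed.

Lemma ReV (x : R[i]) : complex.Re x^-1 = complex.Re x / normc x ^+ 2.
Proof. by rewrite normc_sqr; case: x. Qed.

Lemma ImV (x : R[i]) : complex.Im x^-1 = - complex.Im x / normc x ^+ 2.
Proof. by rewrite normc_sqr; case: x => a b; rewrite /= mulNr. Qed.

Definition vRe (z : 'cV[R[i]]_N) : 'cV[R]_N := map_mx (@complex.Re R) z.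
Definition vIm (z : 'cV[R[i]]_N) : 'cV[R]_N := map_mx (@complex.Im R) z.

Lemma vReIm z : z = Cm (vRe z) + 'i *: Cm (vIm z).
Proof. by apply/matrixP => i j; rewrite !mxE -complexE. Qed.

(** In modulus the summand is a Gaussian in [x] around the real point [- u], of inverse width
    [eta / n ^ 2], the imaginary part of the image of [tau]. *)
Lemma normc_eisT c d a b x (tau : R[i]) (z : 'cV[R[i]]_N) :
  0 < complex.Im tau -> a * d - b * c = 1 ->
  let eta := complex.Im tau in
  let n := normc (c%:~R * tau + d%:~R) in
  let u := ((c%:~R * complex.Re tau + d%:~R) / eta) *: vIm z - c%:~R *: vRe z in
  normc (eisT c d a b x tau z) = n ^- k *
    expR (pi * m%:R * (bl SR (vIm z) (vIm z) / eta - eta / n ^+ 2 * bl SR (intv R x + u) (intv R x + u))).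
Proof.
move=> t0 h eta n u; have j0 := jfac_neq0 t0 h; set j := c%:~R * tau + d%:~R in j0 n *.
have n0 : 0 < n by rewrite normc_gt0.
rewrite /eisT -/j normcM normcV normcX -/n; congr (_ * _); rewrite normc_cexp; congr expR.
set p := vRe z; set v := vIm z; set X := intv R x.
pose xx := bl SR X X; pose xp := bl SR X p; pose xv := bl SR X v.
pose pp := bl SR p p; pose pv := bl SR p v; pose vv := bl SR v v.
have e1 : bil S (intv R[i] x) (intv R[i] x) = xx%:C by rewrite bilE intvC bl_map.
have e2 : bil S (intv R[i] x) z = xp%:C + 'i * xv%:C.
  by rewrite bilE intvC {1}(vReIm z) blDr blZr !bl_map.
have e3 : bil S z z = pp%:C - vv%:C + 2 * 'i * pv%:C.
  have sy : (Cm SR)^T = Cm SR by rewrite -SCE SC_sym.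
  rewrite bilE {1 2}(vReIm z) bl_sqrD // !blZr blZl !bl_map -/pp -/vv -/pv [X in _ + X]mulrA sqr_i'; ring.
rewrite e1 e2 e3; set W := (X in X / j).
have jr : complex.Re j = c%:~R * complex.Re tau + d%:~R by rewrite ReD (intC R c) ReMC (intC R d).
have ji : complex.Im j = c%:~R * eta by rewrite ImD (intC R c) ImMC (intC R d) /= addr0.
have Wr : complex.Re W = xx * (a%:~R * complex.Re tau + b%:~R) + 2 * xp - c%:~R * (pp - vv).
  rewrite /W !ReD !ReN (intC R a) (intC R b) (intC R c) !ReM !ReD !ImD ?ReN ?ImN !ReM !ImM /=; ring.
have Wi : complex.Im W = xx * (a%:~R * eta) + 2 * xv - c%:~R * (2 * pv).
  rewrite /W !ImD !ImN (intC R a) (intC R b) (intC R c) !ImM !ReD !ImD ?ReN ?ImN !ReM !ImM /=; ring.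
have -> : complex.Re (ipi R * m%:R * (W / j)) = - (pi * m%:R * complex.Im (W / j)).
  rewrite (natC R m) !ReM !ImM /=; ring.
rewrite ImM ReV ImV -/n Wr Wi jr ji.
have hR : (a%:~R * d%:~R - b%:~R * c%:~R = 1 :> R) by rewrite -!intrM -intrB h.
have bE : bl SR (X + u) (X + u) = xx + 2 * ((c%:~R * complex.Re tau + d%:~R) / eta * xv - c%:~R * xp)
   + (((c%:~R * complex.Re tau + d%:~R) / eta) ^+ 2 * vv
      - 2 * ((c%:~R * complex.Re tau + d%:~R) / eta) * c%:~R * pv + c%:~R ^+ 2 * pp).
  rewrite bl_sqrD ?symSR // /u !(blDl, blDr, blNl, blNr, blZl, blZr).
  by rewrite -/xx -/xv -/xp -/vv -/pp -/pv (bl_sym v p symSR) -/pv; ring.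
have nE : n ^+ 2 = (c%:~R * complex.Re tau + d%:~R) ^+ 2 + (c%:~R * eta) ^+ 2.
  by rewrite /n normc_sqr jr ji.
have et0 : eta != 0 by rewrite gt_eqF.
have nn0 : n ^+ 2 != 0 by rewrite expf_neq0 // gt_eqF.
have hR' : b%:~R * c%:~R = a%:~R * d%:~R - 1 :> R.
  by move: (a%:~R * d%:~R) (b%:~R * c%:~R) hR => P Q hh; rewrite -hh; ring.
rewrite bE -[LHS]mulrN; congr (_ * _); apply: (mulIf nn0).
rewrite -/eta in jr ji *; set xi := complex.Re tau.
have -> : (vv / eta - eta / n ^+ 2 * (xx + 2 * ((c%:~R * xi + d%:~R) / eta * xv - c%:~R * xp) +
   (((c%:~R * xi + d%:~R) / eta) ^+ 2 * vv - 2 * ((c%:~R * xi + d%:~R) / eta) * c%:~R * pv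
     + c%:~R ^+ 2 * pp))) * n ^+ 2 =
   vv * n ^+ 2 / eta - (eta * xx + 2 * ((c%:~R * xi + d%:~R) * xv - eta * c%:~R * xp) +
   ((c%:~R * xi + d%:~R) ^+ 2 / eta * vv - 2 * (c%:~R * xi + d%:~R) * c%:~R * pv
     + eta * c%:~R ^+ 2 * pp)).
  by move: (n ^+ 2) nn0 => n2 n20; field; rewrite et0 n20.
have -> : - ((xx * (a%:~R * xi + b%:~R) + 2 * xp - c%:~R * (pp - vv)) * (- (c%:~R * eta) / n ^+ 2) +
   (xx * (a%:~R * eta) + 2 * xv - c%:~R * (2 * pv)) * ((c%:~R * xi + d%:~R) / n ^+ 2)) * n ^+ 2 =
   (xx * (a%:~R * xi + b%:~R) + 2 * xp - c%:~R * (pp - vv)) * (c%:~R * eta) -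
   (xx * (a%:~R * eta) + 2 * xv - c%:~R * (2 * pv)) * (c%:~R * xi + d%:~R).
  by move: (n ^+ 2) nn0 => n2 n20; field.
rewrite nE.
have -> : (xx * (a%:~R * xi + b%:~R) + 2 * xp - c%:~R * (pp - vv)) * (c%:~R * eta) =
  xx * (a%:~R * xi * (c%:~R * eta) + (b%:~R * c%:~R) * eta) + (2 * xp - c%:~R * (pp - vv)) * (c%:~R * eta) by ring.
by rewrite hR'; field.
Qed.

Lemma shiftN_bound (e : R) (b : nat) (u : 'cV[R]_N) : (0 < b)%N -> 1 <= e * b%:R ^+ 2 ->
  sbound (fun x : 'cV[int]_N => expR (- (e * \sum_i ((x i 0)%:~R + u i 0) ^+ 2))) ((24 * b%:R) ^+ N).
Proof.
move=> b0 eb.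
have := @sbound_vec R N (fun i n => expR (- (e * (n%:~R + u i 0) ^+ 2))) (24 * b%:R).
move=> /(_ _ _)/sbound_le; apply=> [x|i n|i].
- by rewrite -expR_sum sumrN mulr_sumr.
- exact: expR_ge0.
- exact: gauss_shift.
Qed.

Lemma int_sqr_ge1 (c d : int) : coprimez c d -> 1 <= (c%:~R : R) ^+ 2 + d%:~R ^+ 2.
Proof.
move=> cd; rewrite -!rmorphXn -rmorphD /= -[1]/(1%:~R) ler_int.
have : (c, d) != (0, 0) by apply: contraTneq cd => -[-> ->].
rewrite xpair_eqE; nia.
Qed.

(** The Gaussian in [x] has width proportional to [n = |c tau + d|] and total mass of order [n ^ N],
    uniformly in its centre. The remaining [n ^ (N - k)] is at most of order [n ^ -4], which is
    dominated by a product of functions of [c] and [d]. *)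
Lemma eisF_asum (tau : R[i]) z : (N + 4 <= k)%N -> 0 < complex.Im tau -> asum (eisF tau z).
Proof.
move=> hk t0; have pp := pi_gt0 R; have mp : 0 < (m%:R : R) by rewrite ltr0n.
have [e e0 he] := posdef_lower symSR posSR.
have [de de0 hde] := lat_lower t0.
pose eta := complex.Im tau.
pose th : R := pi * m%:R * eta * e.
have th0 : 0 < th by rewrite /th !mulr_gt0.
(* Chosen so that [th * s ^ 2 >= 1] without taking a root. *)
pose s : R := 1 + th^-1.
have s0 : 0 < s by rewrite ltr_wpDr // invr_ge0 ltW.
pose nn (c d : int) := normc (c%:~R * tau + d%:~R).
have nlow c d : coprimez c d -> de <= nn c d ^+ 2.
  move=> cd; apply: le_trans (_ : de * (c%:~R ^+ 2 + d%:~R ^+ 2) <= _).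
    by rewrite ler_peMr ?(ltW de0) // int_sqr_ge1.
  by have := hde c%:~R d%:~R; rewrite -!intC.
pose C0 := expR (pi * m%:R * (bl SR (vIm z) (vIm z) / eta)) : R.
pose d1 : R := Num.sqrt de; have d10 : 0 < d1 by rewrite sqrtr_gt0.
have nlow1 c d : coprimez c d -> d1 <= nn c d.
  move=> /nlow h; rewrite -[nn c d](ger0_norm (normc_ge0 (c%:~R * tau + d%:~R))) -sqrtr_sqr.
  exact: ler_wsqrtr.
pose A : R := 24 * (s + d1^-1); have A0 : 0 < A by rewrite mulr_gt0 // addr_gt0 // invr_gt0.
pose C1 := C0 * (A ^+ N * (d1 ^- (k - (N + 4)) * (4 / de ^+ 2))).
have C10 : 0 <= C1.
  by rewrite /C1 !mulr_ge0 ?expR_ge0 ?exprn_ge0 ?invr_ge0 ?exprn_ge0 ?(ltW A0) ?(ltW d10) ?(ltW de0).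
have inner c d : coprimez c d -> sbound (fun x => normc (eisF tau z (c, d, x)))
    (C1 * ((1 + c%:~R ^+ 2)^-1 * (1 + d%:~R ^+ 2)^-1)).
  move=> cd; have hb := coprimez_bez cd; have n0 := lt_le_trans d10 (nlow1 c d cd).
  (* A width proportional to [n] up to rounding, large enough for [shiftN_bound]. *)
  set n := nn c d in n0; pose b := (Num.truncn (n * s)).+1.
  have ns0 : 0 <= n * s by rewrite mulr_ge0 // ltW.
  have /andP[b1 b2] := truncn_itv ns0.
  have bp : (0 < b)%N by [].
  have bup : (b%:R : R) <= n * (s + d1^-1).
    have -> : b%:R = (Num.truncn (n * s))%:R + 1 :> R by rewrite natr1.
    rewrite [leRHS]mulrDr; apply: lerD b1 _.
    by rewrite ler_pdivlMr // mul1r; exact: nlow1.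
  have thb : 1 <= th / n ^+ 2 * b%:R ^+ 2.
    rewrite mulrAC ler_pdivlMr ?exprn_gt0 // mul1r.
    have h1 : (n * s) ^+ 2 <= b%:R ^+ 2.
      by apply: lerXn2r; rewrite ?nnegrE // ltW.
    have h2 : n ^+ 2 <= th * (n * s) ^+ 2.
      have : 1 <= th * s ^+ 2.
        have -> : th * s ^+ 2 = th + 2 + th^-1 by rewrite /s; field; rewrite gt_eqF.
        have : 0 < th^-1 by rewrite invr_gt0.
        lra.
      by move=> h3; rewrite exprMn mulrCA ler_peMr // exprn_ge0 // ltW.
    by apply: le_trans h2 _; rewrite ler_wpM2l // ltW.
  pose u := ((c%:~R * complex.Re tau + d%:~R) / eta) *: vIm z - c%:~R *: vRe z.
  have c2 : 0 <= n ^- k * C0 by rewrite mulr_ge0 ?expR_ge0 // invr_ge0 exprn_ge0 // ltW.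
  apply: sbound_leM (sbound_le _ (sboundZ c2 (shiftN_bound u bp thb))); last first.
    move=> x; rewrite /eisF /= cd eis_termE normc_eisT // -/eta -/u -[normc _]/n /=.
    rewrite -[leRHS]mulrA; apply: ler_wpM2l; first by rewrite invr_ge0 exprn_ge0 // ltW.
    rewrite /C0 -expRD ler_expR [leLHS]mulrBr lerD2l lerN2.
    have := he (intv R x + u).
    have -> : \sum_i (intv R x + u) i 0 ^+ 2 = \sum_i ((x i 0)%:~R + u i 0) ^+ 2.
      by apply: eq_bigr => i _; rewrite mxE mxE.
    move: (\sum_i _) (bl SR _ _) => s1 s2 h1.
    rewrite (_ : th / n ^+ 2 * s1 = pi * m%:R * (eta / n ^+ 2 * (e * s1))); last by rewrite /th; ring.
    rewrite ler_wpM2l ?mulr_ge0 ?(ltW pp) // ler_wpM2l // divr_ge0 ?exprn_ge0 ?(ltW t0) ?(ltW n0) //.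
  rewrite -[leLHS]mulrA [leLHS]mulrCA /C1 -[leRHS]mulrA.
  apply: ler_wpM2l; first exact: expR_ge0.
  have h1 : (24 * b%:R) ^+ N <= A ^+ N * n ^+ N.
    have hA : 24 * b%:R <= A * n by rewrite /A -[leRHS]mulrA ler_wpM2l // [leRHS]mulrC.
    have b24 : 0 <= 24 * b%:R :> R by rewrite mulr_ge0.
    rewrite -exprMn; apply: lerXn2r; [exact: b24|exact: le_trans b24 hA|exact: hA].
  apply: le_trans (ler_wpM2l _ h1) _; first by rewrite invr_ge0 exprn_ge0 // ltW.
  rewrite [leLHS]mulrCA -[leRHS]mulrA; apply: ler_wpM2l; first by rewrite exprn_ge0 // ltW.
  rewrite -[leRHS]mulrA.
  (* The excess power is bounded through the minimum [d1] of [|c tau + d|]; exactly four powers are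
     kept. *)
  have -> : n ^- k * n ^+ N = n ^- (k - (N + 4)) * n ^- 4.
    rewrite -{1}(subnK hk) !exprD; field; rewrite !expf_neq0 ?gt_eqF //.
  apply: ler_pM; rewrite ?invr_ge0 ?exprn_ge0 ?(ltW n0) //.
    rewrite lef_pV2 ?posrE ?exprn_gt0 //; apply: lerXn2r; rewrite ?nnegrE ?(ltW d10) ?(ltW n0) //.
    exact: nlow1.
  have h2 : de * (c%:~R ^+ 2 + d%:~R ^+ 2) <= n ^+ 2 by have := hde c%:~R d%:~R; rewrite -!intC.
  have h3 := int_sqr_ge1 cd.
  move: (c%:~R ^+ 2 : R) (d%:~R ^+ 2 : R) (sqr_ge0 (c%:~R : R)) (sqr_ge0 (d%:~R : R)) h2 h3 => x y x0 y0 h2 h3.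
  have x1 : 0 < 1 + x by rewrite ltr_wpDr.
  have y1 : 0 < 1 + y by rewrite ltr_wpDr.
  rewrite -invfM -mulrA -invfM -[n ^- 4]mul1r ler_pdivlMr ?mulr_gt0 ?exprn_gt0 //.
  rewrite mulrAC ler_pdivrMr ?exprn_gt0 // mul1r.
  (* With [x + y >= 1] one has [(1 + x) (1 + y) <= 4 (x + y) ^ 2], the origin of the factor 4 in
     [C1]. *)
  have h4 : (de * (x + y)) ^+ 2 <= n ^+ 4.
    rewrite (_ : n ^+ 4 = (n ^+ 2) ^+ 2); last by rewrite -exprM.
    by apply: lerXn2r; rewrite ?nnegrE ?exprn_ge0 ?mulr_ge0 ?addr_ge0 ?(ltW n0) ?(ltW de0).
  apply: le_trans (_ : 4 * (de * (x + y)) ^+ 2 <= _); last by rewrite ler_wpM2l.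
  rewrite exprMn [leRHS]mulrCA; apply: ler_wpM2l; first by rewrite exprn_ge0 // ltW.
  nra.
pose T (q : int * int) := C1 * ((1 + q.1%:~R ^+ 2)^-1 * (1 + q.2%:~R ^+ 2)^-1).
have T0 q : 0 <= T q by rewrite /T; nneg.
exists (C1 * (8 * 8)).
apply: (@sbound_pair R _ _ (fun p : int * int * 'cV[int]_N => normc (eisF tau z p)) T).
- by move=> p; exact: normc_ge0.
- move=> [c d]; case: (boolP (coprimez c d)) => cd; first exact: inner.
  move=> r ur; rewrite big1 // => x _; by rewrite /eisF /= (negbTE cd) normc0.
- have i0 (n : int) : 0 <= (1 + (n%:~R : R) ^+ 2)^-1 by nneg.
  exact: (sboundZ C10 (sbound_prod i0 i0 (inv1sq_int R) (inv1sq_int R))).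
Qed.

Lemma eis_hsum (tau : R[i]) z : (N + 4 <= k)%N -> 0 < complex.Im tau ->
  hsum (eisF tau z) (2 * eisenstein S k m tau z) /\
  csummable (eis_index N) (eis_term S k m tau z).
Proof.
move=> hk t0; have [s hs] := asum_hsum (eisF_asum z hk t0).
have [cs es] := eis_csum hs; split=> //.
by rewrite /eisenstein es mulrA mulfV ?mul1r // pnatr_eq0.
Qed.

Lemma coprimez_SL2 (a b c d c0 d0 : int) : a * d - b * c = 1 -> coprimez c0 d0 ->
  coprimez (c0 * a + d0 * c) (c0 * b + d0 * d).
Proof.
move=> h /coprimez_bez h0; set u := bez_a c0 d0 in h0; set v := bez_b c0 d0 in h0.
apply: (@coprimez_of_bez (u * a + v * c) (u * b + v * d)).
have -> : (u * a + v * c) * (c0 * b + d0 * d) - (u * b + v * d) * (c0 * a + d0 * c)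
  = (u * d0 - v * c0) * (a * d - b * c) by ring.
by rewrite h h0.
Qed.

Lemma Im_moebius (a b c d : int) (tau : R[i]) : 0 < complex.Im tau -> a * d - b * c = 1 ->
  0 < complex.Im ((a%:~R * tau + b%:~R) / (c%:~R * tau + d%:~R)).
Proof.
move=> t0 h; have j0 := jfac_neq0 t0 h; rewrite ImM ReV ImV.
have n0 : 0 < normc (c%:~R * tau + d%:~R) ^+ 2 by rewrite exprn_gt0 // normc_gt0.
rewrite !ReD !ImD (intC R a) (intC R b) (intC R c) (intC R d) !ReMC !ImMC !ReC !ImC.
set n := normc _ ^+ 2 in n0 *.
have hR : (a%:~R * d%:~R - b%:~R * c%:~R = 1 :> R) by rewrite -!intrM -intrB h.
rewrite !addr0 !mulrA -mulrDl divr_gt0 //; last by rewrite -!intC.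
move: (a%:~R : R) (b%:~R : R) (c%:~R : R) (d%:~R : R) hR => a' b' c' d' hR.
have -> : (a' * complex.Re tau + b') * (- (c' * complex.Im tau)) +
   a' * complex.Im tau * (c' * complex.Re tau + d') = (a' * d' - b' * c') * complex.Im tau by ring.
by rewrite hR mul1r.
Qed.

(** The cocycle relation of the automorphy factor: the slash action multiplies the matrix of the
    summand on the right. *)
Lemma eisT_SL2 (c d a b a0 b0 c0 d0 : int) x tau z : 0 < complex.Im tau ->
  a * d - b * c = 1 -> a0 * d0 - b0 * c0 = 1 ->
  let j0 := c0%:~R * tau + d0%:~R in
  j0 ^- k * cexp (- (ipi R * m%:R * (c0%:~R * bil S z z / j0))) *
    eisT c d a b x ((a0%:~R * tau + b0%:~R) / j0) (j0^-1 *: z) =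
  eisT (c * a0 + d * c0) (c * b0 + d * d0) (a * a0 + b * c0) (a * b0 + b * d0) x tau z.
Proof.
move=> t0 h h0 j0; have j0n : j0 != 0 := jfac_neq0 t0 h0.
have h' : (a * a0 + b * c0) * (c * b0 + d * d0) - (a * b0 + b * d0) * (c * a0 + d * c0) = 1.
  by rewrite -[RHS]mulr1 -{1}h -h0; ring.
rewrite /eisT; set j' := (c * a0 + d * c0)%:~R * tau + _.
have j'n : j' != 0 := jfac_neq0 t0 h'.
have e1 : c%:~R * ((a0%:~R * tau + b0%:~R) / j0) + d%:~R = j' / j0.
  apply: (mulIf j0n); rewrite [RHS]divfK // mulrDl -mulrA divfK // /j' /j0 !intrD !intrM; ring.
have e2 : a%:~R * ((a0%:~R * tau + b0%:~R) / j0) + b%:~R =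
    ((a * a0 + b * c0)%:~R * tau + (a * b0 + b * d0)%:~R) / j0.
  apply: (mulIf j0n); rewrite [RHS]divfK // mulrDl -mulrA divfK // /j0 !intrD !intrM; ring.
(* This identity merges the two terms quadratic in [z] into one. *)
have e3 : c%:~R = (c * a0 + d * c0)%:~R * j0 - c0%:~R * j' :> R[i].
  rewrite /j0 /j' -[in LHS](mulr1 c) -h0 !(intrD, intrM, intrB); ring.
rewrite e1 e2; set P := _%:~R * tau + _%:~R; set c' := (c * a0 + d * c0)%:~R in e3 *.
have -> : bil S (j0^-1 *: z) (j0^-1 *: z) = j0^-1 * (j0^-1 * bil S z z).
  by rewrite -[LHS]/(bl _ _ _) blZl blZr.
have -> : bil S (intv R[i] x) (j0^-1 *: z) = j0^-1 * bil S (intv R[i] x) z.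
  by rewrite -[LHS]/(bl _ _ _) blZr.
rewrite e3 mulrACA -cexpD expr_div_n; congr (_ * cexp _).
  move: (j0 ^+ k) (j' ^+ k) (expf_neq0 k j0n) (expf_neq0 k j'n) => u v un vn.
  by field; rewrite un vn.
move: (bil S z z) (bil S _ z) (bil S _ _) (ipi R) {e1 e2 e3} => zz xz xx ip.
by field; rewrite j0n j'n.
Qed.

(** Right multiplication by [M] permutes the coprime rows. *)
Lemma eis_SL2 (M : 'M[int]_2) (tau : R[i]) (z : 'cV[R[i]]_N) : (N + 4 <= k)%N -> \det M = 1 -> 0 < complex.Im tau ->
  slash_SL2 S k m M (eisenstein S k m) tau z = eisenstein S k m tau z.
Proof.
move=> hk; rewrite (expand_det_row _ 0) !big_ord_recl big_ord0 addr0 /cofactor !det_mx11 !mxE /=.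
rewrite expr0 mul1r expr1 mulN1r mulrN.
rewrite (_ : lift 0 0 = 1 :> 'I_2); last exact: val_inj.
rewrite (_ : lift 1 0 = 0 :> 'I_2); last exact: val_inj.
rewrite /slash_SL2; move: (M 0 0) (M 0 1) (M 1 0) (M 1 1) => a0 b0 c0 d0 h0 t0.
have j0n := jfac_neq0 t0 h0; have t1 := Im_moebius t0 h0.
set j0 := c0%:~R * tau + d0%:~R in j0n t1 *; set tau1 := (_ / j0) in t1 *.
have [hs1 _] := eis_hsum (j0^-1 *: z) hk t1; have [hs _] := eis_hsum z hk t0.
pose h (p : int * int * 'cV[int]_N) :=
  ((p.1.1 * a0 + p.1.2 * c0, p.1.1 * b0 + p.1.2 * d0), p.2).
pose h' (p : int * int * 'cV[int]_N) :=
  ((p.1.1 * d0 - p.1.2 * c0, - p.1.1 * b0 + p.1.2 * a0), p.2).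
have hK : cancel h h'.
  move=> [[c d] x]; rewrite /h /h' /=; congr (_, _, _).
    by rewrite -[RHS]mulr1 -h0; ring.
  by rewrite -[RHS]mulr1 -h0; ring.
have hK' : cancel h' h.
  move=> [[c d] x]; rewrite /h /h' /=; congr (_, _, _).
    by rewrite -[RHS]mulr1 -h0; ring.
  by rewrite -[RHS]mulr1 -h0; ring.
apply: (@mulfI _ 2); first by rewrite pnatr_eq0.
rewrite mulrCA; apply: (hsum_uniq _ hs).
apply/(hsum_reindex (h := h) _ (can_inj hK)) => [p _|]; first by exists (h' p).
apply: eq_hsum (hsumZ _ hs1) => -[[c d] x]; rewrite /eisF /h /=.
case: (boolP (coprimez c d)) => cd.
  have hb := coprimez_bez cd; rewrite coprimez_SL2 // !eis_termE /= /j0 eisT_SL2 //.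
  apply: eisT_indep => //; last by apply/coprimez_bez/coprimez_SL2.
  rewrite -[RHS]mulr1 -{1}hb -h0; ring.
case: ifP => [cd'|_]; last by rewrite mulr0.
have h1 : d0 * a0 - (- b0) * (- c0) = 1 by rewrite -h0; ring.
have := coprimez_SL2 h1 cd'.
rewrite (_ : _ + _ = c); last by rewrite -[RHS]mulr1 -h0; ring.
rewrite (_ : _ + _ = d); last by rewrite -[RHS]mulr1 -h0; ring.
by rewrite (negbTE cd).
Qed.

Lemma intvD (x y : 'cV[int]_N) : intv R[i] (x + y) = intv R[i] x + intv R[i] y.
Proof. exact: map_mxD. Qed.

Lemma intvZ (a : int) (x : 'cV[int]_N) : intv R[i] (a *: x) = a%:~R *: intv R[i] x.
Proof. exact: map_mxZ. Qed.

(** Conjugated through the matrix, a translation by [(la, mu)] becomes the shift of [x] by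
    [d la - c mu]; the brackets in the exponents differ by an even integer. *)
Lemma eisT_heis (c d a b : int) x (la mu : 'cV[int]_N) tau z : 0 < complex.Im tau ->
  a * d - b * c = 1 ->
  cexp (ipi R * m%:R * (bil S (intv R[i] la) (intv R[i] la) * tau + 2 * bil S (intv R[i] la) z)) *
    eisT c d a b x tau (z + tau *: intv R[i] la + intv R[i] mu) =
  eisT c d a b (x + (d *: la + (- c) *: mu)) tau z.
Proof.
move=> t0 h; have jn := jfac_neq0 t0 h.
have hC : a%:~R * d%:~R - b%:~R * c%:~R = 1 :> R[i] by rewrite -!intrM -intrB h.
have [e1 e1E] := bil_even la; have [e2 e2E] := bil_even mu.
rewrite /eisT mulrCA -cexpD; congr (_ * _).
rewrite !intvD !intvZ mulrNz -mulrDr.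
apply/esym; apply: (@cexp_ipi_even _ _ (b * bl S x la - a * bl S x mu + b * d * e1 - b * c * bl S la mu + a * c * e2)).
rewrite !(intrD, intrM, mulrNz) -!(bil_intv _ R[i]).
have eS := SC_sym.
set X := intv R[i] x; set L := intv R[i] la; set U := intv R[i] mu.
rewrite -![bil S _ _]/(bl (map_mx intr S) _ _) in e1E e2E *.
rewrite !(blDl, blDr, blZl, blZr) (bl_sym z L eS) (bl_sym z U eS) (bl_sym U L eS).
rewrite (bl_sym L X eS) (bl_sym U X eS) e1E e2E.
set A := map_mx intr S.
move: (bl A X X) (bl A X L) (bl A X U) (bl A L U) (bl A L z) (bl A U z) (bl A X z) (bl A z z) => XX XL XU LU Lz Uz Xz zz.
set E1 := e1%:~R; set E2 := e2%:~R.
move: hC jn.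
move: (a%:~R : R[i]) (b%:~R : R[i]) (c%:~R : R[i]) (d%:~R : R[i]) => a' b' c' d' hC jn.
apply: (mulIf jn); rewrite [LHS]divfK // [RHS]mulrDl [X in _ = X + _]mulrDl divfK //.
apply/eqP; rewrite -subr_eq0; apply/eqP.
(* The discrepancy is a multiple of [a d - b c - 1]. *)
transitivity ((a' * d' - b' * c' - 1) * (2 * tau * XL + 2 * XU + 2 * d' * tau * E1 - 2 * c' * tau * LU - 2 * c' * E2)); last first.
  by rewrite hC subrr mul0r.
ring.
Qed.

Lemma eis_heis (la mu : 'cV[int]_N) (tau : R[i]) (z : 'cV[R[i]]_N) : (N + 4 <= k)%N -> 0 < complex.Im tau ->
  slash_heis S m la mu (eisenstein S k m) tau z = eisenstein S k m tau z.
Proof.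
move=> hk t0; rewrite /slash_heis.
set z1 := z + tau *: intv R[i] la + intv R[i] mu.
have [hs1 _] := eis_hsum z1 hk t0; have [hs _] := eis_hsum z hk t0.
pose h (p : int * int * 'cV[int]_N) := (p.1, p.2 + (p.1.2 *: la + (- p.1.1) *: mu)).
pose h' (p : int * int * 'cV[int]_N) := (p.1, p.2 - (p.1.2 *: la + (- p.1.1) *: mu)).
have hK : cancel h h' by move=> [p x]; rewrite /h /h' /= addrK.
have hK' : cancel h' h by move=> [p x]; rewrite /h /h' /= subrK.
apply: (@mulfI _ 2); first by rewrite pnatr_eq0.
rewrite mulrCA; apply: (hsum_uniq _ hs).
apply/(hsum_reindex (h := h) _ (can_inj hK)) => [p _|]; first by exists (h' p).
apply: eq_hsum (hsumZ _ hs1) => -[[c d] x]; rewrite /eisF /h /=.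
case: (boolP (coprimez c d)) => cd; last by rewrite mulr0.
by rewrite !eis_termE /= eisT_heis //; exact: coprimez_bez.
Qed.

End Eis.

(** * The dual lattice and the transformed inner sums *)

Section SumExtras.
Variables (R : realType) (I : choiceType).

Lemma asum_restr (P : pred I) (f : I -> R[i]) :
  asum f -> asum (fun i => if P i then f i else 0).
Proof.
case=> M hM; exists M; apply: sbound_le hM => i.
by case: ifP => // _; rewrite normc0 normc_ge0.
Qed.

Lemma sbound_fin (K : finType) (g : K -> R) : (forall k, 0 <= g k) ->
  sbound g (\sum_k g k).
Proof.
move=> g0 s us; apply: ler_sum_subseq => // i _; exact: mem_index_enum.
Qed.

(** The principal logarithm on the right half-plane, built from [ln] and [atan]. *)
Lemma cexp_log (t : R[i]) : 0 < complex.Re t ->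
  exists2 ze : R[i], cexp ze = t & `|complex.Im ze| < pi / 2.
Proof.
move=> a0; pose x := complex.Im t / complex.Re t.
have c0 : 0 < cos (atan x) by apply: cos_gt0_pihalf; rewrite atan_gtNpi2 atan_ltpi2.
pose r := complex.Re t / cos (atan x); have r0 : 0 < r by rewrite divr_gt0.
exists (Complex (ln r) (atan x)); last by rewrite ltr_norml atan_gtNpi2 atan_ltpi2.
rewrite /cexp /= lnK ?posrE // /r.
have -> : sin (atan x) = x * cos (atan x).
  by rewrite -{2}(atanK x) /tan divfK // gt_eqF.
rewrite divfK ?gt_eqF // [x * _]mulrC mulrA divfK ?gt_eqF // /x mulrC divfK ?gt_eqF //.
by case: t {a0 x c0 r r0}.
Qed.

End SumExtras.

(** Accounts for the sum over [d' mod m c] in the coefficient, whose summand has period [c]. *)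
Lemma sum_periodic (V : pzRingType) (F : nat -> V) (c m : nat) :
  (forall i, F (c + i)%N = F i) ->
  \sum_(0 <= i < m * c) F i = m%:R * \sum_(0 <= i < c) F i.
Proof.
move=> Fp; elim: m => [|m IH]; first by rewrite mul0n big_geq // mul0r.
have e : \sum_(c <= i < c + m * c) F i = \sum_(0 <= i < m * c) F i.
  rewrite -{1}[c]add0n big_addn addKn; apply: eq_bigr => i _; by rewrite addnC Fp.
by rewrite mulSn (big_cat_nat (n := c)) ?leq_addr //= e IH -natr1 mulrDl mul1r addrC.
Qed.

Section Dual.
Variables (R : realType) (N : nat) (S : 'M[int]_N).
Hypothesis hS : even_lattice R S.
Local Notation SR := (SR R S).
Let SQ : 'M[rat]_N := map_mx intr S.
Let SC : 'M[R[i]]_N := map_mx intr S.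

(** Integral coordinates on the dual lattice, by which all sums over it are indexed. *)
Definition lam (h : 'cV[int]_N) : 'cV[rat]_N := invmx SQ *m intv rat h.

Lemma detS_neq0 : \det S != 0.
Proof.
have := posdef_unit (posSR hS); rewrite unitmxE /SR det_map_mx unitfE intr_eq0.
by [].
Qed.

Lemma unitSQ : SQ \in unitmx.
Proof. by rewrite unitmxE /SQ det_map_mx unitfE intr_eq0 detS_neq0. Qed.

Lemma SQ_lam h : SQ *m lam h = intv rat h.
Proof. by rewrite /lam mulmxA mulmxV ?unitSQ // mul1mx. Qed.

Lemma lam_inj : injective lam.
Proof.
move=> h h' /(congr1 (mulmx SQ)); rewrite !SQ_lam => /matrixP e.
by apply/matrixP => i j; have := e i j; rewrite !mxE => /intr_inj.
Qed.

Lemma dualP (p : 'cV[rat]_N) : dual_lattice S p <-> exists h, lam h = p.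
Proof. by split=> [[h _ <-]|[h <-]]; exists h. Qed.

Definition rho (h : 'cV[int]_N) : rat := bil S (lam h) (lam h).

Lemma rhoE h : rho h = qd SQ (intv rat h).
Proof. by rewrite /rho -[bil _ _ _]/(bl SQ _ _) blE SQ_lam dotC. Qed.

Lemma rho_qd h : ratr (rho h) = qd SR (intv R h).
Proof.
have e1 : SR = map_mx ratr SQ by apply/matrixP => i j; rewrite !mxE ratr_int.
have e2 : intv R h = map_mx ratr (intv rat h) by apply/matrixP => i j; rewrite !mxE ratr_int.
by rewrite rhoE /qd e1 e2 -map_invmx -map_mxM dot_map.
Qed.

Lemma qd_ge0 (h : 'cV[int]_N) : 0 <= qd SR (intv R h).
Proof.
have [e e0 he] := qd_lower (symSR hS) (posSR hS); apply: le_trans (he _).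
by rewrite mulr_ge0 ?(ltW e0) // sumr_ge0 // => i _; exact: sqr_ge0.
Qed.

Lemma rho_ge0 h : 0 <= rho h.
Proof. by rewrite -(ler0q R) rho_qd qd_ge0. Qed.

Lemma lam_bil h (z : 'cV[R[i]]_N) : bil S (ratv R (lam h)) z = dot (intv R[i] h) z.
Proof.
have e1 : SC = map_mx ratr SQ by apply/matrixP => i j; rewrite !mxE ratr_int.
have e2 : intv R[i] h = map_mx ratr (intv rat h) by apply/matrixP => i j; rewrite !mxE ratr_int.
rewrite -[bil _ _ _]/(bl SC _ _) blE dot_mulmx (SC_sym hS) -/SC e1 -map_mxM SQ_lam.
by rewrite e2.
Qed.

Lemma bil_ratv (l : 'cV[rat]_N) : bil S (ratv R l) (ratv R l) = ratr (bil S l l).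
Proof.
have e1 : SC = map_mx ratr SQ by apply/matrixP => i j; rewrite !mxE ratr_int.
by rewrite -[bil S (ratv _ _) _]/(bl SC _ _) e1 bl_map.
Qed.

Lemma ratrC (x : rat) : ratr x = (ratr x : R)%:C.
Proof. by rewrite [RHS]fmorph_rat. Qed.

(** The number [2 |det S|] has the defining property, because [det S * S^-1] is the integral
    adjugate; so a least one exists and [level] does not take its default value. *)
Lemma level_gt0 : (0 < level S)%N.
Proof.
pose P (mu : nat) := (0 < mu)%N /\
    forall p, dual_lattice S p -> exists t : int, mu%:R * bil S p p = (2 * t)%:~R.
have exP : exists mu, `[< P mu >].
  exists (2 * `|\det S|)%N; apply/asboolP; split; first by rewrite muln_gt0 absz_gt0 detS_neq0.
  move=> _ /dualP[h <-]; exists (sgz (\det S) * dot h (\adj S *m h)).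
  have adjE : (\det S)%:~R *: invmx SQ = map_mx intr (\adj S).
    rewrite /invmx unitSQ scalerA /SQ det_map_mx map_mx_adj mulfV ?scale1r //.
    by rewrite intr_eq0 detS_neq0.
  rewrite -/(rho h) rhoE natrM -mulrA.
  have -> : (`|\det S|%N)%:R = (sgz (\det S))%:~R * (\det S)%:~R :> rat.
    by rewrite -intrM -abszEsg -pmulrn.
  rewrite -mulrA !intrM; congr (_ * (_ * _)).
  by rewrite /qd -dotZr scalemxAl adjE -map_mxM dot_map.
have lv : is_level S (ex_minn exP).
  by case: ex_minnP => mu /asboolP h1 h2; split=> // nu h3; apply/h2/asboolP.
rewrite /level; case: xgetP => [q _ [] []//|/(_ (ex_minn exP))]; by [].
Qed.

End Dual.

(** * One residue class: theta transformation, then Lipschitz formula *)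

Section Blocks.
Variables (R : realType) (N : nat) (S : 'M[int]_N) (m j : nat).
Hypotheses (hS : even_lattice R S) (hm : (0 < m)%N) (hN : ~~ odd N) (j0 : (0 < j)%N).
Local Notation SR := (SR R S).

Definition al (h : 'cV[int]_N) : R := qd SR (intv R h) / (2 * m%:R).

Let m0 : 0 < m%:R :> R. Proof. by rewrite ltr0n. Qed.
Let mC : m%:R != 0 :> R[i]. Proof. by rewrite pnatr_eq0 -lt0n. Qed.

(** Provides the rational twist that [lipschitz] asks for. *)
Lemma al_rat h : exists p (Q : nat), (0 < Q)%N /\ al h = p%:~R / Q%:R.
Proof.
pose x : rat := rho S h / (2 * m%:R); exists (numq x), `|denq x|%N.
split; first by rewrite absz_gt0 denq_neq0.
have -> : al h = ratr x by rewrite /al -(rho_qd hS) /x fmorph_div rmorphM /= !ratr_nat.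
have -> : (`|denq x|%N%:R : R) = (denq x)%:~R by rewrite pmulrn absz_denq.
by rewrite -{1}(divq_num_den x) fmorph_div /= !ratr_int.
Qed.

(** A Fourier term without its constant and without the singular series; pairs are ordered as
    [(h, n)], with [lam h] the frequency in [z]. *)
Definition Bt (tau : R[i]) (z : 'cV[R[i]]_N) (p : 'cV[int]_N * int) : R[i] :=
  if al p.1 < p.2%:~R then
    (p.2%:~R - al p.1)%:C ^+ j * (cexp (2 * ipi R * p.2%:~R * tau) * cexp (2 * ipi R * dot (intv R[i] p.1) z))
  else 0.

Lemma pow_expR_inv1sq (c : R) : 0 < c -> exists2 K : R, 0 <= K &
  forall y : R, 0 <= y -> y ^+ j * expR (- (c * y)) <= K * (1 + y ^+ 2)^-1.
Proof.
move=> c0; exists ((j.+1%:R / c) ^+ j + (j.+3%:R / c) ^+ j.+2).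
  by rewrite addr_ge0 // exprn_ge0 // divr_ge0 // ltW.
move=> y y0; have d0 : 0 < 1 + y ^+ 2 by rewrite ltr_wpDr ?sqr_ge0.
rewrite ler_pdivlMr // mulrDr mulr1 mulrAC -exprD addn2.
by apply: lerD; exact: pow_expR_bound.
Qed.

(** The decay [exp (- 2 pi eta n)] is split at [al h]: the part in [n - al h] is summable over [n]
    uniformly in [h], and the rest is the modulus of a dual theta term. *)
Lemma Bt_asum (tau : R[i]) z : 0 < complex.Im tau -> asum (Bt tau z).
Proof.
move=> t0; set eta := complex.Im tau in t0; have pp := pi_gt0 R.
have [K K0 hK] := @pow_expR_inv1sq (2 * pi * eta) (mulr_gt0 (mulr_gt0 (ltr0n R 2) pp) t0).
pose t : R[i] := (m%:R / eta)%:C.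
have t1 : 0 < complex.Re t^-1.
  by rewrite /t -fmorphV ReC invf_div divr_gt0.
have [M hM] := theta_dual_asum z (symSR hS) (posSR hS) t1.
pose D h := normc (theta_dual SR t z h).
exists (K * 24 * M).
apply: (@sbound_pair R _ _ (fun p => normc (Bt tau z p)) (fun h => K * 24 * D h)).
- by move=> p; exact: normc_ge0.
- move=> h; have := @inv1sq_shift R (- al h) 1 isT; rewrite mulr1 => hb.
  have KD : 0 <= K * D h by rewrite mulr_ge0 // normc_ge0.
  rewrite mulrAC; apply: sbound_le (sboundZ KD hb) => l; rewrite divr1 /Bt /=.
  case: ifP => [al_l|_]; last first.
    by rewrite normc0 mulr_ge0 // invr_ge0 addr_ge0 // sqr_ge0.
  have dl : 0 <= l%:~R - al h by rewrite subr_ge0 ltW.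
  rewrite normcM normcX normc_real (ger0_norm dl) normcM.
  have -> : normc (cexp (2 * ipi R * l%:~R * tau)) * normc (cexp (2 * ipi R * dot (intv R[i] h) z)) =
      expR (- (2 * pi * eta * (l%:~R - al h))) * D h.
    rewrite /D /theta_dual cexpD [in RHS]normcM mulrA; congr (_ * _).
    rewrite !normc_cexp -expRD; congr expR.
    rewrite (intC R l) -fmorphV -rmorphM -rmorphM ReN ReC !ReM !ImM /= /al.
    rewrite -/eta; field; rewrite gt_eqF // gt_eqF //.
  by rewrite [leLHS]mulrA [leRHS]mulrAC; apply: ler_wpM2r; [exact: normc_ge0|exact: hK].
- apply: sboundZ; [by rewrite mulr_ge0|exact: hM].
Qed.

Definition lipK : R[i] := (- (2 * ipi R)) ^+ j.+1 / (j`!)%:R.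
Definition thK : R[i] := ('i * m%:R) ^- N./2 / (Num.sqrt (\det SR))%:C.

Lemma half_N2 : N%:R = 2 * (N./2)%:R :> R[i].
Proof. by rewrite -[in LHS](odd_double_half N) (negbTE hN) add0n -mul2n natrM. Qed.

Lemma Re_imt (w : R[i]) : 0 < complex.Im w -> 0 < complex.Re ('i * m%:R / w).
Proof.
move=> w0; have wn : w != 0 by apply: contraTneq w0 => ->; rewrite ltxx.
rewrite (natC R m) !ReM !ImM ReV ImV /=.
have n0 : 0 < normc w ^+ 2 by rewrite exprn_gt0 // normc_gt0.
have -> : (0 * m%:R - 1 * 0) * (complex.Re w / normc w ^+ 2) -
   (0 * 0 + 1 * m%:R) * (- complex.Im w / normc w ^+ 2) = m%:R * (complex.Im w / normc w ^+ 2).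
  by ring.
by rewrite mulr_gt0 // divr_gt0.
Qed.

Lemma theta_dual_imt (w : R[i]) z h : w != 0 ->
  theta_dual SR ('i * m%:R / w) z h =
  cexp (2 * ipi R * (al h)%:C * w) * cexp (2 * ipi R * dot (intv R[i] h) z).
Proof.
move=> wn; rewrite /theta_dual cexpD; congr (cexp _ * _).
rewrite /al ipiE fmorph_div rmorphM /= -!natC.
move: (qd _ _)%:C (pi : R)%:C => Q P.
have i0 : ('i : R[i]) != 0 by rewrite -normc_gt0 normc_i.
have -> : P / ('i * m%:R / w) = - ('i * (P * w / m%:R)).
  apply: (mulIf (x := 'i * m%:R / w)); first by rewrite !mulf_neq0 // invr_eq0.
  rewrite divfK ?mulf_neq0 ?invr_eq0 // mulNr.
  rewrite (_ : 'i * (P * w / m%:R) * ('i * m%:R / w) = ('i * 'i) * P); first by rewrite sqr_i' mulN1r opprK.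
  by move: 'i i0 => ii ii0; field; rewrite mC wn.
move: 'i i0 => ii ii0; field; rewrite mC //.
Qed.

(** Since [N] is even, [exp (- N ze / 2)] is an integral power of [i m / w], and the choice of the
    logarithm disappears. *)
Lemma theta_imt (w : R[i]) z : 0 < complex.Im w ->
  hsum (fun h => thK * (w ^+ N./2 * (cexp (2 * ipi R * (al h)%:C * w) * cexp (2 * ipi R * dot (intv R[i] h) z))))
    (usum (theta_primal SR ('i * m%:R / w) z)).
Proof.
move=> w0; have wn : w != 0 by apply: contraTneq w0 => ->; rewrite ltxx.
have i0 : ('i : R[i]) != 0 by rewrite -normc_gt0 normc_i.
have [ze zeE zeI] := cexp_log (Re_imt w0).
have td0 : 0 < complex.Re ('i * m%:R / w)^-1.
  rewrite ReV divr_gt0 ?Re_imt // exprn_gt0 // normc_gt0 !mulf_neq0 // invr_eq0 //.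
have ts := usumP (theta_dual_asum z (symSR hS) (posSR hS) td0).
have := thetaN z (symSR hS) (posSR hS) zeI; rewrite zeE => ->.
apply: eq_hsum (hsumZ _ ts) => h; rewrite theta_dual_imt // [RHS]mulrA; congr (_ * _).
have -> : cexp (- (N%:R * ze / 2)) = ('i * m%:R / w) ^- N./2.
  by rewrite half_N2 cexpN -zeE -cexpMn; congr (cexp _)^-1; field.
by rewrite /thK expr_div_n invf_div [RHS]mulrC mulrA.
Qed.

Definition thfam (k : nat) (w : R[i]) z (p : int * 'cV[int]_N) : R[i] :=
  (w + p.1%:~R) ^- k * theta_primal SR ('i * m%:R / (w + p.1%:~R)) z p.2.

(** The factor [(w + n) ^ (N / 2)] of the theta transformation lowers the exponent from [k] to
    [j + 1]; after the exchange of sums each [h] is a Lipschitz sum with twist [al h]. *)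
Lemma theta_lip (k : nat) (w : R[i]) z s : k = (N./2 + j.+1)%N -> 0 < complex.Im w ->
  hsum (thfam k w z) s -> s = thK * lipK * usum (Bt w z).
Proof.
move=> kE w0 hs.
have Iw n : complex.Im (w + n%:~R) = complex.Im w by rewrite ImD (intC R n) ImC addr0.
have wn (n : int) : w + n%:~R != 0.
  by apply: contraTneq w0 => e; rewrite -(Iw n) e ltxx.
pose P (n : int) (h : 'cV[int]_N) : R[i] := thK * ((w + n%:~R) ^- j.+1 *
  (cexp (2 * ipi R * (al h)%:C * (w + n%:~R)) * cexp (2 * ipi R * dot (intv R[i] h) z))).
pose t n := (w + n%:~R) ^- k * usum (theta_primal SR ('i * m%:R / (w + n%:~R)) z).
have h1 : hsum t s.
  apply: hsum_pair hs _ => n; rewrite /thfam /=; apply/hsumZ/usumP.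
  by apply: theta_primal_asum (symSR hS) (posSR hS) _; rewrite Re_imt // Iw.
have h2 n : hsum (P n) (t n).
  have w1 : 0 < complex.Im (w + n%:~R) by rewrite Iw.
  apply: eq_hsum (hsumZ _ (theta_imt z w1)) => h; rewrite /P mulrCA; congr (_ * _).
  rewrite [LHS]mulrA; congr (_ * _); rewrite kE exprD invfM mulrAC mulVf ?mul1r //.
  by rewrite expf_neq0.
pose u h := thK * (cexp (2 * ipi R * dot (intv R[i] h) z) * (lipK * usum (fun l => if al h < l%:~R then
   (l%:~R - al h)%:C ^+ j * cexp (2 * ipi R * l%:~R * w) else 0))).
have h3 h : hsum (fun n => P n h) (u h).
  have [p [Q [Q0 alE]]] := al_rat h.
  have [la le] := lipschitz p w0 Q0 j0.
  have := usumP la; rewrite le => hl.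
  have := hsumZ thK (hsumZ (cexp (2 * ipi R * dot (intv R[i] h) z)) hl).
  rewrite /u /lipK alE; apply: eq_hsum => n; rewrite /P alE /lip_prim; congr (_ * _).
  by rewrite mulrC mulrA.
(* The exponentials have moduli independent of [n], so the double family is in modulus a product of
   an untwisted Lipschitz term and a dual theta term. *)
have as0 : asum (fun p : int * 'cV[int]_N => P p.1 p.2).
  have [[M1 hM1] _] := lipschitz 0 w0 (ltn0Sn 0) j0.
  have td0 : 0 < complex.Re ('i * m%:R / w)^-1.
    rewrite ReV divr_gt0 ?Re_imt // exprn_gt0 // normc_gt0 !mulf_neq0 // ?invr_eq0 //.
      by rewrite -normc_gt0 normc_i.
    by have := wn 0; rewrite addr0.
  have [M2 hM2] := theta_dual_asum z (symSR hS) (posSR hS) td0.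
  exists (normc thK * (M1 * M2)).
  apply: sbound_le (sboundZ (normc_ge0 thK) (sbound_prod _ _ hM1 hM2)); last 2 first.
  - by move=> n; exact: normc_ge0.
  - by move=> h; exact: normc_ge0.
  move=> [n h]; rewrite -[leLHS]/(normc (P n h)).
  rewrite -[leRHS]/(normc thK * (normc (lip_prim w 0 1 j n) * normc (theta_dual SR ('i * m%:R / w) z h))).
  rewrite /P normcM ler_wpM2l ?normc_ge0 // /lip_prim mul0r mulr0 mul0r cexp0 mulr1.
  rewrite normcM ler_wpM2l ?normc_ge0 // theta_dual_imt; last by have := wn 0; rewrite addr0.
  rewrite [leLHS]normcM [leRHS]normcM; apply: ler_wpM2r; first exact: normc_ge0.
  by rewrite !normc_cexp_2pi_real Iw.
have h4 := (hsum_swap s as0 h2 h3).1 h1.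
have hB := usumP (Bt_asum z w0).
have h5 : hsum u (thK * lipK * usum (Bt w z)).
  have := hsum_pair (hsumZ (thK * lipK) hB) (fun h => hsumZ (thK * lipK) (usumP (asum_fst h (Bt_asum z w0)))).
  apply: eq_hsum => h; rewrite /u -mulrA; congr (_ * _); rewrite mulrCA; congr (_ * _).
  apply: usum_eq; have [p [Q [Q0 alE]]] := al_rat h.
  have la : asum (lip_dual w p Q j) by apply: lip_dual_asum.
  have := hsumZ (cexp (2 * ipi R * dot (intv R[i] h) z)) (usumP la).
  rewrite (_ : usum (lip_dual w p Q j) = usum (fun l => if al h < l%:~R then
     (l%:~R - al h)%:C ^+ j * cexp (2 * ipi R * l%:~R * w) else 0)); last first.
    by apply: eq_usum => l; rewrite /lip_dual alE.
  apply: eq_hsum => l; rewrite /Bt /lip_dual /= alE; case: ifP => _; last by rewrite mulr0.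
  by rewrite [LHS]mulrC -[LHS]mulrA.
exact: hsum_uniq h4 h5.
Qed.

End Blocks.

(** * The terms with positive lower left entry *)

Lemma modz_ord (c : nat) (i : 'I_c.+1) (n : int) :
  (((i : nat)%:Z + c.+1%:Z * n) %% c.+1%:Z)%Z = (i : nat)%:Z.
Proof.
rewrite addrC mulrC modzMDl modz_small // lez_nat ltz_nat leq0n ltn_ord //.
Qed.

Lemma ord_split_inj (c : nat) (i i' : 'I_c.+1) (n n' : int) :
  (i : nat)%:Z + c.+1%:Z * n = (i' : nat)%:Z + c.+1%:Z * n' -> i = i' /\ n = n'.
Proof.
move=> e; have ei : i = i'.
  by have := congr1 (fun u => (u %% c.+1%:Z)%Z) e; rewrite !modz_ord => -[] /val_inj.
by split=> //; move: e; rewrite ei => /addrI /mulfI; apply.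
Qed.

Definition modo (c : nat) (d : int) : 'I_c.+1 := inord `|(d %% c.+1%:Z)%Z|.

Lemma modoE c (d : int) : ((modo c d : nat)%:Z = (d %% c.+1%:Z)%Z).
Proof.
have h0 : 0 <= (d %% c.+1%:Z)%Z by apply: modz_ge0.
rewrite /modo inordK ?gez0_abs //.
by rewrite -ltz_nat gez0_abs // ltz_pmod.
Qed.

Lemma coprimez_nat (c d : nat) (n : int) :
  coprimez c%:Z (d%:Z + c%:Z * n) = coprime c d.
Proof.
rewrite /coprimez addrC mulrC gcdzMDl; by rewrite /gcdz /= /coprime.
Qed.

Lemma cexp_shift (R : realType) (U V : R[i]) (e : int) :
  U = V + 2 * ipi R * e%:~R -> cexp U = cexp V.
Proof. by move=> ->; exact: cexpDint. Qed.

Lemma coprimez01 : coprimez 0 1. Proof. by []. Qed.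

(** For modulus [c + 1] there are [c + 1] residues [d] and [(c + 1) ^ N] vectors; with the weight
    this leaves at most [(c + 1) ^ -3]. *)
Lemma powc_bound (R : realType) (N k c : nat) : (N + 4 <= k)%N ->
  (c.+1%:R : R) * (c.+1%:R ^- k * c.+1%:R ^+ N) <= (1 + c%:R ^+ 2)^-1.
Proof.
move=> hkN; have x1 : 1 <= c.+1%:R :> R by rewrite ler1n.
have xn : (c.+1%:R : R) != 0 by rewrite pnatr_eq0.
have -> : (c.+1%:R : R) * (c.+1%:R ^- k * c.+1%:R ^+ N) = (c.+1%:R ^+ (k - N.+1))^-1.
  have kN : (N.+1 <= k)%N by apply: leq_trans hkN; rewrite addn4 ltnS leqW // leqW // leqW.
  move: (c.+1%:R : R) xn {x1} => x xn.
  rewrite -[in LHS](subnK kN) exprD exprS; move: (expf_neq0 (k - N.+1) xn) (expf_neq0 N xn).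
  by move: (x ^+ (k - N.+1)) (x ^+ N) => u v un vn; field; rewrite un vn xn.
rewrite lef_pV2 ?posrE ?exprn_gt0 ?(lt_le_trans ltr01) //; last by rewrite lerDl sqr_ge0.
apply: le_trans (_ : c.+1%:R ^+ 2 <= _).
  rewrite -natr1; have : 0 <= c%:R :> R by []. nra.
apply: ler_weXn2l => //; move: hkN; lia.
Qed.

Section Assemble.
Variables (R : realType) (N : nat) (S : 'M[int]_N) (k m : nat).
Hypotheses (hS : even_lattice R S) (hm : (0 < m)%N) (hN : ~~ odd N) (hk : ~~ odd k).
Hypothesis (hkN : (N + 4 <= k)%N).
Local Notation SR := (SR R S).
Local Notation Cm := (map_mx (real_complex R)).

Definition ovec (c : nat) (r : 'cV['I_c]_N) : 'cV[int]_N :=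
  map_mx (fun i : 'I_c => (i : nat)%:Z) r.

(** The exponent [k - N / 2 - 1] of [Delta] in the coefficient. *)
Definition jw := (k - N./2).-1.

Lemma half_le : (N./2 <= N)%N. Proof. by rewrite -[leqRHS](odd_double_half N) -addnn addnA leq_addl. Qed.

Lemma jw_gt0 : (0 < jw)%N.
Proof. have := half_le; rewrite /jw; move: (N./2) hkN => q; lia. Qed.

Lemma jwE : k = (N./2 + jw.+1)%N.
Proof. have := half_le; rewrite /jw; move: (N./2) hkN => q; lia. Qed.

(** Division with remainder of both [d] and [x]; the minus sign makes the quotient [y] enter the
    theta series as [y + (z - r / c)]. *)
Definition blkmap (c : nat) (p : ('I_c.+1 * 'cV['I_c.+1]_N) * (int * 'cV[int]_N)) :
    int * 'cV[int]_N :=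
  ((p.1.1 : nat)%:Z + c.+1%:Z * p.2.1, ovec p.1.2 - c.+1%:Z *: p.2.2).

Lemma blkmap_inj c : injective (@blkmap c).
Proof.
move=> [[d r] [n y]] [[d' r'] [n' y']] []; rewrite /= => /ord_split_inj[-> ->] /matrixP e.
have ry i : r i 0 = r' i 0 /\ - y i 0 = - y' i 0.
  by apply: ord_split_inj; have := e i 0; rewrite !mxE !mulrN.
congr (_, _, (_, _)); apply/matrixP => i i'; rewrite ord1; first by case: (ry i).
by case: (ry i) => _ /oppr_inj.
Qed.

Lemma blkmap_surj c q : exists p, @blkmap c p = q.
Proof.
case: q => d x.
exists ((modo c d, \col_i modo c (x i ord0)), ((d %/ c.+1%:Z)%Z, \col_i - ((x i ord0) %/ c.+1%:Z)%Z)).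
rewrite /blkmap /=; congr (_, _).
  by rewrite modoE addrC mulrC -divz_eq.
apply/matrixP => i i'; rewrite [i']ord1 !mxE modoE mulrN opprK.
by rewrite addrC mulrC -divz_eq.
Qed.

Lemma intvB (x y : 'cV[int]_N) : intv R[i] (x - y) = intv R[i] x - intv R[i] y.
Proof. exact: map_mxB. Qed.

(** From [(a tau + b) / (c tau + d) = a / c - 1 / (c (c tau + d))] the exponent splits into the
    phase [a (x, x) / c], which depends on [x] only modulo [c], and a square in [y + z - r / c]. *)
Lemma eisT_block (c d0 : nat) (a b n : int) (r y : 'cV[int]_N) (tau : R[i]) z :
  (0 < c)%N -> 0 < complex.Im tau -> a * d0%:Z - b * c%:Z = 1 ->
  eisT S k m c%:Z (d0%:Z + c%:Z * n) a (b + a * n) (r - c%:Z *: y) tau z =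
  c%:R ^- k * cexp (ipi R / c%:R * (m%:R * a%:~R * bil S (intv R[i] r) (intv R[i] r))) *
  thfam S m k (tau + d0%:R / c%:R) (z - c%:R^-1 *: intv R[i] r) (n, y).
Proof.
move=> c0 t0 h; have cn : c%:R != 0 :> R[i] by rewrite pnatr_eq0 -lt0n.
have h' : a * (d0%:Z + c%:Z * n) - (b + a * n) * c%:Z = 1 by rewrite -h; ring.
have jn := jfac_neq0 t0 h'.
have hC : a%:~R * d0%:R - b%:~R * c%:R = 1 :> R[i].
  by rewrite [d0%:R]pmulrn [c%:R]pmulrn -!intrM -intrB h.
have bE : b%:~R = (a%:~R * d0%:R - 1) / c%:R :> R[i].
  apply: (mulIf cn); rewrite divfK //.
  by move: (a%:~R * d0%:R) (b%:~R * c%:R) hC => P Q hh; rewrite -hh; ring.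
rewrite /eisT /thfam /=; set j := c%:~R * tau + _ in jn *.
pose w := tau + d0%:R / c%:R + n%:~R : R[i].
have jE : j = c%:R * w by rewrite /j /w intrD intrM -!pmulrn; field.
have wn : w != 0 by move: jn; rewrite jE mulf_eq0 negb_or => /andP[].
rewrite -/w jE exprMn invfM [RHS]mulrACA; congr (_ * _).
rewrite /theta_primal -cexpD.
have [e eE] := bil_even hS y.
have ryE := bil_intv S R[i] r y.
rewrite intvB intvZ -bilE.
apply: (@cexp_shift R _ _ (m%:Z * (- (a * bl S r y) + a * c%:Z * e))).
rewrite !(intrD, intrM, mulrNz) -!pmulrn -ryE.
set Y := intv R[i] y in eE ryE *; set X := intv R[i] r in ryE *.
have piE : (pi : R)%:C * ('i * m%:R / w) = ipi R * m%:R / w.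
  by rewrite ipiE !mulrA [(pi : R)%:C * _]mulrC.
rewrite piE -![bil S _ _]/(bl (map_mx intr S) _ _) in eE *.
have eS := SC_sym hS.
rewrite !(blDl, blDr, blZl, blZr, blNl, blNr) (bl_sym Y X eS) (bl_sym z X eS) (bl_sym z Y eS) eE.
rewrite bE.
set A := map_mx intr S.
have tE : tau = w - d0%:R / c%:R - n%:~R by rewrite /w; ring.
rewrite {1}tE.
move: (bl A X X) (bl A X Y) (bl A X z) (bl A Y z) (bl A z z) (ipi R) => XX XY Xz Yz zz ip.
move: (e%:~R : R[i]) (a%:~R : R[i]) (n%:~R : R[i]) => e' a' n'.
move: (w : R[i]) wn => w' wn'.
by field; rewrite cn wn'.
Qed.

(** The sum over [x] in [beta_term], with [lambda] expressed by its integral coordinates [p.1]. *)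
Definition ph (c : nat) (p : 'cV[int]_N * int) (d : nat) : R[i] :=
  \sum_(x : 'cV['I_c]_N) cexp (ipi R / c%:R * (m%:R * (bez_a c%:Z d%:Z)%:~R *
     bil S (intv R[i] (ovec x)) (intv R[i] (ovec x)) - 2 * dot (intv R[i] p.1) (intv R[i] (ovec x))
     + 2 * p.2%:~R * d%:R)).

Definition Ac (c : nat) (p : 'cV[int]_N * int) : R[i] :=
  \sum_(d < c) if coprime c d then c%:R ^- k * ph c p d else 0.

Lemma normc_cexp_ipi (c : nat) (X : int) : normc (cexp (ipi R / c%:R * X%:~R)) = 1.
Proof.
rewrite normc_cexp (natC R c) (intC R X) -fmorphV -mulrA -rmorphM ReM /= mul0r mulr0 subrr expR0.
by [].
Qed.

Lemma ph_le c p d : normc (ph c p d) <= c%:R ^+ N.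
Proof.
apply: le_trans (normc_sum _ _ _) _.
apply: le_trans (_ : \sum_(x : 'cV['I_c]_N) 1 <= _); last first.
  by rewrite sumr_const card_mx card_ord muln1 natrX.
apply: ler_sum => x _; rewrite bil_intv dot_map [m%:R]pmulrn [d%:R]pmulrn -[2 in X in X <= _]/(2%:~R).
rewrite -!intrM -intrB -intrD normc_cexp_ipi //.
Qed.

Lemma Ac_le c p : normc (Ac c p) <= c%:R * (c%:R ^- k * c%:R ^+ N).
Proof.
apply: le_trans (normc_sum _ _ _) _.
have -> : c%:R * (c%:R ^- k * c%:R ^+ N) = \sum_(d < c) (c%:R ^- k * c%:R ^+ N) :> R.
  by rewrite sumr_const card_ord mulr_natl.
apply: ler_sum => d _.
have h0 : 0 <= (c%:R : R) ^- k by rewrite invr_ge0 exprn_ge0.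
case: ifP => _; last by rewrite normc0 mulr_ge0 // exprn_ge0.
by rewrite normcM normcV normcX normc_nat ler_wpM2l // ph_le.
Qed.

Lemma Ac_bound c p : normc (Ac c.+1 p) <= (1 + c%:R ^+ 2)^-1.
Proof. exact: le_trans (Ac_le _ _) (powc_bound R c hkN). Qed.

Lemma Bt_shift (tau : R[i]) z (x y : R[i]) v p :
  Bt S m jw (tau + x) (z - y *: v) p =
  cexp (2 * ipi R * (p.2%:~R * x - y * dot (intv R[i] p.1) v)) * Bt S m jw tau z p.
Proof.
rewrite /Bt; case: ifP => _; last by rewrite mulr0.
rewrite [RHS]mulrCA; congr (_ * _); rewrite -!cexpD; congr cexp.
rewrite dotDr dotNr dotZr; ring.
Qed.

Definition cK : R[i] := thK R S m * lipK R jw.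

(** Each of the finitely many classes [(d, r)] is evaluated by [theta_lip] at [tau + d / c] and
    [z - r / c]. By [Bt_shift] these translations only contribute phases, and the phases add up to
    [Ac]. *)
Lemma block_hsum (tau : R[i]) z c s : 0 < complex.Im tau ->
  asum (fun q : int * 'cV[int]_N => eisF S k m tau z (c.+1%:Z, q.1, q.2)) ->
  hsum (fun q : int * 'cV[int]_N => eisF S k m tau z (c.+1%:Z, q.1, q.2)) s ->
  hsum (fun p => Ac c.+1 p * (cK * Bt S m jw tau z p)) s.
Proof.
move=> t0 has hs.
pose G (p : ('I_c.+1 * 'cV['I_c.+1]_N) * (int * 'cV[int]_N)) :=
  eisF S k m tau z (c.+1%:Z, (blkmap p).1, (blkmap p).2).
have aG : asum G.
  apply/(asum_reindex (f := fun q : int * 'cV[int]_N => eisF S k m tau z (c.+1%:Z, q.1, q.2)) (@blkmap_inj c)) => //.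
  by move=> q _; exact: blkmap_surj.
have hG : hsum G s.
  apply/(hsum_reindex (f := fun q : int * 'cV[int]_N => eisF S k m tau z (c.+1%:Z, q.1, q.2)) _ (@blkmap_inj c)) => //.
  by move=> q _; exact: blkmap_surj.
pose K1 (pr : 'I_c.+1 * 'cV['I_c.+1]_N) : R[i] := c.+1%:R ^- k * cexp (ipi R / c.+1%:R *
  (m%:R * (bez_a c.+1%:Z (pr.1 : nat)%:Z)%:~R * bil S (intv R[i] (ovec pr.2)) (intv R[i] (ovec pr.2)))).
have K1n pr : K1 pr != 0 by rewrite /K1 mulf_neq0 ?cexp_neq0 // invr_eq0 expf_neq0 // pnatr_eq0.
pose W (pr : 'I_c.+1 * 'cV['I_c.+1]_N) : R[i] := tau + (pr.1 : nat)%:R / c.+1%:R.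
pose Z (pr : 'I_c.+1 * 'cV['I_c.+1]_N) := z - c.+1%:R^-1 *: intv R[i] (ovec pr.2).
have W0 pr : 0 < complex.Im (W pr).
  by rewrite /W ImD (natC R pr.1) (natC R c.+1) -fmorphV -rmorphM ImC addr0.
pose T (pr : 'I_c.+1 * 'cV['I_c.+1]_N) : R[i] :=
  if coprime c.+1 pr.1 then K1 pr * (cK * usum (Bt S m jw (W pr) (Z pr))) else 0.
have hT pr : hsum (fun q => G (pr, q)) (T pr).
  have [t ht] := asum_hsum (asum_fst pr aG).
  rewrite (_ : T pr = t) //; rewrite /T; case: (boolP (coprime c.+1 pr.1)) => cd; last first.
    apply: hsum_uniq ht; apply: (eq_hsum (f := fun=> 0)); last exact: hsum0.
    move=> -[n y]; by rewrite /G /blkmap /eisF /= coprimez_nat (negbTE cd).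
  have h1 : hsum (thfam S m k (W pr) (Z pr)) ((K1 pr)^-1 * t).
    apply: eq_hsum (hsumZ _ ht) => -[n y]; rewrite /G /blkmap /eisF /= coprimez_nat cd.
    have cz : coprimez c.+1%:Z (pr.1 : nat)%:Z by have := coprimez_nat c.+1 pr.1 0; rewrite mulr0 addr0 => ->.
    have cz' : coprimez c.+1%:Z ((pr.1 : nat)%:Z + c.+1%:Z * n) by rewrite coprimez_nat.
    have hb := coprimez_bez cz.
    rewrite eis_termE /=.
    rewrite (@eisT_indep _ _ _ k m hS _ _ _ _ (bez_a c.+1%:Z (pr.1 : nat)%:Z)
      (bez_b c.+1%:Z (pr.1 : nat)%:Z + bez_a c.+1%:Z (pr.1 : nat)%:Z * n) _ _ _ t0 (coprimez_bez cz')); last first.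
      by rewrite -hb; ring.
    by rewrite eisT_block // -/(K1 pr) mulKf.
  rewrite /cK -(theta_lip hS hm hN jw_gt0 jwE (W0 pr) h1).
  by rewrite mulVKf.
have sE : s = \sum_pr T pr := hsum_uniq (hsum_pair hG hT) (hsum_fin _).
pose F (pr : 'I_c.+1 * 'cV['I_c.+1]_N) p : R[i] :=
  if coprime c.+1 pr.1 then K1 pr * (cK * Bt S m jw (W pr) (Z pr) p) else 0.
have hF pr : hsum (F pr) (T pr).
  rewrite /F /T; case: ifP => _; last exact: hsum0.
  by apply/hsumZ/hsumZ/usumP/Bt_asum => //; exact: W0.
rewrite sE; apply: eq_hsum (hsum_bigsum (index_enum _) hF) => p.
rewrite -(pair_bigA _ (fun d r => F (d, r) p)) /= /Ac mulr_suml; apply: eq_bigr => d _.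
rewrite /F /=; case: ifP => cd; last by rewrite mul0r big1.
rewrite /ph mulr_sumr mulr_suml; apply: eq_bigr => r _.
rewrite /K1 /W /Z /= Bt_shift [cK * _]mulrCA [LHS]mulrA; congr (_ * _).
rewrite -[LHS]mulrA; congr (_ * _); rewrite -cexpD; congr cexp.
by field; rewrite addrC natr1 pnatr_eq0.
Qed.

(** The bound on [Ac] is summable in [c] and uniform in the frequency, which justifies the exchange
    with the Fourier sum. *)
Lemma hsum_pos (tau : R[i]) z sp : 0 < complex.Im tau ->
  hsum (fun p => if 0 < p.1.1 then eisF S k m tau z p else 0) sp ->
  hsum (fun p => usum (fun c => Ac c.+1 p) * (cK * Bt S m jw tau z p)) sp.
Proof.
move=> t0 hs.
pose fp (p : int * int * 'cV[int]_N) := if 0 < p.1.1 then eisF S k m tau z p else 0.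
have afp : asum fp := asum_restr (fun p => 0 < p.1.1) (eisF_asum hS hm z hkN t0).
pose hc (p : nat * (int * 'cV[int]_N)) : int * int * 'cV[int]_N := (p.1.+1%:Z, p.2.1, p.2.2).
have hc_inj : injective hc by move=> [c [d x]] [c' [d' x']] [] -> -> ->.
have hc_surj p : fp p != 0 -> exists q, hc q = p.
  case: p => [[c d] x]; rewrite /fp /=; case: ifP => [c0 _|]; last by rewrite eqxx.
  exists (`|c|.-1, (d, x)); rewrite /hc /=; congr (_, _, _).
  by case: c c0 => [[|c]|c].
have ag : asum (fun q => fp (hc q)) by apply/asum_reindex.
have hg : hsum (fun q => fp (hc q)) sp by apply/hsum_reindex.
have ac c : asum (fun q : int * 'cV[int]_N => eisF S k m tau z (c.+1%:Z, q.1, q.2)).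
  exact: (asum_fst c ag).
pose t c := usum (fun q : int * 'cV[int]_N => eisF S k m tau z (c.+1%:Z, q.1, q.2)).
have ht : hsum t sp by apply: hsum_pair hg _ => c; exact: usumP (ac c).
pose f (c : nat) p := Ac c.+1 p * (cK * Bt S m jw tau z p).
have hf c : hsum (f c) (t c) by apply: block_hsum t0 (ac c) (usumP (ac c)).
have aA p : asum (fun c => Ac c.+1 p).
  exists 4; apply: sbound_le (inv1sq_nat R) => c; exact: Ac_bound.
have [M hM] := Bt_asum jw hS hm z t0.
have af : asum (fun q : nat * ('cV[int]_N * int) => f q.1 q.2).
  exists (4 * (normc cK * M)).
  have i0 (n : nat) : 0 <= (1 + (n%:R : R) ^+ 2)^-1 by nneg.
  have b0 p : 0 <= normc cK * normc (Bt S m jw tau z p) by rewrite mulr_ge0 // normc_ge0.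
  apply: sbound_le (sbound_prod i0 b0 (inv1sq_nat R) (sboundZ (normc_ge0 _) hM)) => -[c p].
  rewrite -[leLHS]/(normc (f c p)) /f normcM [normc (cK * _)]normcM.
  apply: ler_wpM2r; [exact: b0|exact: Ac_bound].
apply: (hsum_swap sp af hf _).1 ht => p.
have := hsumZ (cK * Bt S m jw tau z p) (usumP (aA p)).
rewrite [in X in hsum _ X]mulrC; apply: eq_hsum => c; by rewrite mulrC.
Qed.

Lemma eisF_opp (tau : R[i]) z (p : int * int * 'cV[int]_N) : 0 < complex.Im tau ->
  eisF S k m tau z (- p.1.1, - p.1.2, - p.2) = eisF S k m tau z p.
Proof.
case: p => [[c d] x] t0; rewrite /eisF /= coprimezN coprimeNz; case: ifP => // cd.
have cd' : coprimez (- c) (- d) by rewrite coprimezN coprimeNz.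
have hb := coprimez_bez cd; rewrite !eis_termE /=.
rewrite (@eisT_indep _ _ _ k m hS _ _ _ _ (- bez_a c d) (- bez_b c d) _ _ _ t0 (coprimez_bez cd')); last first.
  by rewrite -hb; ring.
rewrite /eisT !mulrNz.
have jn := jfac_neq0 t0 hb; set j := c%:~R * tau + d%:~R in jn *.
have -> : - c%:~R * tau - d%:~R = - j :> R[i] by rewrite /j; ring.
have -> : intv R[i] (- x) = - intv R[i] x by exact: map_mxN.
rewrite exprNn -signr_odd (negbTE hk) expr0 mul1r; congr (_ * cexp (_ * _)).
rewrite -![bil S _ _]/(bl (map_mx intr S) _ _) !(blNl, blNr).
by field.
Qed.

Definition thT (tau : R[i]) z (x : 'cV[int]_N) : R[i] :=
  cexp (ipi R * m%:R * (bil S (intv R[i] x) (intv R[i] x) * tau + 2 * bil S (intv R[i] x) z)).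

Lemma eisF01 (tau : R[i]) z x : 0 < complex.Im tau ->
  eisF S k m tau z (0, 1, x) = thT tau z x.
Proof.
move=> t0; rewrite -[LHS]/(eisT S k m 0 1 (bez_a 0 1) (bez_b 0 1) x tau z).
rewrite (@eisT_indep _ _ _ k m hS _ _ _ _ 1 0 _ _ _ t0 (coprimez_bez coprimez01)) ?mulr1 ?mulr0 ?subr0 //.
by rewrite /eisT !mulr0z !mulr1z !mul0r add0r expr1n invr1 !mul1r addr0 subr0 mulr1.
Qed.

Lemma thT_asum (tau : R[i]) z : 0 < complex.Im tau -> asum (thT tau z).
Proof.
move=> t0; have [M hM] := eisF_asum hS hm z hkN t0; exists M.
pose h (x : 'cV[int]_N) : int * int * 'cV[int]_N := (0, 1, x).
have ih : injective h by move=> x x' [].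
by apply: sbound_le (sbound_reindex ih hM) => x; rewrite /h eisF01.
Qed.

(** The terms with [c = 0] have [d = 1] or [d = -1] and give two equal theta series; the signs of
    [c] give two equal halves. Both doublings are absorbed by the factor 1/2. *)
Lemma eis_expansion (tau : R[i]) z : 0 < complex.Im tau ->
  exists Th sp, [/\ hsum (thT tau z) Th,
    hsum (fun p => usum (fun c => Ac c.+1 p) * (cK * Bt S m jw tau z p)) sp &
    eisenstein S k m tau z = Th + sp].
Proof.
move=> t0; have ae := eisF_asum hS hm z hkN t0.
have [hE _] := eis_hsum hS hm z hkN t0.
have [Th hTh] := asum_hsum (thT_asum z t0).
have [sp hsp] := asum_hsum (asum_restr (fun p => 0 < p.1.1) ae).
have [s0 hs0] := asum_hsum (asum_restr (fun p => p.1.1 == 0) ae).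
exists Th, sp; split => //; first exact: hsum_pos.
have hsn : hsum (fun p => if p.1.1 < 0 then eisF S k m tau z p else 0) sp.
  pose h (p : int * int * 'cV[int]_N) := (- p.1.1, - p.1.2, - p.2).
  have hK : cancel h h by move=> [[c d] x]; rewrite /h /= !opprK.
  apply/(hsum_reindex (h := h) _ (can_inj hK)) => [p _|]; first by exists (h p).
  apply: eq_hsum hsp => p; rewrite /h /= eisF_opp // oppr_lt0; by [].
have s0E : s0 = Th + Th.
  pose h (p : bool * 'cV[int]_N) : int * int * 'cV[int]_N :=
    (0, (if p.1 then 1 else -1), (if p.1 then p.2 else - p.2)).
  have ih : injective h by move=> [[] x] [[] x'] [] // => [->|/oppr_inj ->].
  have sh p : (if p.1.1 == 0 then eisF S k m tau z p else 0) != 0 -> exists q, h q = p.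
    case: p => [[c d] x] /=; case: ifP => [/eqP ->|_]; last by rewrite eqxx.
    rewrite /eisF /=; case: ifP => [cd _|]; last by rewrite eqxx.
    have : `|d|%N = 1%N by move: cd; rewrite /coprimez /gcdz /= gcd0n => /eqP[].
    case: d {cd} => [[|[|d]]|[|d]] // _; first by exists (true, x).
    by exists (false, - x); rewrite /h /= opprK.
  have hh := (hsum_reindex _ ih sh).2 hs0.
  have h1 : hsum (fun _ : bool => Th) s0.
    apply: hsum_pair hh _ => b; apply: eq_hsum hTh => x; rewrite /h /=.
    case: b => /=; first by rewrite eisF01.
    by rewrite -(eisF01 z x t0) -(@eisF_opp tau z (0, 1, x) t0) /= oppr0.
  by have := hsum_uniq h1 (hsum_fin _); rewrite big_bool.
have : 2 * eisenstein S k m tau z = s0 + (sp + sp).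
  apply: hsum_uniq hE (eq_hsum _ (hsumD hs0 (hsumD hsp hsn))) => p.
  by case: (ltgtP p.1.1 0) => _; rewrite ?addr0 ?add0r.
rewrite s0E => e; apply: (@mulfI _ 2); first by rewrite pnatr_eq0.
rewrite e; ring.
Qed.

End Assemble.

(** * The Fourier coefficients *)

Section Beta.
Variables (R : realType) (N : nat) (S : 'M[int]_N) (k m : nat).
Hypotheses (hS : even_lattice R S) (hm : (0 < m)%N) (hN : ~~ odd N) (hk : ~~ odd k).
Hypothesis (hkN : (N + 4 <= k)%N).
Local Notation j := (jw N k).
Local Notation phc := (ph R S m).
Local Notation Acc := (Ac R S k m).

Lemma hsum_ltn (f : nat -> R[i]) n : (forall i, (n <= i)%N -> f i = 0) ->
  hsum f (\sum_(0 <= i < n) f i).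
Proof.
move=> f0; rewrite big_mkord.
apply/(@hsum_reindex _ _ _ (fun i : 'I_n => (i : nat)) f _ (@val_inj _ _ _)).
  move=> i; case: (ltnP i n) => [hi _|/f0 ->]; last by rewrite eqxx.
  by exists (Ordinal hi).
exact: hsum_fin.
Qed.

Lemma sbound_ltn (g : nat -> R) n (M : R) : 0 <= M -> (forall i, 0 <= g i <= M) ->
  (forall i, (n <= i)%N -> g i = 0) -> sbound g (n%:R * M).
Proof.
move=> M0 gM g0.
apply: (@sbound_reindex_onto _ _ _ (fun i : 'I_n => (i : nat)) _ _ (@val_inj _ _ _)).
  move=> i; case: (ltnP i n) => [hi _|/g0 ->]; last by rewrite eqxx.
  by exists (Ordinal hi).
apply: sbound_leM (sbound_fin _) => [|i]; last by case/andP: (gM i).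
apply: le_trans (_ : \sum_(i < n) M <= _); last by rewrite sumr_const card_ord mulr_natl.
by apply: ler_sum => i _; case/andP: (gM i).
Qed.

(** The inverses of [d] and [c + d] modulo [c] differ by a multiple of [c], which enters multiplied
    by the even number [(x, x)]; the remaining change is [2 n]. *)
Lemma ph_periodic c p d : (0 < c)%N -> coprime c d -> phc c p (c + d)%N = phc c p d.
Proof.
move=> c0 cd; apply: eq_bigr => x _.
have z1 : coprimez c%:Z d%:Z by have := coprimez_nat c d 0; rewrite mulr0 addr0 => ->.
have z2 : coprimez c%:Z (c + d)%N%:Z.
  by have := coprimez_nat c d 1; rewrite mulr1 cd PoszD addrC => ->.
have h1 := coprimez_bez z1; have h2 := coprimez_bez z2.
set a := bez_a c%:Z d%:Z in h1 *; set b := bez_b c%:Z d%:Z in h1.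
set a' := bez_a _ (c + d)%N%:Z in h2 *; set b' := bez_b _ (c + d)%N%:Z in h2.
have aE : a' = a + c%:Z * (a * b' - a * a' - a' * b).
  have e : a' * (1 - (a * d%:Z - b * c%:Z)) - a * (1 - (a' * (c + d)%N%:Z - b' * c%:Z)) = 0.
    by rewrite h1 h2 subrr !mulr0 subrr.
  by apply/eqP; rewrite -subr_eq0 -e PoszD; apply/eqP; ring.
have [e eE] := bil_even hS (ovec x).
set t := a * b' - a * a' - a' * b in aE.
apply: (@cexp_shift R _ _ (m%:Z * t * e + p.2)).
have cn : c%:R != 0 :> R[i] by rewrite pnatr_eq0 -lt0n.
rewrite {1}aE eE !(intrD, intrM) natrD -!pmulrn.
move: (a%:~R : R[i]) (t%:~R : R[i]) (e%:~R : R[i]) (p.2%:~R : R[i]) (dot _ _) (ipi R) => a1 t1 e1 p1 D ip.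
by field.
Qed.

(** The representative [disc_form] differs from [(lambda, lambda)] by an even integer, so the
    exponent is an integral multiple of [2 pi i]. *)
Lemma nu_term (n : int) h (nu : nat) :
  cexp (2 * ipi R * n%:~R * m%:R * nu%:R)
  * cexp (ipi R * nu%:R * ratr (disc_form S (lam S h)))
  * cexp (- (ipi R * nu%:R * bil S (ratv R (lam S h)) (ratv R (lam S h)))) = 1.
Proof.
rewrite bil_ratv /disc_form raddfB /= rmorphM /= ratr_int ratr_nat -!cexpD.
set fl := Num.floor _.
rewrite (_ : _ + _ = 2 * ipi R * (n * m%:Z * nu%:Z - nu%:Z * fl)%:~R) ?cexp_2pi_int //.
rewrite !(intrD, intrM, mulrNz) -!pmulrn; ring.
Qed.

Lemma beta_termE (n : int) h c d :
  beta_term R S k m n (lam S h) (c, d) =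
  (m * c)%:R ^- k * phc c (h, n) d * (level S)%:R.
Proof.
have -> : (level S)%:R = \sum_(nu < level S)
     (cexp (2 * ipi R * n%:~R * m%:R * (nu : nat)%:R)
     * cexp (ipi R * (nu : nat)%:R * ratr (disc_form S (lam S h)))
     * cexp (- (ipi R * (nu : nat)%:R * bil S (ratv R (lam S h)) (ratv R (lam S h))))).
  by under eq_bigr => nu _ do rewrite nu_term; rewrite sumr_const card_ord.
have -> : phc c (h, n) d = \sum_(x : 'cV['I_c]_N) cexp (ipi R / c%:R *
     (m%:R * (bez_a c%:Z d%:Z)%:~R * bil S (intv R[i] (ovec x)) (intv R[i] (ovec x))
      - 2 * bil S (ratv R (lam S h)) (intv R[i] (ovec x)) + 2 * n%:~R * d%:R)).
  by apply: eq_bigr => x _; rewrite lam_bil.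
by [].
Qed.

Definition betaF (n : int) h (q : nat * nat) : R[i] :=
  if q \in beta_index m then beta_term R S k m n (lam S h) q else 0.

Lemma mem_beta_index (c d : nat) :
  ((c, d) \in beta_index m) = [&& (0 < c)%N, (d < m * c)%N & coprime c d].
Proof. by apply/idP/and3P; rewrite inE. Qed.

Lemma betaF_asum n h : asum (betaF n h).
Proof.
pose Q : R := (level S)%:R.
pose B (c : nat) : R := if (0 < c)%N then c%:R ^- k * c%:R ^+ N * Q else 0.
have Q0 : 0 <= Q by rewrite ler0n.
have B0 c : 0 <= B c by rewrite /B; case: ifP => // _; rewrite !mulr_ge0 ?invr_ge0 ?exprn_ge0.
have bB c d : normc (betaF n h (c, d)) <= B c.
  rewrite /betaF mem_beta_index; case: ifP => [/and3P[c0 _ _]|_]; last by rewrite normc0.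
  rewrite /B c0 beta_termE !normcM normcV normcX !normc_nat ler_wpM2r //.
  have cp : 0 < c%:R :> R by rewrite ltr0n.
  apply: ler_pM; rewrite ?invr_ge0 ?exprn_ge0 ?normc_ge0 //; last exact: ph_le.
  rewrite lef_pV2 ?posrE ?exprn_gt0 ?ltr0n ?muln_gt0 ?hm // lerXn2r ?nnegrE //.
  by rewrite ler_nat leq_pmull.
pose T (c : nat) : R := (m * c)%:R * B c.
exists (m%:R * Q * 4); apply: (@sbound_pair R _ _ (fun q => normc (betaF n h q)) T).
- by move=> q; exact: normc_ge0.
- move=> c; apply: sbound_ltn => // [d|d cd]; first by rewrite normc_ge0 bB.
  by rewrite /betaF mem_beta_index [(d < _)%N]ltnNge cd /= andbF normc0.
- apply: (@sbound_reindex_onto _ _ _ succn _ _ succn_inj).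
    by case=> [|c _]; [rewrite /T muln0 mul0r eqxx|exists c].
  have mQ : 0 <= m%:R * Q by rewrite mulr_ge0.
  apply: sbound_le (sboundZ mQ (inv1sq_nat R)) => c.
  rewrite /T /B /= natrM; have := powc_bound R c hkN.
  rewrite (_ : m%:R * _ * _ = m%:R * Q * (c.+1%:R * (c.+1%:R ^- k * c.+1%:R ^+ N))).
    by apply: ler_wpM2l.
  by move: (c.+1%:R : R) => x; ring.
Qed.

Lemma Ac_asum p : asum (fun c => Acc c.+1 p).
Proof.
by exists 4; apply: sbound_le (inv1sq_nat R) => c; exact: Ac_bound.
Qed.

Lemma betaF_row n h c :
  \sum_(0 <= d < m * c.+1) betaF n h (c.+1, d) =
  (level S)%:R * (m%:R ^- k * m%:R) * Acc c.+1 (h, n).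
Proof.
pose F d := if coprime c.+1 d then ((m * c.+1)%:R ^- k * phc c.+1 (h, n) d * (level S)%:R) else 0.
transitivity (\sum_(0 <= d < m * c.+1) F d).
  rewrite big_nat [RHS]big_nat; apply: eq_bigr => d /andP[_ dl].
  by rewrite /betaF mem_beta_index dl /= /F; case: ifP => // _; rewrite beta_termE.
rewrite sum_periodic; last first.
  move=> d; rewrite /F /coprime gcdnDl -/(coprime c.+1 d); case: ifP => // cd.
  by rewrite ph_periodic.
rewrite big_mkord /Ac !mulr_sumr; apply: eq_bigr => d _; rewrite /F.
case: ifP => _; last by rewrite !mulr0.
rewrite natrM exprMn invfM.
move: (m%:R ^- k) (c.+1%:R ^- k) (ph _ _ _ _ _ _) => u v w; ring.
Qed.

Lemma beta_hsum n h :
  hsum (betaF n h) ((level S)%:R * (m%:R ^- k * m%:R) * usum (fun c => Acc c.+1 (h, n))).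
Proof.
have [s hs] := asum_hsum (betaF_asum n h).
have h1 : hsum (fun c => \sum_(0 <= d < m * c) betaF n h (c, d)) s.
  apply: hsum_pair hs _ => c; apply: hsum_ltn => d cd.
  by rewrite /betaF mem_beta_index [(d < _)%N]ltnNge cd /= andbF.
have h2 : hsum (fun c => \sum_(0 <= d < m * c.+1) betaF n h (c.+1, d)) s.
  apply: (hsum_reindex (f := fun c => \sum_(0 <= d < m * c) betaF n h (c, d)) _ succn_inj _).2 h1.
  by case=> [|c _]; [rewrite muln0 big_geq ?eqxx|exists c].
have h3 := hsumZ ((level S)%:R * (m%:R ^- k * m%:R)) (usumP (Ac_asum (h, n))).
rewrite -(hsum_uniq h2 (eq_hsum _ h3)) // => c; by rewrite betaF_row.
Qed.

Lemma beta_csum n h : csummable (beta_index m) (beta_term R S k m n (lam S h)) /\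
  csum (beta_index m) (beta_term R S k m n (lam S h)) =
  (level S)%:R * (m%:R ^- k * m%:R) * usum (fun c => Acc c.+1 (h, n)).
Proof. exact: hsum_csum (beta_hsum n h). Qed.

Lemma Delta_al (n : int) h : ratr (Delta S m n (lam S h)) = m%:R * (n%:~R - al R S m h)%:C.
Proof.
have mR : m%:R != 0 :> R by rewrite pnatr_eq0 -lt0n.
rewrite ratrC (natC R m) -rmorphM; congr (_%:C).
rewrite /Delta -/(rho S h) raddfB /= !rmorphM /= ratr_int ratr_nat fmorphV /= ratr_nat.
rewrite (rho_qd hS) /al; by field.
Qed.

(** The level cancels from [(1 / q) ^ (j + 1) q ^ j q], and [m ^ (- k) m m ^ j] is the
    [m ^ (- N / 2)] in [thK]. *)
Lemma beta_eq (n : int) h : beta R S k m n (lam S h) =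
  cK R S k m * (n%:~R - al R S m h)%:C ^+ j * usum (fun c => Acc c.+1 (h, n)).
Proof.
have kE := jwE hm hN hk hkN.
have k1 : (k - N./2)%N = j.+1 by rewrite [in LHS]kE addKn.
rewrite /beta k1 subn1 /= (beta_csum n h).2 Delta_al /cK /thK /lipK.
have -> : \det (SR R S) = (\det S)%:~R by rewrite det_map_mx.
rewrite fmorphV expr_div_n !exprMn [X in m%:R ^- X]kE exprD !exprS.
have q0 : (level S)%:R != 0 :> R[i] by rewrite pnatr_eq0 -lt0n (level_gt0 hS).
have m0 : m%:R != 0 :> R[i] by rewrite pnatr_eq0 -lt0n.
have i0 : ('i%C : R[i]) != 0 by rewrite -normc_gt0 normc_i.
have f0 : (j`!)%:R != 0 :> R[i] by rewrite pnatr_eq0 -lt0n fact_gt0.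
move: (expf_neq0 j q0) (expf_neq0 j m0) (expf_neq0 N./2 m0) (expf_neq0 N./2 i0).
move: ((level S)%:R ^+ j) (m%:R ^+ j) (m%:R ^+ N./2) ('i%C ^+ N./2) => Qj Mj Mn In Qj0 Mj0 Mn0 In0.
move: ((level S)%:R : R[i]) (m%:R : R[i]) ((j`!)%:R : R[i]) q0 m0 f0 => Q M f Q0 M0 f0.
move: ((- (2 * ipi R)) ^+ j) (2 * ipi R) (_ ^+ j) (usum _) => P I2 D U.
move: ((Num.sqrt (\det S)%:~R : R)%:C^-1) => s.
by field; rewrite Q0 M0 f0 Qj0 Mj0 Mn0 In0.
Qed.

(** The condition [1 <= n] follows from [n m > (lambda, lambda) / 2 >= 0]. *)
Lemma fourier_indexP (n : int) h :
  fourier_index S m (n, lam S h) <-> al R S m h < n%:~R.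
Proof.
have m0 : 0 < m%:R :> rat by rewrite ltr0n.
have alE : (al R S m h < n%:~R) = (2^-1 * rho S h < n%:~R * m%:R).
  rewrite -(ltr_rat R) !rmorphM /= fmorphV /= !ratr_nat ratr_int (rho_qd hS) /al.
  have mR : 0 < m%:R :> R by rewrite ltr0n.
  rewrite ltr_pdivrMr ?mulr_gt0 //; move: (qd _ _) => Q.
  by rewrite [2^-1 * _]mulrC ltr_pdivrMr // mulrA mulrAC.
split=> [[_ _] /=|]; first by rewrite alE.
rewrite alE => h1; split=> //=; last by apply/dualP; exists h.
have h0 : 0 <= 2^-1 * rho S h by rewrite mulr_ge0 ?invr_ge0 ?(rho_ge0 hS).
have := le_lt_trans h0 h1.
by rewrite pmulr_lgt0 // ltr0z gtz0_ge1.
Qed.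

Lemma dual_reindex (D : set (int * 'cV[rat]_N)) (F : int * 'cV[rat]_N -> R[i]) s :
  (forall p, D p -> dual_lattice S p.2) ->
  hsum (fun q : 'cV[int]_N * int => if (q.2, lam S q.1) \in D then F (q.2, lam S q.1) else 0) s ->
  csummable D F /\ csum D F = s.
Proof.
move=> hD hs; apply: hsum_csum.
pose g (q : 'cV[int]_N * int) := (q.2, lam S q.1).
have ig : injective g by move=> [h n] [h' n'] [-> /(lam_inj hS) ->].
apply: (hsum_reindex (h := g) _ ig _).1 hs => -[n l].
case: ifP => [|_]; last by rewrite eqxx.
by rewrite inE => /hD /dualP[h /= <-] _; exists (h, n).
Qed.

End Beta.

(** * Holomorphy of exponential series *)

Lemma mx_norm_ge (K : numDomainType) m n (x : 'M[K]_(m, n)) ij : `|x ij.1 ij.2| <= `|x|.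
Proof. by rewrite [leRHS]/Num.Def.normr /= mx_normE -[leLHS]nngE num_le; exact: le_bigmax. Qed.

Section Holo.
Variables (R : realType) (N : nat).
Notation idx := ('cV[int]_N * int)%type.

Definition ex (q : idx) (tau : R[i]) (z : 'cV[R[i]]_N) : R[i] :=
  cexp (2 * ipi R * q.2%:~R * tau) * cexp (2 * ipi R * dot (intv R[i] q.1) z).

Lemma exE q tau z : ex q tau z = cexp (2 * ipi R * (q.2%:~R * tau + dot (intv R[i] q.1) z)).
Proof. by rewrite /ex -cexpD; congr cexp; ring. Qed.

Definition wt (q : idx) : R := `|q.2%:~R| + \sum_i `|(q.1 i 0)%:~R|.

Lemma wt_ge0 q : 0 <= wt q.
Proof. by rewrite addr_ge0 // sumr_ge0. Qed.

Lemma normc_lin q (h : R[i]) (g : 'cV[R[i]]_N) (t : R) : normc h <= t ->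
  (forall i, normc (g i 0) <= t) ->
  normc (2 * ipi R * (q.2%:~R * h + dot (intv R[i] q.1) g)) <= 2 * pi * (wt q * t).
Proof.
move=> ht gt; have pp := pi_gt0 R.
rewrite normcM normc_ipi2; apply: ler_wpM2l; first by rewrite mulr_ge0 // ltW.
rewrite /wt mulrDl mulr_suml.
apply: le_trans (normcD _ _) _; apply: lerD.
  by rewrite normcM normc_int ler_wpM2l.
rewrite dotE; apply: le_trans (normc_sum _ _ _) _; apply: ler_sum => i _.
by rewrite normcM mxE normc_int ler_wpM2l.
Qed.

Lemma sbound_sum (I : choiceType) (K : finType) (g : K -> I -> R) (M : K -> R) :
  (forall k, sbound (g k) (M k)) -> sbound (fun i => \sum_k g k i) (\sum_k M k).
Proof.
move=> h s us; rewrite exchange_big /=; apply: ler_sum => k _; exact: h.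
Qed.

Lemma ex_add q tau z (h : R[i]) g :
  ex q (tau + h) (z + g) = ex q tau z * cexp (2 * ipi R * (q.2%:~R * h + dot (intv R[i] q.1) g)).
Proof. by rewrite !exE -cexpD dotDr; congr cexp; ring. Qed.

Section Series.
Variables (a : idx -> R[i]) (phi : R[i] -> 'cV[R[i]]_N -> R[i]).
Hypothesis a0 : forall q, a q != 0 -> 0 <= q.2.
Hypothesis aphi : forall tau z, 0 < complex.Im tau ->
  asum (fun q => a q * ex q tau z) /\ hsum (fun q => a q * ex q tau z) (phi tau z).

(* Multiplying by [expR (2 * pi * r * wt q)] amounts to evaluating the exponential at a
   point whose imaginary parts are shifted by [r], with signs depending on [q]. *)
Lemma weighted_bound (tau : R[i]) z (r : R) : 0 < r -> r < complex.Im tau ->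
  exists M, sbound (fun q => normc (a q * ex q tau z) * expR (2 * pi * r * wt q)) M.
Proof.
move=> r0 rt.
pose sg (s : {ffun 'I_N -> bool}) : 'cV[R[i]]_N := \col_i (- ('i * ((-1) ^+ s i * r)%:C)).
have tr : 0 < complex.Im (tau - 'i * r%:C).
  by rewrite ImD ImN ImM /= mul0r mul1r add0r subr_gt0.
have hM s : exists M, sbound (fun q => normc (a q * ex q (tau - 'i * r%:C) (z + sg s))) M.
  by case: (aphi (z + sg s) tr).
have [M MP] := choice hM.
exists (\sum_s M s); apply: sbound_le (sbound_sum MP) => q.
have [->|an0] := eqVneq (a q) 0.
  by rewrite mul0r normc0 mul0r sumr_ge0 // => s _; exact: normc_ge0.
have n0 := a0 an0.
pose s0 : {ffun 'I_N -> bool} := [ffun i => q.1 i 0 < 0].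
rewrite (bigD1 s0) //= -[leLHS]addr0; apply: lerD; last by apply: sumr_ge0 => s _; exact: normc_ge0.
rewrite (ex_add q tau z) mulrA [leRHS]normcM; apply: ler_wpM2l; first exact: normc_ge0.
rewrite normc_cexp ler_expR.
have -> : dot (intv R[i] q.1) (sg s0) = - ('i * (r * \sum_i `|(q.1 i 0)%:~R|)%:C).
  rewrite dotE rmorphM rmorph_sum /= !mulr_sumr -sumrN; apply: eq_bigr => i _.
  rewrite !mxE ffunE (intC R (q.1 i 0)) mulrN; congr (- _).
  rewrite mulrCA; congr (_ * _); rewrite -!rmorphM; congr (_%:C); rewrite mulrA [RHS]mulrC; congr (_ * _).
  case: ltP => hq; first by rewrite ltr0_norm ?ltrz0 // expr1 mulrN1.
  by rewrite ger0_norm ?ler0z // expr0 mulr1.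
rewrite /wt ger0_norm ?ler0z // (intC R q.2).
set sm := \sum_i _; rewrite !ReM !ImM !ReD !ImD !ReN !ImN !ReM !ImM /=.
rewrite le_eqVlt; apply/orP; left; apply/eqP; ring.
Qed.

Lemma expR_ge_lin (y : R) : 0 <= y -> y <= expR y.
Proof. by move=> y0; apply: le_trans (expR_ge1Dx y); rewrite lerDr. Qed.

Lemma expR_ge_sqr (y : R) : 0 <= y -> y ^+ 2 <= 4 * expR y.
Proof.
move=> y0; have h := @expR_ge_lin (y / 2) (divr_ge0 y0 (ler0n _ 2)).
have -> : expR y = expR (y / 2) ^+ 2 by rewrite expr2 -expRD -splitr.
have y2 : 0 <= y / 2 by rewrite divr_ge0.
have : (y / 2) ^+ 2 <= expR (y / 2) ^+ 2 by rewrite lerXn2r ?nnegrE ?expR_ge0.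
by rewrite expr_div_n; lra.
Qed.

(** The candidates [A] and [B] are the termwise derivatives. The weight [exp (2 pi r wt)] is the
    square of [exp y]: one factor pays for the increment of the exponential, the other for the
    powers of the frequency. *)
Lemma holo_est (tau : R[i]) z : 0 < complex.Im tau ->
  exists (r C : R) (A : R[i]) (B : 'cV[R[i]]_N), [/\ 0 < r, 0 <= C &
  forall (h : R[i]) (g : 'cV[R[i]]_N) (t : R), t <= r -> normc h <= t -> (forall i, normc (g i 0) <= t) ->
    normc (phi (tau + h) (z + g) - phi tau z - (A * h + dot B g)) <= C * t ^+ 2].
Proof.
move=> t0; have pp := pi_gt0 R.
pose r := complex.Im tau / 2; have r0 : 0 < r by rewrite divr_gt0.
have rt : r < complex.Im tau by rewrite /r; lra.
have [M hM] := weighted_bound z r0 rt.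
pose E q := a q * ex q tau z.
pose y q := pi * r * wt q.
have y0 q : 0 <= y q by rewrite /y !mulr_ge0 ?wt_ge0 // ltW.
have wE q : 2 * pi * wt q = 2 / r * y q by rewrite /y; field; rewrite gt_eqF.
have lin_asum (c : idx -> R[i]) : (forall q, normc (c q) <= wt q) ->
    asum (fun q => E q * (2 * ipi R * c q)).
  move=> hc; exists (2 / r * M); have r2 : 0 <= 2 / r by rewrite divr_ge0 // ltW.
  apply: sbound_le (sboundZ r2 hM) => q.
  rewrite [leLHS]normcM [leRHS]mulrCA; apply: ler_wpM2l; first exact: normc_ge0.
  rewrite normcM normc_ipi2.
  apply: le_trans (_ : 2 * pi * wt q <= _); first by rewrite ler_wpM2l ?mulr_ge0 // ltW.
  rewrite wE ler_wpM2l //; apply: le_trans (expR_ge_lin (y0 q)) _.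
  rewrite ler_expR /y; have := y0 q; rewrite /y; nra.
have hA' : asum (fun q => E q * (2 * ipi R * q.2%:~R)).
  by apply: lin_asum => q; rewrite normc_int /wt lerDl sumr_ge0.
have [A hA] := asum_hsum hA'.
have hB i : exists b, hsum (fun q => E q * (2 * ipi R * (q.1 i 0)%:~R)) b.
  apply: asum_hsum; apply: lin_asum => q; rewrite normc_int /wt (bigD1 i) //=.
  by rewrite addrCA lerDl addr_ge0 // sumr_ge0.
have [b bP] := choice hB.
(* The constant is [8 * 16 * 2]: from [cexp_taylor2], from the square of the linear form, and from
   the two exponentials. The radius [r / 2] keeps the increment below [y q]. *)
exists (r / 2), (256 / r ^+ 2 * M), A, (\col_i b i); split.
- by rewrite divr_gt0.
- by rewrite !mulr_ge0 ?invr_ge0 ?exprn_ge0 ?(ltW r0) //; exact: sbound_ge0 hM.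
move=> h g t tr ht gt; have t0' : 0 <= t := le_trans (normc_ge0 _) ht.
have th : 0 < complex.Im (tau + h).
  rewrite ImD; have := normc_Im h; rewrite ler_norml => /andP[h1 _]; rewrite /r in tr; lra.
pose L q := 2 * ipi R * (q.2%:~R * h + dot (intv R[i] q.1) g).
have hs : hsum (fun q => a q * (ex q (tau + h) (z + g) - ex q tau z - ex q tau z * L q))
    (phi (tau + h) (z + g) - phi tau z - (A * h + dot (\col_i b i) g)).
  have h1 := hsumB (aphi (z + g) th).2 (aphi z t0).2.
  have h2 := hsum_bigsum (index_enum 'I_N) (fun i => hsumZ (g i 0) (bP i)).
  have h3 := hsumB h1 (hsumD (hsumZ h hA) h2).
  have -> : A * h + dot (\col_i b i) g = h * A + \sum_(i < N) g i 0 * b i.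
    rewrite [A * h]mulrC dotE; congr (_ + _); by apply: eq_bigr => i _; rewrite mxE mulrC.
  apply: eq_hsum h3 => q; rewrite /L /E dotE.
  have -> : \sum_(i < N) g i 0 * (a q * ex q tau z * (2 * ipi R * (q.1 i 0)%:~R)) =
     a q * ex q tau z * (2 * ipi R * \sum_i (intv R[i] q.1) i 0 * g i 0).
    rewrite !mulr_sumr; apply: eq_bigr => i _; rewrite mxE; ring.
  by ring.
rewrite [leRHS]mulrAC; apply: hsum_normc_le hs _.
have c0 : 0 <= 256 / r ^+ 2 * t ^+ 2 by rewrite !mulr_ge0 ?invr_ge0 ?exprn_ge0 ?(ltW r0).
apply: sbound_le (sboundZ c0 hM) => q.
rewrite [normc (a q * ex _ _ _)]normcM [leLHS]normcM.
set nx := normc (ex q tau z); set na := normc (a q).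
rewrite (_ : 256 / r ^+ 2 * t ^+ 2 * (na * nx * expR (2 * pi * r * wt q)) =
  na * (256 / r ^+ 2 * t ^+ 2 * (nx * expR (2 * pi * r * wt q)))); last by ring.
apply: ler_wpM2l; first exact: normc_ge0.
have nx0 : 0 <= nx by exact: normc_ge0.
have Lle : normc (L q) <= 2 / r * y q * t.
  by apply: le_trans (normc_lin q ht gt) _; rewrite mulrA wE.
have Ly : normc (L q) <= y q.
  apply: le_trans Lle _.
  rewrite [leRHS](_ : y q = 2 / r * y q * (r / 2)); last by field; rewrite gt_eqF.
  by apply: ler_wpM2l => //; rewrite mulr_ge0 // divr_ge0 // ltW.
have e1 : normc (cexp (L q)) <= expR (y q).
  by apply: normc_cexp_le; apply: le_trans (ler_norm _) (le_trans (normc_Re _) Ly).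
have e0 : 1 <= expR (y q) by apply: le_trans (expR_ge1Dx _); rewrite lerDl.
pose u := 2 * ipi R * (q.2%:~R * tau + dot (intv R[i] q.1) z).
have tay := cexp_taylor2 u (u + L q).
rewrite [u + L q - u]addrAC subrr add0r cexpD -exE -/(L q) in tay.
rewrite ex_add; apply: le_trans tay _; rewrite [normc (_ * cexp _)]normcM -/nx.
have -> : expR (2 * pi * r * wt q) = expR (y q) * expR (y q).
  by rewrite -expRD; congr expR; rewrite /y; ring.
have L2 : normc (L q) ^+ 2 <= 16 / r ^+ 2 * t ^+ 2 * expR (y q).
  apply: le_trans (_ : (2 / r * y q * t) ^+ 2 <= _).
    by rewrite lerXn2r ?nnegrE ?normc_ge0 // (le_trans (normc_ge0 _) Lle).
  rewrite (_ : (2 / r * y q * t) ^+ 2 = 4 / r ^+ 2 * t ^+ 2 * y q ^+ 2); last by field; rewrite gt_eqF.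
  rewrite (_ : 16 / r ^+ 2 * t ^+ 2 * expR (y q) = 4 / r ^+ 2 * t ^+ 2 * (4 * expR (y q))); last by field; rewrite gt_eqF.
  apply: ler_wpM2l; last exact: expR_ge_sqr.
  by rewrite !mulr_ge0 ?invr_ge0 ?exprn_ge0 // ltW.
have s2 : nx + nx * normc (cexp (L q)) <= 2 * nx * expR (y q).
  have : nx * normc (cexp (L q)) <= nx * expR (y q) by rewrite ler_wpM2l.
  have : nx * 1 <= nx * expR (y q) by rewrite ler_wpM2l.
  lra.
rewrite (_ : 256 / r ^+ 2 * t ^+ 2 * (nx * (expR (y q) * expR (y q))) =
  8 * (16 / r ^+ 2 * t ^+ 2 * expR (y q)) * (2 * nx * expR (y q))); last by field; rewrite gt_eqF.
apply: ler_pM => //.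
- by rewrite mulr_ge0 // exprn_ge0 // normc_ge0.
- by rewrite addr_ge0 // mulr_ge0 // normc_ge0.
- by rewrite ler_wpM2l.
Qed.

Lemma ge0_complexE (x : R[i]) : 0 <= x -> x = (complex.Re x)%:C.
Proof. by case: x => x y; rewrite lecE /= => /andP[/eqP -> _]. Qed.

Lemma normc_mx_le (g : 'cV[R[i]]_N) i : `|g i 0| <= `|g|.
Proof.
exact: (mx_norm_ge g (i, 0)).
Qed.

Lemma CxCN_norm_le (w : CxCN R N) : normc (w.1 : R[i]) <= complex.Re `|w| /\
  forall i, normc (w.2 i 0) <= complex.Re `|w|.
Proof.
have cmp : `|w.1| >=< `|w.2| by apply: real_comparable; exact: normr_real.
have wE := ge0_complexE (normr_ge0 w).
have h1 : `|w.1| <= `|w| by rewrite prod_normE comparable_le_max // lexx.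
have h2 : `|w.2| <= `|w| by rewrite prod_normE comparable_le_max // lexx orbT.
split=> [|i].
  by rewrite -lecR -wE -normcE'.
by rewrite -lecR -wE -normcE'; apply: le_trans h2; exact: normc_mx_le.
Qed.

Definition dlin (A : R[i]) (B : 'cV[R[i]]_N) (w : CxCN R N) : R[i]^o := A * w.1 + dot B w.2.

Lemma dlin_linear A B : linear (dlin A B).
Proof.
move=> c u v; rewrite /dlin /= dotDr dotZr -[c *: _ in RHS]/(c * _) -[c *: u.1]/(c * u.1); ring.
Qed.

HB.instance Definition _ A B :=
  GRing.isLinear.Build R[i] (CxCN R N) R[i]^o *:%R (dlin A B) (dlin_linear A B).

Lemma holomorphic_series : holomorphic_HC phi.
Proof.
move=> p hp.
have [r [C [A [B [r0 C0 est]]]]] := holo_est p.2 hp.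
have cont : continuous (dlin A B).
  apply/linear_bounded_continuous/ex_bound.
  pose K := normc A + \sum_i normc (B i 0).
  exists K%:C; apply: (nbhs_norm0P (V := CxCN R N)).2; exists 1 => //= w w1.
  have [w2 w3] := CxCN_norm_le w.
  have r1 : complex.Re `|w| <= 1.
    by have := ltW w1; rewrite lecE /= => /andP[].
  suff hK : normc (dlin A B w : R[i]) <= K by have := hK; rewrite -lecR -normcE'.
  rewrite /dlin /K; apply: le_trans (normcD _ _) _; apply: lerD.
    by rewrite normcM ler_piMr ?normc_ge0 // (le_trans w2).
  rewrite dotE; apply: le_trans (normc_sum _ _ _) _; apply: ler_sum => i _.
  by rewrite normcM ler_piMr ?normc_ge0 // (le_trans (w3 i)).
pose f (w : CxCN R N) : R[i]^o := phi w.1 w.2.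
have eo : f \o shift p = cst (f p) + dlin A B +o_ (0 : CxCN R N) id.
  apply/eqaddoP => e e0.
  have [e1 e1E e10] : exists2 e1 : R, e = e1%:C & 0 < e1.
    move: e0; case: e => x y; rewrite ltcE /= => /andP[/eqP -> x0]; by exists x.
  (* The quadratic estimate is little-o of the norm on this ball; [C + 1] avoids dividing by 0. *)
  pose d := Num.min r (e1 / (C + 1)).
  have d0 : 0 < d by rewrite lt_min r0 divr_gt0 // ltr_wpDl.
  apply: (nbhs_norm0P (V := CxCN R N)).2; exists d%:C => [|w wd] /=; first by rewrite ltcR.
  have [w2 w3] := CxCN_norm_le w; set t := complex.Re `|w| in w2 w3.
  have wE : `|w| = t%:C := ge0_complexE (normr_ge0 w).
  have td : t < d by rewrite -ltcR -wE.
  have t0 : 0 <= t := le_trans (normc_ge0 _) w2.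
  have tr : t <= r by apply: ltW (lt_le_trans td _); rewrite ge_min lexx.
  suff hw : normc (f (w + p) - (f p + dlin A B w) : R[i]) <= e1 * t.
    by rewrite e1E wE; have := hw; rewrite -lecR -normcE' rmorphM.
  rewrite opprD addrA /f /= [w.1 + p.1]addrC [w.2 + p.2]addrC.
  apply: le_trans (est _ _ _ tr w2 w3) _; rewrite expr2 mulrA; apply: ler_wpM2r => //.
  have : t <= e1 / (C + 1) by apply: ltW (lt_le_trans td _); rewrite ge_min lexx orbT.
  rewrite ler_pdivlMr ?ltr_wpDl //; nra.
have dE := diff_unique cont eo.
by apply/diff_locallyP; rewrite dE.
Qed.

End Series.
End Holo.

(** * The Fourier expansion *)

Section Final.
Variables (R : realType) (N : nat) (S : 'M[int]_N) (k m : nat).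
Hypotheses (hS : even_lattice R S) (hm : (0 < m)%N) (hN : ~~ odd N) (hk : ~~ odd k).
Hypothesis (hkN : (N + 4 <= k)%N).
Local Notation alh := (al R S m).

Lemma expo_ex (q : 'cV[int]_N * int) (tau : R[i]) z : expo S q.2 (lam S q.1) tau z = ex q tau z.
Proof. by rewrite /expo /ex lam_bil. Qed.

Lemma theta_csum (tau : R[i]) z Th : hsum (thT S m tau z) Th -> theta S m tau z = Th.
Proof.
move=> h; apply: (hsum_csum _).2; apply: eq_hsum h => x; by rewrite in_setT.
Qed.

(** The theta term of [x] is the Fourier term with [lambda = m x] and [n = m (x, x) / 2], which lies
    on the cone [Delta = 0]; the division by 2 is exact. *)
Definition thidx (x : 'cV[int]_N) : 'cV[int]_N * int :=
  (m%:Z *: (S *m x), m%:Z * (bl S x x %/ 2)%Z).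

Lemma lam_thidx x : lam S (thidx x).1 = m%:R *: intv rat x.
Proof.
have iv : intv rat (m%:Z *: (S *m x)) = map_mx intr S *m (m%:R *: intv rat x).
  by rewrite -scalemxAr /intv map_mxZ map_mxM.
by rewrite /lam /= iv mulKmx // (unitSQ hS).
Qed.

Lemma thidx_inj : injective thidx.
Proof.
move=> x y /(congr1 (fun q => lam S q.1)); rewrite !lam_thidx => /(congr1 (fun v => m%:R^-1 *: v)).
rewrite !scalerA mulVf ?pnatr_eq0 -?lt0n // !scale1r => /matrixP e.
by apply/matrixP => i j; have := e i j; rewrite !mxE => /intr_inj.
Qed.

Lemma half_bl x : bl S x x = 2 * (bl S x x %/ 2)%Z.
Proof.
have [e ->] := bl_even (symS hS) (evS hS) x.
by rewrite mulKz.
Qed.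

Lemma thT_ex (tau : R[i]) z x : thT S m tau z x = ex (thidx x) tau z.
Proof.
rewrite exE /thT /thidx /=; congr cexp.
have -> : dot (intv R[i] (m%:Z *: (S *m x))) z = m%:R * bil S (intv R[i] x) z.
  rewrite intvZ dotZl -pmulrn; congr (_ * _).
  by rewrite -[RHS]/(bl _ _ _) blE dot_mulmx (SC_sym hS) /intv map_mxM.
rewrite bil_intv {1}half_bl !intrM -!pmulrn; ring.
Qed.

(** All Fourier coefficients at once: [beta] where [Delta > 0], and the theta contribution where
    [Delta = 0]. *)
Definition fcoef (q : 'cV[int]_N * int) : R[i] :=
  (if alh q.1 < q.2%:~R then beta R S k m q.2 (lam S q.1) else 0) +
  (if q \in range thidx then 1 else 0).

Lemma pos_expansion (tau : R[i]) z sp :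
  hsum (fun p => usum (fun c => Ac R S k m c.+1 p) * (cK R S k m * Bt S m (jw N k) tau z p)) sp ->
  hsum (fun q => (if alh q.1 < q.2%:~R then beta R S k m q.2 (lam S q.1) else 0) * ex q tau z) sp.
Proof.
apply: eq_hsum => -[h n]; rewrite /Bt /=; case: ifP => _; last by rewrite !mulr0 mul0r.
by rewrite beta_eq // /ex /=; ring.
Qed.

Lemma pos_asum (tau : R[i]) z : 0 < complex.Im tau ->
  asum (fun q => (if alh q.1 < q.2%:~R then beta R S k m q.2 (lam S q.1) else 0) * ex q tau z).
Proof.
move=> t0; have [M hM] := Bt_asum (jw N k) hS hm z t0.
exists (4 * normc (cK R S k m) * M).
have c0 : 0 <= 4 * normc (cK R S k m) by rewrite mulr_ge0 // normc_ge0.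
apply: sbound_le (sboundZ c0 hM) => -[h n].
have U : normc (usum (fun c => Ac R S k m c.+1 (h, n))) <= 4.
  by apply: usum_le; apply: sbound_le (inv1sq_nat R) => c; exact: Ac_bound.
rewrite /Bt; rewrite -[(h, n).1]/h -[(h, n).2]/n; case: ifP => _; last first.
  by rewrite mul0r normc0 mulr0.
rewrite beta_eq // /ex -[(h, n).1]/h -[(h, n).2]/n.
set E := cexp _ * cexp _; set D := _ ^+ _; set u := usum _ in U *; set K := cK _ _ _ _ in c0 *.
rewrite (_ : K * D * u * E = u * (K * (D * E))); last by ring.
rewrite normcM [normc (K * _)]normcM mulrA; apply: ler_wpM2r; first exact: normc_ge0.
by apply: ler_wpM2r; first exact: normc_ge0.
Qed.

Lemma th_reindex (tau : R[i]) z :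
  (fun x => (if thidx x \in range thidx then 1 else 0) * ex (thidx x) tau z) =1 thT S m tau z.
Proof.
move=> x; rewrite ifT ?mul1r -?thT_ex //.
by rewrite inE; exists x.
Qed.

Lemma th_supp (tau : R[i]) z (q : 'cV[int]_N * int) :
  (if q \in range thidx then 1 else 0) * ex q tau z != 0 -> exists x, thidx x = q.
Proof.
case: ifP => [|_]; last by rewrite mul0r eqxx.
by rewrite inE => -[x _ <-] _; exists x.
Qed.

Lemma eis_fourier (tau : R[i]) z : 0 < complex.Im tau ->
  asum (fun q => fcoef q * ex q tau z) /\
  hsum (fun q => fcoef q * ex q tau z) (eisenstein S k m tau z).
Proof.
move=> t0; have [Th [sp [hTh hsp ->]]] := eis_expansion hS hm hN hk hkN z t0.
have a1 := pos_asum z t0; have h1 := pos_expansion hsp.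
pose g q := (if q \in range thidx then 1 else 0) * ex q tau z.
have a2 : asum g.
  apply/(asum_reindex (f := g) thidx_inj (@th_supp tau z)).
  exact: eq_asum (fsym (th_reindex tau z)) (thT_asum hS hm hkN z t0).
have h2 : hsum g Th.
  apply/(hsum_reindex (f := g) _ thidx_inj (@th_supp tau z)).
  exact: eq_hsum (fsym (th_reindex tau z)) hTh.
split.
  case: a1 => M1 hM1; case: a2 => M2 hM2; exists (M1 + M2).
  by apply: sbound_le (sboundD hM1 hM2) => q; rewrite /fcoef mulrDl; exact: normcD.
by rewrite addrC; apply: eq_hsum (hsumD h1 h2) => q; rewrite /g /fcoef mulrDl.
Qed.

Lemma fcoef_supp q : fcoef q != 0 -> 0 <= 2 * q.2%:~R * m%:R - rho S q.1.
Proof.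
have m0 : 0 < m%:R :> R by rewrite ltr0n.
case: (boolP (q \in range thidx)) => [|nq].
  rewrite inE => -[x _ <-] _; rewrite /rho lam_thidx.
  have -> : bil S (m%:R *: intv rat x) (m%:R *: intv rat x) = m%:R * (m%:R * (bl S x x)%:~R).
    by rewrite -[LHS]/(bl _ _ _) blZl blZr; congr (_ * (_ * _)); exact: (bil_intv S rat x x).
  rewrite -[(thidx x).2]/(m%:Z * (bl S x x %/ 2)%Z) [in X in _ - X]half_bl !intrM -!pmulrn.
  by rewrite le_eqVlt; apply/orP; left; apply/eqP; ring.
rewrite /fcoef (negbTE nq) addr0; case: ifP => [h _|_]; last by rewrite eqxx.
rewrite -(ler0q R) raddfB /= !rmorphM /= ratr_int !ratr_nat (rho_qd hS) subr_ge0.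
move: h; rewrite /al ltr_pdivrMr ?mulr_gt0 // => h; apply: ltW; apply: lt_le_trans h _.
by rewrite mulrCA mulrA.
Qed.

Lemma fcoef_ge0 q : fcoef q != 0 -> 0 <= q.2.
Proof.
move=> /fcoef_supp; rewrite subr_ge0 => h; have := le_trans (rho_ge0 hS q.1) h.
have m0 : 0 < m%:R :> rat by rewrite ltr0n.
by rewrite pmulr_lge0 // pmulr_rge0 // ler0z.
Qed.

Lemma eis_jacobi : jacobi_form S k m (eisenstein S k m : R[i] -> 'cV[R[i]]_N -> R[i]).
Proof.
split.
- exact: holomorphic_series fcoef_ge0 eis_fourier.
- move=> M x y tau z dM t0; rewrite -[RHS](eis_heis hS hm x y z hkN t0) /slash_heis.
  by congr (_ * _); exact: eis_SL2.
(* A coefficient function on rational vectors is required; the coordinates of a dual vector [l] are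
   those of [S l], and the floor reads them as integers. *)
- exists (fun n l => fcoef (map_mx (@Num.floor rat) (map_mx intr S *m l), n)) => tau z t0 D t.
  suff [c1 c2] : csummable D t /\ csum D t = eisenstein S k m tau z by split.
  apply: (dual_reindex hS) => [p []//|].
  apply: eq_hsum (eis_fourier z t0).2 => -[h n].
  have fl : map_mx (@Num.floor rat) (map_mx intr S *m lam S h) = h.
    by rewrite (SQ_lam hS); apply/matrixP => i i'; rewrite !mxE intrKfloor.
  rewrite /t -[(h, n).1]/h -[(h, n).2]/n -[(n, lam S h).1]/n -[(n, lam S h).2]/(lam S h).
  rewrite fl (expo_ex (h, n)); case: ifP => // /negbT nD.
  have [->|/fcoef_supp f0] := eqVneq (fcoef (h, n)) 0; first by rewrite mul0r.
  case/negP: nD; rewrite inE /D /=; split=> //; by apply/dualP; exists h.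
Qed.

Lemma eis_main (tau : R[i]) z : 0 < complex.Im tau ->
  let t := fun p : int * 'cV[rat]_N => beta R S k m p.1 p.2 * expo S p.1 p.2 tau z in
  csummable (fourier_index S m) t /\
  eisenstein S k m tau z = theta S m tau z + csum (fourier_index S m) t.
Proof.
move=> t0 t; have [Th [sp [hTh hsp ->]]] := eis_expansion hS hm hN hk hkN z t0.
rewrite (theta_csum hTh).
suff [c1 ->] : csummable (fourier_index S m) t /\ csum (fourier_index S m) t = sp by [].
apply: (dual_reindex hS) => [p []//|].
apply: eq_hsum (pos_expansion hsp) => -[h n].
rewrite /t -[(h, n).1]/h -[(h, n).2]/n -[(n, lam S h).1]/n -[(n, lam S h).2]/(lam S h).
have -> : ((n, lam S h) \in fourier_index S m) = (alh h < n%:~R).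
  have fi : fourier_index S m (n, lam S h) <-> alh h < n%:~R by exact: fourier_indexP.
  by apply/idP/idP => [|/fi hh]; rewrite inE // => /fi.
by case: ifP => _; rewrite ?mul0r // (expo_ex (h, n)).
Qed.

End Final.

(** Parity sharpens the strict inequality to the gap of 4 on which the convergence estimates
    rest. *)
Lemma even_gap (N k : nat) : ~~ odd N -> ~~ odd k -> (2 + N < k)%N -> (N + 4 <= k)%N.
Proof. lia. Qed.

(** As [csum] has a meaning only for summable families, summability is asserted along with the
    values for the Eisenstein series, the singular series and the Fourier series. *)
Theorem theorem2p3 (R : realType) (N : nat) (S : 'M[int]_N) (k m : nat)
  (hS : even_lattice R S) (hN : ~~ odd N) (hk : ~~ odd k)
  (hm : (0 < m)%N) (hkN : (2 + N < k)%N) :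
  [/\ forall (tau : R[i]) (z : 'cV[R[i]]_N), upper_half tau ->
        csummable (eis_index N) (eis_term S k m tau z),
      jacobi_form S k m (eisenstein S k m : R[i] -> 'cV[R[i]]_N -> R[i]),
      forall (n : int) (l : 'cV[rat]_N), fourier_index S m (n, l) ->
        csummable (beta_index m) (beta_term R S k m n l) &
      forall (tau : R[i]) (z : 'cV[R[i]]_N), upper_half tau ->
        let t := fun p : int * 'cV[rat]_N =>
          beta R S k m p.1 p.2 * expo S p.1 p.2 tau z in
        csummable (fourier_index S m) t /\
        eisenstein S k m tau z = theta S m tau z + csum (fourier_index S m) t].
Proof.
have gap := even_gap hN hk hkN; split.
- by move=> tau z t0; case: (eis_hsum hS hm z gap t0).
- exact: eis_jacobi.
- move=> n l [_ hd _]; have [h <-] := (dualP S l).1 hd.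
  by apply: proj1; apply: beta_csum.
- by move=> tau z t0; exact: eis_main.
Qed.
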